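(* Let $A=\mathbb{F}[t]$, $F$ a finite extension of $K=\mathbb{F}(t)$ with $\kappa:A\to F$ the inclusion and $\theta=\kappa(t)$, $\mathfrak{p}$ a finite place of $F$ with completion $F_{\mathfrak{p}}$, valuation ring $\mathcal{O}_{\mathfrak{p}}$, $\mathfrak{m}=\mathfrak{p}\cap A$, and $\ell\neq\mathfrak{m}$ a maximal ideal of $A$. Let $p$ be the characteristic of $\mathbb{F}$, $k\ge0$ an integer, $n=p^k$, and $\underline{M}=\underline{A}(n)$ over $F_{\mathfrak{p}}$. Then $$\operatorname{Ext}^{1,\mathrm{reg}}_{\mathcal{O}_{\mathfrak{p}}}(\mathbbm{1},\underline{M})=\operatorname{Ext}^{1,\mathrm{reg}}_{\mathrm{good}}(\mathbbm{1},\underline{M})_\ell.$$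
   Context: $\mathbb{F}$ finite with $q$ elements. Here $A\otimes F_{\mathfrak{p}}=F_{\mathfrak{p}}[t]$, $\tau$ raises coefficients to the $q$-th power (write $f^{(1)}=\tau(f)$), $\mathfrak{j}=(t-\theta)$. $\underline{A}(n)$ is the $A$-motive $(F_{\mathfrak{p}}[t],\tau_M)$ with $\tau_M(\tau^*f)=(t-\theta)^{-n}f^{(1)}$ (the dual of the $n$-th tensor power of the Carlitz motive); $\mathbbm{1}=(F_{\mathfrak{p}}[t],\tau^*f\mapsto f^{(1)})$. $\iota:M[\mathfrak{j}^{-1}]=F_{\mathfrak{p}}[t,(t-\theta)^{-1}]\to\operatorname{Ext}^1(\mathbbm{1},\underline{M})$ (Yoneda Ext of $A$-motives over $F_{\mathfrak{p}}$) sends $m$ to the class of $(F_{\mathfrak{p}}[t]^2,\begin{pmatrix}\tau_M&m\mathbf{1}\\0&\mathbf{1}\end{pmatrix})$; it is surjective with kernel $(\operatorname{id}-\tau_M)(M)$. Regulated extensions (Hodge polygon equal to that of $\underline{M}\oplus\mathbbm{1}$) form $\operatorname{Ext}^{1,\mathrm{reg}}(\mathbbm{1},\underline{M})=\iota(M+\tau_M(\tau^*M))$. $M_{\mathcal{O}}$ is the largest finitely generated $\mathcal{O}_{\mathfrak{p}}[t]$-submodule $L$ of $M$ generating $M$ with $\tau_M(\tau^*L)\subset L[(t-\theta)^{-1}]$, and $\operatorname{Ext}^1_{\mathcal{O}_{\mathfrak{p}}}(\mathbbm{1},\underline{M})=\iota(M_{\mathcal{O}}[(t-\theta)^{-1}])$.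 With $F_{\mathfrak{p}}^{\mathrm{ur}}$ the maximal unramified extension and $\widehat{F^{\mathrm{ur}}_{\mathfrak{p}}[t]}_\ell$ the $\ell$-adic completion of $F_{\mathfrak{p}}^{\mathrm{ur}}[t]$, $\iota(m)$ has good reduction with respect to $\ell$ iff $\xi-\tau_M(\tau^*\xi)=m$ has a solution $\xi\in\widehat{F^{\mathrm{ur}}_{\mathfrak{p}}[t]}_\ell$ (equivalently its $\ell$-adic Galois realization splits on inertia); these classes form $\operatorname{Ext}^1_{\mathrm{good}}(\mathbbm{1},\underline{M})_\ell$. The superscript $\mathrm{reg}$ denotes intersection with $\operatorname{Ext}^{1,\mathrm{reg}}(\mathbbm{1},\underline{M})$. *)

(* Defs.v *)
From HB Require Import structures.
From mathcomp Require Import all_boot all_order all_algebra all_field.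
From mathcomp Require Import boolp classical_sets.

Set Implicit Arguments.
Unset Strict Implicit.
Unset Printing Implicit Defensive.

Import Order.TTheory GRing.Theory Num.Theory.
Local Open Scope classical_set_scope.
Local Open Scope ring_scope.

(* The value of v at 0 is irrelevant: val_ge treats v 0 as +oo. *)
Definition val_ge (K : fieldType) (v : K -> int) (n : int) (x : K) : bool :=
  (x == 0) || (n <= v x).

(* v is normalized: its value group is all of Z. *)
Record discrete_valuation (K : fieldType) (v : K -> int) : Prop := {
  dv_mul : forall x y, x != 0 -> y != 0 -> v (x * y) = v x + v y;
  dv_add : forall n x y, val_ge v n x -> val_ge v n y -> val_ge v n (x + y);
  dv_norm : exists2 x, x != 0 & v x = 1 }.

Definition val_complete (K : fieldType) (v : K -> int) : Prop :=
  forall u : nat -> K,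
    (forall n : int, exists N : nat, forall i j,
        (N <= i)%N -> (N <= j)%N -> val_ge v n (u i - u j)) ->
    exists l : K, forall n : int, exists N : nat, forall i,
        (N <= i)%N -> val_ge v n (u i - l).

(* (Fp, w), with the embedding j, is the completion of (F, v); this determines
   (Fp, w, j) up to unique isomorphism. *)
Record is_completion (F : fieldType) (v : F -> int)
    (Fp : fieldType) (j : {rmorphism F -> Fp}) (w : Fp -> int) : Prop := {
  compl_dv : discrete_valuation w;
  compl_ext : forall x, x != 0 -> w (j x) = v x;
  compl_complete : val_complete w;
  compl_dense : forall (n : int) (y : Fp), exists x : F, val_ge w n (y - j x) }.

Definition algebraic_closure (K : fieldType) (L : closedFieldType)
    (b : {rmorphism K -> L}) : Prop :=
  forall x : L, exists2 g : {poly K}, g != 0 & root (map_poly b g) x.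

Section Unramified.
Variables (K : fieldType) (w : K -> int).
Variables (L : closedFieldType) (b : {rmorphism K -> L}).

Definition integral_over_O (y : L) : Prop :=
  exists2 g : {poly K},
    g \is monic /\ (forall i, val_ge w 0 g`_i) & root (map_poly b g) y.

(* x lies in the maximal unramified extension of K inside its algebraic closure
   L iff K(x)/K is unramified, i.e. has ramification index 1 (the residue field
   of K is finite here, so residue extensions are automatically separable).  As
   K is complete, y in L^* has the same valuation as c in K^* iff y / c is a
   unit of the integral closure of O_K; as x is algebraic, K(x) = K[x]. *)
Definition max_unramified (x : L) : Prop :=
  forall g : {poly K}, let y := (map_poly b g).[x] in y != 0 ->
    exists2 c : K, c != 0 &
      integral_over_O (y / b c) /\ integral_over_O (b c / y).

End Unramified.

(* f |-> f^(1) *)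
Definition twist (R : nzRingType) (q m n : nat) (f : 'M[{poly R}]_(m, n)) :
    'M[{poly R}]_(m, n) :=
  map_mx (map_poly (fun x => x ^+ q)) f.

Definition to_frac (K : fieldType) m n (f : 'M[{poly K}]_(m, n)) :
    'M[{fraction {poly K}}]_(m, n) := map_mx (@tofrac _) f.

(* K is an A-field, A = Fq[t], with structure map kappa. *)
Section Motives.
Variables (Fq : finFieldType) (K : fieldType).
Variables (kappa : {rmorphism {poly Fq} -> K}).

Local Notation q := #|Fq|.
Local Notation theta := (kappa 'X).

Definition jgen : {fraction {poly K}} := tofrac ('X - theta%:P).

(* L[(t - theta)^-1], for a set L of polynomial matrices *)
Definition localize m n (L : set 'M[{poly K}]_(m, n)) :
    set 'M[{fraction {poly K}}]_(m, n) :=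
  [set x | exists N : nat, exists2 y, L y & jgen ^+ N *: x = to_frac y].

Lemma jgen_neq0 : jgen != 0.
Proof. by rewrite tofrac_eq0 polyXsubC_eq0. Qed.

Lemma localize_poly m n (y : 'M[{poly K}]_(m, n)) : localize setT (to_frac y).
Proof. by exists 0; exists y => //; rewrite expr0 scale1r. Qed.

Lemma localize_mul m n p (x : 'M_(m, n)) (y : 'M_(n, p)) :
  localize setT x -> localize setT y -> localize setT (x *m y).
Proof.
move=> [N [u _ hu]] [N' [u' _ hu']]; exists (N + N')%N; exists (u *m u') => //.
by rewrite /to_frac map_mxM -/(to_frac u) -/(to_frac u') -hu -hu' -scalemxAl
  -scalemxAr scalerA exprD.
Qed.

Lemma localize_opp m n (x : 'M_(m, n)) :
  localize setT x -> localize setT (- x).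
Proof.
move=> [N [u _ hu]]; exists N; exists (- u) => //.
by rewrite scalerN hu /to_frac map_mxN.
Qed.

Lemma localize_block m n p r (x : 'M_(m, p)) (y : 'M_(m, r)) (z : 'M_(n, p))
    (s : 'M_(n, r)) :
  localize setT x -> localize setT y -> localize setT z -> localize setT s ->
  localize setT (block_mx x y z s).
Proof.
have up k l (a : 'M_(k, l)) N N' c : jgen ^+ N *: a = to_frac c -> (N <= N')%N ->
    exists c', jgen ^+ N' *: a = to_frac c'.
  move=> h le; exists (('X - theta%:P) ^+ (N' - N) *: c).
  rewrite -(subnK le) exprD -scalerA h addnK; apply/matrixP=> i j.
  by rewrite !mxE rmorphM rmorphXn.
move=> [N1 [u1 _ /up h1]] [N2 [u2 _ /up h2]] [N3 [u3 _ /up h3]] [N4 [u4 _ /up h4]].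
pose N := maxn (maxn N1 N2) (maxn N3 N4).
have [|c1 {}h1] := h1 N; first by rewrite !leq_max leqnn.
have [|c2 {}h2] := h2 N; first by rewrite !leq_max leqnn !orbT.
have [|c3 {}h3] := h3 N; first by rewrite !leq_max leqnn !orbT.
have [|c4 {}h4] := h4 N; first by rewrite !leq_max leqnn !orbT.
exists N; exists (block_mx c1 c2 c3 c4) => //.
by rewrite scale_block_mx h1 h2 h3 h4 /to_frac map_block_mx.
Qed.

(* K[t] is a PID, so an A-motive of rank r over K is, in a basis of its
   underlying module, (K[t]^r, tau_M) with tau_M (tau^* f) = Phi *m f^(1) on
   column vectors f, where Phi is in GL_r(K[t, (t - theta)^-1]). *)
Record motive (r : nat) := Motive {
  Phi :> 'M[{fraction {poly K}}]_r;
  Phi_localize : localize setT Phi;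
  Phi_unit : Phi \in unitmx;
  Phi_inv_localize : localize setT (invmx Phi) }.

Definition tauM r (M : motive r) n (f : 'M[{poly K}]_(r, n)) :
    'M[{fraction {poly K}}]_(r, n) := M *m to_frac (twist q f).

Definition morphism r s (M : motive r) (N : motive s)
    (f : 'M[{poly K}]_(s, r)) : Prop :=
  to_frac f *m M = tauM N f.

Section Block.
Variables (r s : nat) (M : motive r) (N : motive s).
Variables (m : 'M[{fraction {poly K}}]_(r, s)) (hm : localize setT m).

Let mx := block_mx M m 0 N.
Let mx' := block_mx (invmx M) (- (invmx M *m m *m invmx N)) 0 (invmx N).

Lemma block_motiveK : mx *m mx' = 1%:M.
Proof.
rewrite mulmx_block !mulmx0 !mul0mx !addr0 !add0r mulmxN !mulmxA.
by rewrite !mulmxV ?Phi_unit // mul1mx addNr -scalar_mx_block.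
Qed.

Lemma block_motive_unit : mx \in unitmx.
Proof. exact: (mulmx1_unit block_motiveK).1. Qed.

Lemma localize0 k l : localize setT (0 : 'M_(k, l)).
Proof. by exists 0; exists 0 => //; rewrite scaler0 /to_frac map_mx0. Qed.

Lemma block_motive_localize : localize setT mx.
Proof.
by apply: localize_block => //; [exact: Phi_localize | exact: localize0
  | exact: Phi_localize].
Qed.

Lemma block_motive_inv_localize : localize setT (invmx mx).
Proof.
have -> : invmx mx = mx'.
  by rewrite -[RHS](mulKmx block_motive_unit) block_motiveK mulmx1.
apply: localize_block; try exact: Phi_inv_localize; last exact: localize0.
apply: localize_opp; apply: localize_mul; last exact: Phi_inv_localize.
by apply: localize_mul => //; exact: Phi_inv_localize.
Qed.

Definition block_motive : motive (r + s) :=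
  Motive block_motive_localize block_motive_unit block_motive_inv_localize.

End Block.

Definition direct_sum r s (M : motive r) (N : motive s) : motive (r + s) :=
  block_motive M N (localize0 r s).

Lemma unit_motive_localize : localize setT (1%:M : 'M_1).
Proof.
by exists 0; exists 1%:M => //; rewrite expr0 scale1r /to_frac map_mx1.
Qed.

Lemma unit_motive_inv_localize : localize setT (invmx (1%:M : 'M_1)).
Proof. by rewrite invmx1; exact: unit_motive_localize. Qed.

Definition unit_motive : motive 1 :=
  Motive unit_motive_localize (unitmx1 _ _) unit_motive_inv_localize.

Section CarlitzDual.
Variable n : nat.

Lemma carlitz_dual_unit : ((jgen ^- n)%:M : 'M_1) \in unitmx.
Proof. by rewrite unitmxE det_scalar1 unitfE invr_neq0 // expf_neq0 // jgen_neq0. Qed.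

Lemma carlitz_dual_localize : localize setT ((jgen ^- n)%:M : 'M_1).
Proof.
exists n; exists 1%:M => //.
by rewrite scale_scalar_mx divff ?expf_neq0 ?jgen_neq0 // /to_frac map_mx1.
Qed.

Lemma carlitz_dual_inv_localize : localize setT (invmx ((jgen ^- n)%:M : 'M_1)).
Proof.
rewrite invmx_scalar invrK; exists 0; exists (('X - theta%:P) ^+ n)%:M => //.
rewrite expr0 scale1r /to_frac map_scalar_mx /=; congr (_%:M).
by rewrite rmorphXn.
Qed.

(* A(n) : tau_M (tau^* f) = (t - theta)^-n f^(1) *)
Definition carlitz_dual : motive 1 :=
  Motive carlitz_dual_localize carlitz_dual_unit carlitz_dual_inv_localize.

End CarlitzDual.

Section Extensions.
Variables (r : nat) (M : motive r).

(* Ranks add in exact sequences, so the middle term has rank r + 1. *)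
Record extension := Extension {
  ext_mid :> motive (r + 1);
  ext_inj : 'M[{poly K}]_(r + 1, r);
  ext_proj : 'M[{poly K}]_(1, r + 1);
  ext_inj_morphism : morphism M ext_mid ext_inj;
  ext_proj_morphism : morphism ext_mid unit_motive ext_proj;
  ext_exact_left : forall x : 'cV_r, ext_inj *m x = 0 -> x = 0;
  ext_exact_mid : forall x : 'cV_(r + 1),
    ext_proj *m x = 0 <-> exists y : 'cV_r, x = ext_inj *m y;
  ext_exact_right : forall z : 'cV_1,
    exists x : 'cV_(r + 1), ext_proj *m x = z }.

Definition ext_equiv (E E' : extension) : Prop :=
  exists h : 'M[{poly K}]_(r + 1),
    [/\ h \in unitmx, morphism E E' h,
        h *m ext_inj E = ext_inj E' & ext_proj E' *m h = ext_proj E].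

(* Ext^1(1, M) is the set of all ext_class E; subsets of it are sets of sets. *)
Definition ext_class (E : extension) : set extension :=
  [set E' | ext_equiv E E'].

Section Iota.
Variables (m : 'M[{fraction {poly K}}]_(r, 1)) (hm : localize setT m).

Let E := block_motive M unit_motive hm.
Let inj : 'M[{poly K}]_(r + 1, r) := col_mx 1%:M 0.
Let proj : 'M[{poly K}]_(1, r + 1) := row_mx 0 1%:M.

Lemma twist0 k l : twist q (0 : 'M[{poly K}]_(k, l)) = 0.
Proof.
by apply/matrixP=> i j; rewrite !mxE map_poly0.
Qed.

Lemma twist1 k : twist q (1%:M : 'M[{poly K}]_k) = 1%:M.
Proof.
have q0 : 0 ^+ q = 0 :> K.
  by rewrite expr0n -[#|Fq|]prednK //; apply/card_gt0P; exists 0.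
apply/matrixP=> i j; rewrite !mxE; case: eqP => _ /=; last by rewrite map_poly0.
apply/polyP=> d; rewrite coef_map_id0 // !coef1.
by case: eqP => _; rewrite ?expr1n ?q0.
Qed.

Lemma iota_inj_morphism : morphism M E inj.
Proof.
rewrite /morphism /tauM /= /twist map_col_mx -/(twist q _) -/(twist q _).
rewrite twist0 twist1 /to_frac !map_col_mx !map_mx0 !map_mx1.
by rewrite mul_col_mx mul_block_col !mul1mx !mul0mx !mulmx0 mulmx1 !addr0.
Qed.

Lemma iota_proj_morphism : morphism E unit_motive proj.
Proof.
rewrite /morphism /tauM /= /twist map_row_mx -/(twist q _) -/(twist q _).
rewrite twist0 twist1 /to_frac !map_row_mx !map_mx0 !map_mx1.
by rewrite mul_row_block !mul1mx !mul0mx !add0r.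
Qed.

Lemma iota_exact_left (x : 'cV_r) : inj *m x = 0 -> x = 0.
Proof.
by rewrite mul_col_mx mul1mx mul0mx -[RHS]col_mx0 => /eq_col_mx[].
Qed.

Lemma iota_exact_mid (x : 'cV_(r + 1)) :
  proj *m x = 0 <-> exists y : 'cV_r, x = inj *m y.
Proof.
rewrite -[x]vsubmxK mul_row_col mul0mx add0r mul1mx; split=> [->|[y]].
  by exists (usubmx x); rewrite mul_col_mx mul1mx mul0mx.
by rewrite mul_col_mx mul1mx mul0mx => /eq_col_mx[].
Qed.

Lemma iota_exact_right (z : 'cV_1) : exists x : 'cV_(r + 1), proj *m x = z.
Proof. by exists (col_mx 0 z); rewrite mul_row_col mul0mx add0r mul1mx. Qed.

(* (M + 1, [[tau_M, m . 1], [0, 1]]), for m in M[(t - theta)^-1] *)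
Definition iota : extension :=
  Extension iota_inj_morphism iota_proj_morphism
    iota_exact_left iota_exact_mid iota_exact_right.

End Iota.
End Extensions.

(* w is the nondecreasing sequence of slopes of the Hodge polygon of M, i.e. the
   elementary divisors of tau_M(tau^* M) relative to M at (t - theta): M has a
   K[t]-basis (e_i), the columns of P, such that the (t - theta)^(w_i) e_i form
   a basis of tau_M(tau^* M).  As Phi is invertible away from (t - theta), the
   global and the local elementary divisors agree. *)
Definition hodge_slopes r (M : motive r) (w : r.-tuple int) : Prop :=
  sorted <=%O w /\
  exists P Q : 'M[{poly K}]_r,
    [/\ P \in unitmx, Q \in unitmx &
        Phi M = to_frac P *m diag_mx (\row_i jgen ^ tnth w i) *m to_frac Q].

Definition same_hodge_polygon r (M M' : motive r) : Prop :=
  exists w, hodge_slopes M w /\ hodge_slopes M' w.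

Definition Ext1reg r (M : motive r) : set (set (extension M)) :=
  [set C | exists2 E, C = ext_class E &
     same_hodge_polygon E (direct_sum M unit_motive)].

Section Integral.
Variables (w : K -> int) (r : nat) (M : motive r).

Definition polyO m n (f : 'M[{poly K}]_(m, n)) : Prop :=
  forall i j k, val_ge w 0 (f i j)`_k.

(* L is a finitely generated O[t]-submodule of M = K[t]^r (spanned by the
   columns of G) that generates M and is stable under tau_M up to inverting
   (t - theta). *)
Definition integral_model (L : set 'cV[{poly K}]_r) : Prop :=
  (exists d (G : 'M[{poly K}]_(r, d)),
     L = [set G *m c | c in [set c : 'cV_d | polyO c]] /\
     forall x : 'cV_r, exists c : 'cV_d, x = G *m c) /\
  forall x, L x -> localize L (tauM M x).

Definition max_integral_model (L : set 'cV[{poly K}]_r) : Prop :=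
  integral_model L /\ forall L', integral_model L' -> L' `<=` L.

Definition Ext1O : set (set (extension M)) :=
  [set C | exists MO, max_integral_model MO /\
     exists m (hm : localize setT m), localize MO m /\ C = ext_class (iota M hm)].

End Integral.

Section Good.
Variables (w : K -> int) (L : closedFieldType) (b : {rmorphism K -> L}).
Variables (l : {poly Fq}) (r : nat) (M : motive r).

(* ell, as an element of L[t] *)
Definition ellL : {poly L} := map_poly (fun a => b (kappa a%:P)) l.

Definition cong (i : nat) (f g : 'cV[{poly L}]_r) : Prop :=
  forall a c, ellL ^+ i %| f a c - g a c.

(* xi, a coherent sequence of vectors over K^ur[t] modulo ell^i, is an element
   of the ell-adic completion of K^ur[t]^r. *)
Definition in_completion (xi : nat -> 'cV[{poly L}]_r) : Prop :=
  (forall i a c k, max_unramified w b (xi i a c)`_k) /\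
  forall i, cong i (xi i.+1) (xi i).

(* xi - tau_M(tau^* xi) = m in the completion.  There (t - theta) is a unit, so
   the equation is stated after multiplication by a power of (t - theta) that
   clears the denominators of tau_M and m. *)
Definition solves (xi : nat -> 'cV[{poly L}]_r)
    (m : 'cV[{fraction {poly K}}]_r) : Prop :=
  exists N (P : 'M[{poly K}]_r) (y : 'cV[{poly K}]_r),
    [/\ jgen ^+ N *: Phi M = to_frac P, jgen ^+ N *: m = to_frac y &
        forall i, cong i
          (('X - (b theta)%:P) ^+ N *: xi i
             - map_mx (map_poly b) P *m twist q (xi i))
          (map_mx (map_poly b) y)].

Definition Ext1good : set (set (extension M)) :=
  [set C | exists m (hm : localize setT m),
     (exists2 xi, in_completion xi & solves xi m) /\ C = ext_class (iota M hm)].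

End Good.
End Motives.

Section CompletedPlace.
Variables (Fq : finFieldType) (F : fieldExtType {fraction {poly Fq}}).

(* The inclusion A = Fq[t] -> Fq(t) -> F *)
Definition kappaF : {rmorphism {poly Fq} -> F} := in_alg F \o @tofrac _.

Definition finite_place (v : F -> int) : Prop :=
  discrete_valuation v /\ forall a, val_ge v 0 (kappaF a).

(* The intersection with A of the prime of v *)
Definition place_ideal (v : F -> int) : set {poly Fq} :=
  [set a | val_ge v 1 (kappaF a)].

Definition kappa_completion (Fp : fieldType) (j : {rmorphism F -> Fp}) :
  {rmorphism {poly Fq} -> Fp} := j \o kappaF.

End CompletedPlace.

Arguments Ext1O {Fq K kappa} w {r} M.
Arguments Ext1reg {Fq K kappa r} M.
Arguments Ext1good {Fq K kappa} w {L} b l {r} M.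

(* Main.v *)
(* Write K for the completed field, O for its valuation ring, theta for the
   image of t and J = t - theta.  A class that is regulated and of the form
   iota(m) has m = y / J^n with y in K[t]: multiplication by J^n clears the
   denominators of the Frobenius matrix, since it does so for the direct sum
   with the same Hodge polygon.  By a Gauss norm argument M_O = O[t], so the left
   hand side asks for y in O[t], up to adding J^n f - f^(1) with f in K[t].

   If y is in O[t], the equation J^n xi - xi^(1) = y is solved modulo powers of
   ell one step at a time.  Modulo ell, evaluation at the conjugate roots
   zeta^(q^s) of ell turns it into e_(s+1) = a_(s+1) (e_s^q + c_(s+1)), where
   a_(s+1) is integral because ell(theta) is a unit.  Eliminating all unknowns but
   e_0 leaves one polynomial with derivative -1, which has an unramified root by
   Hensel's lemma.

   Conversely, as n is a power of p, J^n = t^n - theta^n, and y can be taken of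
   degree < n.  Reducing a solution modulo ell^(n r), a polynomial in t^n, and
   comparing coefficients along each residue class mod n, one gets
   - y_i = g(h) with h unramified and g in O[X] monic of degree q^(r deg ell).
   If y_i is not in O, this degree divides the valuation of y_i, for every r.

   Unramified elements are handled through the O-algebras generated by finite
   subfields of L: the residue field is algebraic over Fq, so Hensel's lemma
   produces Teichmueller representatives. *)

Require Import Defs.
From HB Require Import structures.
From mathcomp Require Import all_boot all_order all_algebra all_field.
From mathcomp Require Import boolp classical_sets.
From mathcomp Require Import generic_quotient zify ring.

Set Implicit Arguments.
Unset Strict Implicit.
Unset Printing Implicit Defensive.

Import Order.TTheory GRing.Theory Num.Theory.
Local Open Scope classical_set_scope.
Local Open Scope ring_scope.

(** * Subrings of a field and integral elements *)

(** No valuation is constructed on [L]. The integral closure [Ob] of O plays the role of its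
    valuation ring, divisibility by powers of the uniformizer [U] that of its topology, and integer
    valuations are read off by comparison with elements of K ([has_val]). [L] is not complete
    either, so limits are taken only in subalgebras that are finitely generated as O-modules,
    coordinate by coordinate. The predicate [max_unramified] is not visibly stable under addition,
    whereas the converse divides a solution by a polynomial with remainder. Solutions are therefore
    moved to [approx], which is stable under addition and under multiplication by K, and whose
    nonzero elements still have a valuation in Z. All uses of Hensel's lemma concern polynomials
    with derivative -1: in characteristic p the q-th powers have derivative zero, so Newton's step
    is simply [y + f(y)]. *)

Record subring (L : fieldType) (S : L -> Prop) : Prop := {
  subring1 : S 1;
  subringB : forall x y, S x -> S y -> S (x - y);
  subringM : forall x y, S x -> S y -> S (x * y) }.

Definition coefs_in (L : fieldType) (S : L -> Prop) (p : {poly L}) :=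
  forall i, S p`_i.

Definition integral_in (L : fieldType) (S : L -> Prop) (y : L) : Prop :=
  exists2 g : {poly L}, g \is monic /\ coefs_in S g & root g y.

Section Pack.
Variables (L : fieldType) (S : L -> Prop) (hS : subring S).

Definition subring_pred : {pred L} := [pred x | `[< S x >]].

Lemma subring_pred_closed : subring_closed subring_pred.
Proof.
have E x : (x \in subring_pred) = `[< S x >] by [].
split=> [|x y|x y]; rewrite !E.
- by rewrite asboolT //; exact: (subring1 hS).
- by move=> /asboolP hx /asboolP hy; apply/asboolP/(subringB hS).
- by move=> /asboolP hx /asboolP hy; apply/asboolP/(subringM hS).
Qed.

Definition subring_pack : subringClosed L :=
  HB.pack subring_pred (GRing.isSubringClosed.Build L subring_pred subring_pred_closed).

Lemma in_subring_pack x : (x \in subring_pack) <-> S x.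
Proof. by split=> [/asboolP|h] //; exact/asboolP. Qed.

End Pack.

Section PackedInt.
Variables (L : fieldType) (S : subringClosed L).
(** [integralOver] is relative to a ring morphism. Turning the subring into a type makes its
    inclusion one, so that the closure properties of integral elements carry over to
    [integral_in]. *)
Record subring_type := SubringType { subring_val :> L; subring_valP : subring_val \in S }.
HB.instance Definition _ := [isSub for subring_val].
HB.instance Definition _ := [Choice of subring_type by <:].
HB.instance Definition _ := [SubChoice_isSubComNzRing of subring_type by <:].

Lemma integralOver_in (y : L) :
  integralOver (\val : subring_type -> L) y <->
  exists2 g : {poly L}, g \is monic /\ g \is a polyOver S & root g y.
Proof.
split=> [[g mg rg]|[g [mg /polyOverP gS] rg]].
  exists (map_poly \val g) => //; split; first by rewrite monic_map.
  by apply/polyOverP=> i; rewrite coef_map; exact: subring_valP.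
pose h : {poly subring_type} := \poly_(i < size g) insubd 0 g`_i.
have hE : map_poly \val h = g.
  apply/polyP=> i; rewrite coef_map coef_poly; case: ltnP => hi.
    by rewrite /= insubdK ?gS.
  by rewrite nth_default.
exists h; last by rewrite hE.
rewrite monicE; apply/eqP/val_inj; rewrite -lead_coef_map_inj //; last exact: val_inj.
by rewrite hE (monicP mg).
Qed.
End PackedInt.

Section SubringTheory.
Variables (L : fieldType) (S : L -> Prop) (hS : subring S).
Local Notation Sp := (subring_pack hS).

Lemma subring0 : S 0.
Proof. by apply/(in_subring_pack hS); rewrite rpred0. Qed.

Lemma subringN x : S x -> S (- x).
Proof. by rewrite -!(in_subring_pack hS) rpredN. Qed.

Lemma subringD x y : S x -> S y -> S (x + y).
Proof. by rewrite -!(in_subring_pack hS); exact: rpredD. Qed.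

Lemma subringX x n : S x -> S (x ^+ n).
Proof. by rewrite -!(in_subring_pack hS); exact: rpredX. Qed.

Lemma subring_sum (I : Type) (r : seq I) (P : pred I) (F : I -> L) :
  (forall i, P i -> S (F i)) -> S (\sum_(i <- r | P i) F i).
Proof.
by move=> h; apply/(in_subring_pack hS)/rpred_sum => i /h; rewrite in_subring_pack.
Qed.

Lemma coefs_inP p : coefs_in S p <-> p \is a polyOver Sp.
Proof.
by split=> [h|/polyOverP h i]; [apply/polyOverP=> i|]; apply/(in_subring_pack hS).
Qed.

Lemma coefs_inD p r : coefs_in S p -> coefs_in S r -> coefs_in S (p + r).
Proof. by rewrite !coefs_inP; exact: rpredD. Qed.

Lemma coefs_inB p r : coefs_in S p -> coefs_in S r -> coefs_in S (p - r).
Proof. by rewrite !coefs_inP; exact: rpredB. Qed.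

Lemma coefs_inM p r : coefs_in S p -> coefs_in S r -> coefs_in S (p * r).
Proof. by rewrite !coefs_inP; exact: rpredM. Qed.

Lemma coefs_inX p n : coefs_in S p -> coefs_in S (p ^+ n).
Proof. by rewrite !coefs_inP; exact: rpredX. Qed.

Lemma coefs_inC c : S c -> coefs_in S c%:P.
Proof. by rewrite coefs_inP polyOverC in_subring_pack. Qed.

Lemma coefs_in_X : coefs_in S 'X.
Proof. by rewrite coefs_inP polyOverX. Qed.

Lemma coefs_in_horner p x : coefs_in S p -> S x -> S p.[x].
Proof. by rewrite coefs_inP -!(in_subring_pack hS); exact: rpred_horner. Qed.

Lemma integral_inE y : integral_in S y <->
  integralOver (\val : subring_type Sp -> L) y.
Proof.
rewrite integralOver_in; split=> -[g [mg gS] rg]; exists g => //; split=> //.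
  exact/coefs_inP.
exact/coefs_inP.
Qed.

Lemma integral_in_id x : S x -> integral_in S x.
Proof.
move=> Sx; exists ('X - x%:P); last by rewrite root_XsubC.
split; first exact: monicXsubC.
by apply/coefs_inP; rewrite polyOverXsubC in_subring_pack.
Qed.

Lemma integral_in_subring : subring (integral_in S).
Proof.
split=> [|x y|x y]; first by apply: integral_in_id; exact: (subring1 hS).
  by rewrite !integral_inE; exact: integral_sub.
by rewrite !integral_inE; exact: integral_mul.
Qed.

Lemma integral_in_trans (g : {poly L}) y :
  g \is monic -> coefs_in (integral_in S) g -> root g y -> integral_in S y.
Proof.
move=> mg hg rg; rewrite integral_inE; apply: (integral_root_monic mg rg).
by apply/integral_poly => i; rewrite -integral_inE.
Qed.

End SubringTheory.

(** Long division, followed coefficientwise. [V] is only asked to be an additive group stable under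
    multiplication by [T], because it is also applied to [approx], with [T] the image of K. *)
Lemma monic_division (L : fieldType) (V T : L -> Prop) (f g : {poly L}) :
  V 0 -> (forall x y, V x -> V y -> V (x + y)) ->
  (forall x y, V x -> V y -> V (x - y)) ->
  (forall x c, V x -> T c -> V (x * c)) ->
  coefs_in V f -> g \is monic -> coefs_in T g ->
  exists q r, [/\ f = q * g + r, coefs_in V q, coefs_in V r &
    (size r < size g)%N].
Proof.
move=> V0 VD VB VM + mg gT.
have [n] := ubnP (size f); elim: n f => // n IHn f /ltnSE sf fV.
have [lt_fg|le_gf] := ltnP (size f) (size g).
  exists 0, f; rewrite mul0r add0r; split=> // i; by rewrite coef0.
pose c := lead_coef f; pose e := (size f - size g)%N.
pose f' := f - c%:P * 'X^e * g.
have g0 : (0 < size g)%N by rewrite size_poly_gt0 monic_neq0.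
have coefE i : (c%:P * 'X^e * g)`_i = if (i < e)%N then 0 else c * g`_(i - e).
  by rewrite -mulrA coefCM coefXnM; case: ifP; rewrite ?mulr0.
have f'V : coefs_in V f'.
  move=> i; rewrite coefB coefE; case: ifP => _; first by rewrite subr0.
  by apply: VB => //; apply: VM => //; exact: fV.
have f0 : (0 < size f)%N := leq_trans g0 le_gf.
have sf' : (size f' < size f)%N.
  rewrite -(prednK f0) ltnS; apply/leq_sizeP=> i hi.
  rewrite coefB coefE ltnNge (leq_trans _ hi) /=; last first.
    by rewrite /e -subn1 leq_sub2l.
  move: hi; rewrite leq_eqVlt => /orP[/eqP<-|hi].
    have -> : ((size f).-1 - e = (size g).-1)%N.
      by rewrite /e -!subn1 subnAC subKn.
    by move/monicP: mg; rewrite /lead_coef => ->; rewrite mulr1 subrr.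
  rewrite (nth_default _ (_ : size f <= i)%N); last by move: f0 hi; clear; lia.
  rewrite nth_default ?mulr0 ?subrr // /e.
  by move: f0 hi le_gf g0; rewrite -!subn1; move: (size f) (size g) => a b0; clear; lia.
have [q [r [E qV rV sr]]] := IHn f' (leq_trans sf' sf) f'V.
exists (q + c%:P * 'X^e), r; split=> //.
  by rewrite mulrDl addrAC -E addrNK.
move=> i; rewrite coefD coefCM coefXn; apply: VD => //.
by case: eqP => _; rewrite ?mulr1 ?mulr0 //; exact: fV.
Qed.

(** * Discrete valuations *)

Section Valuation.
Variables (K : fieldType) (w : K -> int) (dv : discrete_valuation w).

Lemma valM x y : x != 0 -> y != 0 -> w (x * y) = w x + w y.
Proof. exact: (dv_mul dv). Qed.

Lemma val1 : w 1 = 0.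
Proof.
have h : (1 : K) != 0 by exact: oner_neq0.
by have := valM h h; rewrite mulr1; move: (w 1) => x; lia.
Qed.

Lemma valX x n : x != 0 -> w (x ^+ n) = w x *+ n.
Proof.
move=> x0; elim: n => [|n IH]; first by rewrite expr0 val1 mulr0n.
by rewrite exprS valM ?expf_neq0 // IH mulrS.
Qed.

Lemma valV x : x != 0 -> w x^-1 = - w x.
Proof.
move=> x0; apply/eqP; rewrite -addr_eq0 addrC -valM ?invr_eq0 //.
by rewrite divff // val1.
Qed.

Lemma valN x : w (- x) = w x.
Proof.
have [->|x0] := eqVneq x 0; first by rewrite oppr0.
have n10 : -1 != 0 :> K by rewrite oppr_eq0 oner_eq0.
rewrite -mulN1r valM //; suff -> : w (-1) = 0 by rewrite add0r.
by have := valM n10 n10; rewrite mulrNN mulr1 val1; lia.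
Qed.

Lemma val_geE n x : x != 0 -> val_ge w n x = (n <= w x).
Proof. by rewrite /val_ge => /negPf ->. Qed.

Lemma val_ge0 n : val_ge w n 0.
Proof. by rewrite /val_ge eqxx. Qed.

Lemma val_geD n x y : val_ge w n x -> val_ge w n y -> val_ge w n (x + y).
Proof. exact: (dv_add dv). Qed.

Lemma val_geN n x : val_ge w n (- x) = val_ge w n x.
Proof. by rewrite /val_ge oppr_eq0 valN. Qed.

Lemma val_geB n x y : val_ge w n x -> val_ge w n y -> val_ge w n (x - y).
Proof. by move=> hx hy; apply: val_geD => //; rewrite val_geN. Qed.

Lemma val_geM n m x y :
  val_ge w n x -> val_ge w m y -> val_ge w (n + m) (x * y).
Proof.
rewrite /val_ge mulf_eq0.
by have [//|x0] := eqVneq x 0; have [//|y0] := eqVneq y 0; rewrite /= valM //; lia.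
Qed.

Lemma val_ge_le n m x : m <= n -> val_ge w n x -> val_ge w m x.
Proof. by rewrite /val_ge; case: eqP => //= _; lia. Qed.

Lemma val_ge1 : val_ge w 0 1.
Proof. by rewrite val_geE ?oner_eq0 // val1. Qed.

Lemma val_ge_subring : subring (val_ge w 0).
Proof.
split=> [|x y|x y]; first exact: val_ge1.
  exact: val_geB.
by move=> hx hy; rewrite -[0]addr0; exact: val_geM.
Qed.

Lemma val_ge_sum n (I : Type) (r : seq I) (P : pred I) (F : I -> K) :
  (forall i, P i -> val_ge w n (F i)) -> val_ge w n (\sum_(i <- r | P i) F i).
Proof.
move=> h; elim/big_rec: _ => [|i x Pi hx]; first exact: val_ge0.
by apply: val_geD => //; exact: h.
Qed.

Lemma val_geMr n x y : val_ge w n x -> val_ge w 0 y -> val_ge w n (x * y).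
Proof. by move=> hx hy; rewrite -[n]addr0; exact: val_geM. Qed.

Lemma val_poly_bound (g : {poly K}) : exists M : nat,
  forall i, val_ge w (- M%:Z) g`_i.
Proof.
pose M := (\sum_(i < size g) `|w g`_i|)%N; exists M => i.
have [hi|hi] := ltnP i (size g); last by rewrite nth_default // val_ge0.
have : (`|w g`_i| <= M)%N by rewrite /M (bigD1 (Ordinal hi)) //= leq_addr.
by rewrite /val_ge; case: eqP => //= _; lia.
Qed.

Section Uniformizer.
Variables (u : K) (u0 : u != 0) (wu : w u = 1).

Lemma val_ge_divX n x : val_ge w n%:Z x = val_ge w 0 (x / u ^+ n).
Proof.
have [->|x0] := eqVneq x 0; first by rewrite mul0r !val_ge0.
rewrite !val_geE ?mulf_neq0 ?invr_eq0 ?expf_neq0 //.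
rewrite valM ?invr_eq0 ?expf_neq0 // valV ?expf_neq0 // valX // wu.
by rewrite natz; lia.
Qed.
End Uniformizer.
End Valuation.

(** * Integral closure of the valuation ring in an algebraic closure *)

Section IntegralClosure.
Variables (K : fieldType) (w : K -> int) (dv : discrete_valuation w).
Variables (L : closedFieldType) (b : {rmorphism K -> L}).

Definition O_im (y : L) : Prop := exists2 a, val_ge w 0 a & y = b a.

Lemma O_im_subring : subring O_im.
Proof.
have hO := val_ge_subring dv.
split=> [|x y [a ha ->] [c hc ->]|x y [a ha ->] [c hc ->]].
- by exists 1; [exact: (subring1 hO)|rewrite rmorph1].
- by exists (a - c); [exact: (subringB hO)|rewrite rmorphB].
- by exists (a * c); [exact: (subringM hO)|rewrite rmorphM].
Qed.

Lemma coefs_in_O_im (g : {poly L}) : coefs_in O_im g ->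
  exists2 h : {poly K}, coefs_in (val_ge w 0) h & g = map_poly b h.
Proof.
move=> gO; have ex i : exists a, val_ge w 0 a /\ g`_i = b a.
  by have [a] := gO i; exists a.
have [f hf] := choice ex.
exists (\poly_(i < size g) f i).
  move=> i; rewrite coef_poly; case: ifP => _; last exact: val_ge0.
  by have [] := hf i.
apply/polyP=> i; rewrite coef_map coef_poly; case: ltnP => hi.
  by have [] := hf i.
by rewrite nth_default // raddf0.
Qed.

Local Notation Ob := (integral_in O_im).

Lemma integral_over_OE y : integral_over_O w b y <-> Ob y.
Proof.
split=> [[g [mg gO] rg]|[g [mg /coefs_in_O_im[h hO gE]] rg]].
  exists (map_poly b g) => //; split; first by rewrite monic_map.
  by move=> i; rewrite coef_map; exists g`_i.
by exists h; [split=> //; rewrite -(map_monic b) -gE | rewrite -gE].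
Qed.

Let hOb : subring Ob := integral_in_subring O_im_subring.

Lemma integral_O a : val_ge w 0 a -> Ob (b a).
Proof. by move=> ha; apply: (integral_in_id O_im_subring); exists a. Qed.

(** Divide an integral equation of [a] by [a ^+ d]: if [w a] were negative, 1 would be a sum of
    terms of valuation at least 1. *)
Lemma integral_O_closed a : Ob (b a) -> val_ge w 0 a.
Proof.
move=> /integral_over_OE[g [mg gO] rg].
have {}rg : root g a by move: rg; rewrite fmorph_root.
have [->|a0] := eqVneq a 0; first exact: val_ge0.
rewrite val_geE // leNgt; apply/negP => wa.
have sg : (0 < size g)%N by rewrite size_poly_gt0 monic_neq0.
set d := (size g).-1.
have E : 1 = - \sum_(i < d) g`_i * a ^+ i / a ^+ d.
  move/rootP: rg; rewrite horner_coef -(prednK sg) big_ord_recr /= -/d.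
  move: mg; rewrite monicE /lead_coef => /eqP ->; rewrite mul1r addrC => /eqP.
  rewrite addr_eq0 => /eqP hE.
  by rewrite -mulr_suml -mulNr -hE divff // expf_neq0.
have : val_ge w 1 1.
  rewrite [X in val_ge _ _ X]E val_geN //; apply: (val_ge_sum dv) => i _.
  rewrite -mulrA mulrC; apply: (val_geMr dv); last exact: gO.
  rewrite val_geE; last by rewrite mulf_neq0 ?invr_eq0 ?expf_neq0.
  rewrite (valM dv) ?invr_eq0 ?expf_neq0 // (valV dv) ?expf_neq0 // !(valX dv) //.
  have := ltn_ord i; rewrite -(mulr_natr (w a) i) -(mulr_natr (w a) d) !natz.
  move: (nat_of_ord i) (w a) wa => x z hz hxy; move: (d) hz hxy => y; clear => hz hxy.
  have -> : z * x - z * y = - z * (y - x)%N by lia.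
  have : 1 <= - z by lia.
  have : 1 <= (y - x)%N%:Z by lia.
  move: (- z) ((y - x)%N%:Z) => s t; nia.
by rewrite val_geE ?oner_eq0 // (val1 dv).
Qed.

Variables (u : K) (u0 : u != 0) (wu : w u = 1).
Hypothesis (hb : algebraic_closure b).
Local Notation U := (b u).

Lemma U_neq0 : U != 0.
Proof. by rewrite fmorph_eq0. Qed.

Lemma integral_U : Ob U.
Proof. by apply: integral_O; rewrite val_geE // wu. Qed.

Lemma not_integral_Uinv : ~ Ob U^-1.
Proof.
rewrite -fmorphV => /integral_O_closed.
by rewrite val_geE ?invr_eq0 // (valV dv) // wu.
Qed.

Lemma integral_leading_unit (g : {poly K}) (y : L) :
  coefs_in (val_ge w 0) g -> g != 0 -> w (lead_coef g) = 0 ->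
  root (map_poly b g) y -> Ob y.
Proof.
move=> gO g0 wg rg; apply/integral_over_OE.
have l0 : lead_coef g != 0 by rewrite lead_coef_eq0.
exists ((lead_coef g)^-1 *: g).
  split; first by rewrite monicE lead_coefZ mulVf.
  move=> i; rewrite coefZ; apply: (val_geMr dv) => //.
  by rewrite val_geE ?invr_eq0 // (valV dv) // wg.
by rewrite linearZ /= rootZ // fmorph_eq0 invr_eq0.
Qed.

Lemma integral_scale x : exists M : nat, Ob (U ^+ M * x).
Proof.
have [g g0 rg] := hb x; have l0 : lead_coef g != 0 by rewrite lead_coef_eq0.
have [M hM] := val_poly_bound w ((lead_coef g)^-1 *: g).
exists M; apply/integral_over_OE.
have sg : (0 < size g)%N by rewrite size_poly_gt0.
set d := (size g).-1.
(* The monic polynomial with root [U ^+ M * x]. For [i < d] the exponent [M * (d - i)] is at least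
   [M], which clears the denominator of the coefficient. *)
pose h := \poly_(i < d.+1) ((lead_coef g)^-1 * g`_i * u ^+ (M * (d - i))).
have hd : h`_d = 1.
  by rewrite coef_poly ltnSn subnn muln0 expr0 mulr1 /d -lead_coefE mulVf.
have sh : size h = d.+1.
  by apply: size_poly_eq; rewrite subnn muln0 expr0 mulr1 /d -lead_coefE mulVf ?oner_eq0.
exists h.
  split; first by rewrite monicE lead_coefE sh hd.
  move=> i; rewrite coef_poly; case: ltnP => hi; last exact: val_ge0.
  move: hi; rewrite ltnS leq_eqVlt => /orP[/eqP ->|hi].
    by rewrite subnn muln0 expr0 mulr1 /d -lead_coefE mulVf // (val_ge1 dv).
  have := hM i; rewrite coefZ => hMi.
  rewrite -(addNr (M * (d - i))%N%:Z); apply: (val_geM dv); last first.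
    by rewrite val_geE ?expf_neq0 // (valX dv) // wu natz.
  apply: val_ge_le hMi; rewrite lerN2 lez_nat leq_pmulr //; lia.
apply/rootP; rewrite horner_coef size_map_poly sh.
transitivity (U ^+ (M * d) * (b (lead_coef g))^-1 * (map_poly b g).[x]); last first.
  by rewrite (rootP rg) mulr0.
rewrite horner_coef size_map_poly -(prednK sg) -/d mulr_sumr.
apply: eq_bigr => i _; have hi : (i <= d)%N by rewrite -ltnS.
rewrite !coef_map /= coef_poly ltn_ord !rmorphM fmorphV rmorphXn /=.
rewrite exprMn -exprM (_ : M * d = M * (d - i) + M * i)%N; last by rewrite -mulnDr subnK.
by rewrite exprD; ring.
Qed.

(** The U-adic topology is separated: once [U ^+ M / y] is integral, integrality of [y / U ^+ M.+1]
    would make [U^-1] integral. *)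
Lemma integral_separated y : y != 0 -> exists N : nat, ~ Ob (y / U ^+ N).
Proof.
move=> y0; have [M hM] := integral_scale y^-1.
exists M.+1 => hN; apply: not_integral_Uinv.
have := subringM hOb hM hN.
suff -> : U ^+ M * y^-1 * (y / U ^+ M.+1) = U^-1 by [].
rewrite mulrA mulfVK // exprS invfM mulrCA divff ?mulr1 //.
by rewrite expf_neq0 // U_neq0.
Qed.

(** An integral equation for [y = (1 + U z)^-1] is written down. Since [1 - y = U y z], multiplying
    [g(z) = 0] by [(U y)^d] gives [sum_i g_i (1 - y)^i (U y)^(d - i) = 0], which is [G(y) = 0]. The
    coefficient of degree [d] in [G] is [(-1)^d] plus a multiple of [u], hence a unit. *)
Lemma integral_1DU z : Ob z -> 1 + U * z != 0 /\ Ob (1 + U * z)^-1.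
Proof.
move=> hz.
have nz : 1 + U * z != 0.
  apply/negP => /eqP E; apply: not_integral_Uinv.
  suff -> : U^-1 = - z by exact: (subringN hOb).
  apply: (mulfI U_neq0); rewrite mulfV ?U_neq0 // mulrN; apply/eqP.
  by rewrite -addr_eq0 E.
split=> //; have [g [mg gO] rg] := (integral_over_OE z).2 hz.
have sg : (0 < size g)%N by rewrite size_poly_gt0 monic_neq0.
set d := (size g).-1; set y := (1 + U * z)^-1.
have gd : g`_d = 1 by move: mg; rewrite monicE /lead_coef => /eqP.
have hO := val_ge_subring dv.
have Ou : val_ge w 0 u by rewrite val_geE // wu.
pose A : {poly K} := 1 - 'X; pose B : {poly K} := u *: 'X.
have sA : size A = 2%N by rewrite /A addrC size_polyDl size_polyN size_polyX // size_poly1.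
have sB : size B = 2%N by rewrite /B size_scale // size_polyX.
have AO : coefs_in (val_ge w 0) A.
  apply: (coefs_inB hO); last exact: (coefs_in_X hO).
  by rewrite -polyC1; apply: (coefs_inC hO); exact: (val_ge1 dv).
have BO : coefs_in (val_ge w 0) B.
  rewrite /B -mul_polyC; apply: (coefs_inM hO); first exact: (coefs_inC hO).
  exact: (coefs_in_X hO).
pose G : {poly K} := \sum_(i < d.+1) g`_i *: (A ^+ i * B ^+ (d - i)).
have hsz i : (i <= d)%N -> (size (A ^+ i * B ^+ (d - i))%R <= d.+1)%N.
  move=> hi; have := size_polyMleq (A ^+ i) (B ^+ (d - i)).
  have := size_poly_exp_leq A i; have := size_poly_exp_leq B (d - i).
  rewrite sA sB /=; move: hi; clear.
  move: (size (A ^+ i)) (size (B ^+ (d - i))) (size _) => p q r; lia.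
have sG : (size G <= d.+1)%N.
  apply: (leq_trans (size_sum _ _ _)); apply/bigmax_leqP => i _.
  by apply: (leq_trans (size_scale_leq _ _)); apply: hsz; rewrite -ltnS.
have GO : coefs_in (val_ge w 0) G.
  apply/(coefs_inP hO); apply: rpred_sum => i _; apply/(coefs_inP hO).
  rewrite -mul_polyC; apply: (coefs_inM hO).
    by apply: (coefs_inC hO); exact: gO.
  by apply: (coefs_inM hO); exact: (coefs_inX hO).
have Gd : exists2 e, val_ge w 1 e & G`_d = (-1) ^+ d + e.
  exists (\sum_(i < d) g`_i * (A ^+ i * B ^+ (d - i))`_d).
    apply: (val_ge_sum dv) => i _; rewrite mulrC; apply: (val_geMr dv) => //.
    have -> : (d - i = (d - i).-1.+1)%N by have := ltn_ord i; lia.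
    rewrite exprS {2}/B -scalerAl -scalerAr coefZ; apply: (val_geMr dv).
      by rewrite val_geE // wu.
    apply: (coefs_inM hO); first exact: (coefs_inX hO).
    by apply: (coefs_inM hO); [exact: (coefs_in_X hO)|exact: (coefs_inX hO)].
  rewrite coef_sum big_ord_recr /= addrC; congr (_ + _); last first.
    by apply: eq_bigr => i _; rewrite coefZ.
  rewrite gd scale1r subnn expr0 mulr1.
  have -> : A = (-1) *: ('X - 1%:P) :> {poly K} by rewrite scaleN1r opprB polyC1.
  rewrite exprZn coefZ.
  have := monicXsubC (1 : K); move/(monic_exp d); rewrite monicE lead_coefE.
  by rewrite size_exp_XsubC => /eqP ->; rewrite mulr1.
have [e he Ge] := Gd.
have w1 : w ((-1) ^+ d) = 0.
  by rewrite (valX dv) ?oppr_eq0 ?oner_eq0 // (valN dv) (val1 dv) mul0rn.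
have Gd0 : G`_d != 0.
  apply/negP => /eqP G0; move: he.
  have -> : e = - (-1) ^+ d by apply/eqP; rewrite -addr_eq0 addrC -Ge G0.
  by rewrite (val_geN dv) val_geE ?w1 // expf_neq0 // oppr_eq0 oner_eq0.
have wG : w G`_d = 0.
  apply/eqP; rewrite eq_le; apply/andP; split; last by have := GO d; rewrite val_geE.
  rewrite leNgt; apply/negP => hw.
  have : val_ge w 1 ((-1) ^+ d).
    have -> : (-1) ^+ d = G`_d - e by rewrite Ge addrK.
    by apply: (val_geB dv) => //; rewrite val_geE //; lia.
  by rewrite val_geE ?w1 // expf_neq0 // oppr_eq0 oner_eq0.
have szG : size G = d.+1.
  by apply/eqP; rewrite eqn_leq sG ltnNge; apply: contra Gd0 => hs; rewrite nth_default.
apply: (@integral_leading_unit G) => //.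
- by rewrite -size_poly_eq0 szG.
- by rewrite lead_coefE szG.
apply/rootP; rewrite raddf_sum /= horner_sum.
transitivity ((U * y) ^+ d * (map_poly b g).[z]); last by rewrite (rootP rg) mulr0.
rewrite horner_coef size_map_poly -(prednK sg) -/d mulr_sumr.
apply: eq_bigr => i _; have hi : (i <= d)%N by rewrite -ltnS.
rewrite linearZ /= hornerZ coef_map mulrCA; congr (_ * _).
rewrite rmorphM !rmorphXn /= /A /B rmorphB /= rmorph1 linearZ /= map_polyX !hornerE.
have -> : 1 - y = U * y * z.
  have yE : (1 + U * z) * y = 1 by rewrite mulfV.
  by rewrite -[X in X - y = _]yE; ring.
move: (nat_of_ord i) hi => k hk.
by rewrite -[in RHS](subnK hk) !exprMn !exprD; ring.
Qed.

End IntegralClosure.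

(** * Polynomials over finite fields *)

Section FiniteFieldPoly.
Variable Fq : finFieldType.
Local Notation q := #|Fq|.

Lemma card_gt1 : (1 < q)%N. Proof. exact: finNzRing_gt1. Qed.
Lemma card_gt0 : (0 < q)%N. Proof. exact: ltnW card_gt1. Qed.

Section Frobenius.
Variables (R : comNzRingType) (iota : {rmorphism Fq -> R}).

Lemma pchar_pnat_card m : [pchar R].-nat (q ^ m)%N.
Proof.
have [p pr hp] := finPcharP Fq.
rewrite pnatX; apply/orP; left; rewrite (card_pprimeChar hp).
have hpR : p \in [pchar R] by exact: rmorph_pchar hp.
by rewrite pnatX; apply/orP; left; rewrite pnatE.
Qed.

Lemma natr_card : q%:R = 0 :> R.
Proof.
have [p pr hp] := finPcharP Fq.
have hpR : p \in [pchar R] by exact: rmorph_pchar hp.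
apply/eqP; rewrite -(dvdn_pcharf hpR) (card_pprimeChar hp) Euclid_dvdX // dvdnn /=.
rewrite lt0n; apply/negP => /eqP k0; have := card_gt1.
by rewrite (card_pprimeChar hp) k0.
Qed.

Lemma frobD m (x y : R) : (x + y) ^+ (q ^ m) = x ^+ (q ^ m) + y ^+ (q ^ m).
Proof. exact/exprDn_pchar/pchar_pnat_card. Qed.

Lemma frob0 m : 0 ^+ (q ^ m) = 0 :> R.
Proof. by rewrite expr0n expn_eq0 -leqn0 leqNgt card_gt0. Qed.

Lemma frobN m (x : R) : (- x) ^+ (q ^ m) = - x ^+ (q ^ m).
Proof. by apply/eqP; rewrite -addr_eq0 -frobD addNr frob0. Qed.

Lemma frobB m (x y : R) : (x - y) ^+ (q ^ m) = x ^+ (q ^ m) - y ^+ (q ^ m).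
Proof. by rewrite frobD frobN. Qed.

Lemma frob_sum m (I : Type) (r : seq I) (P : pred I) (F : I -> R) :
  (\sum_(i <- r | P i) F i) ^+ (q ^ m) = \sum_(i <- r | P i) F i ^+ (q ^ m).
Proof. by apply: (big_morph (fun x => x ^+ (q ^ m)) (frobD m) (frob0 m)). Qed.

Lemma expf_cardX m (c : Fq) : c ^+ (q ^ m) = c.
Proof. by elim: m => [|m IH]; rewrite ?expr1 // expnS exprM expf_card. Qed.

Lemma frob_iota m c : iota c ^+ (q ^ m) = iota c.
Proof. by rewrite -rmorphXn expf_cardX. Qed.

Lemma frob_mul m k (x : R) : x ^+ (q ^ m) = x -> x ^+ (q ^ (m * k)) = x.
Proof.
by move=> h; elim: k => [|k IH]; rewrite ?muln0 ?expr1 // mulnS expnD exprM h.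
Qed.
End Frobenius.

(** Pigeonhole: two of the ['X^(q ^ s)] agree modulo [G], and the difference of two such powers is a
    [q ^ s]-th power of some ['X^(q ^ m) - 'X]. Repeated factors of [G] are absorbed by the exponent
    [N]. *)
Lemma dvdp_frob_power (G : {poly Fq}) : G != 0 ->
  exists m N, (0 < m)%N /\ G %| ('X^(q ^ m) - 'X) ^+ N.
Proof.
move=> G0; pose T := 'rV[Fq]_(size G).
pose f (s : 'I_(#|{: T}|.+1)) : T := poly_rV ('X^(q ^ s) %% G).
have /injectivePn[s [t nst Est]] : ~~ injectiveb f.
  apply/injectiveP => /leq_card; rewrite card_ord ltnn //.
wlog lt_st : s t nst Est / (s < t)%N.
  move=> H; have [|ge|E] := ltngtP s t; first exact: H.
    by apply: (H t s) => //; rewrite eq_sym.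
  by case/eqP: nst; exact: val_inj.
have Em : 'X^(q ^ s) %% G = 'X^(q ^ t) %% G.
  move/(congr1 rVpoly): Est; rewrite /f !poly_rV_K //; apply: ltnW; exact: ltn_modpN0.
exists (t - s)%N, (q ^ s)%N; split; first by rewrite subn_gt0.
rewrite frobB //; last exact: polyC.
rewrite -exprM -expnD subnK ?(ltnW lt_st) //.
by rewrite /dvdp modpD modpN Em subrr.
Qed.

Section Algebraic.
Variables (E : fieldType) (iota : {rmorphism Fq -> E}).

(** The algebraic closure of [Fq] in [E], as [frob_periodic_integral] shows. *)
Definition frob_periodic (x : E) : Prop := exists2 m, (0 < m)%N & x ^+ (q ^ m) = x.
Local Notation Fb := frob_periodic.

Lemma frob_periodic_root (G : {poly Fq}) x :
  G != 0 -> root (map_poly iota G) x -> Fb x.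
Proof.
move=> G0 rG; have [m [N [m0 dG]]] := dvdp_frob_power G0.
exists m => //; move: dG; rewrite -(dvdp_map iota) => /root_dvdp/(_ rG).
rewrite rmorphXn rmorphB /= map_polyXn map_polyX.
move/rootP; rewrite !hornerE => /eqP; rewrite expf_eq0 => /andP[_].
by rewrite subr_eq0 => /eqP.
Qed.

Lemma frob_periodic_integral x : Fb x <-> integralOver iota x.
Proof.
split=> [[m m0 hx]|[g mg rg]]; last by apply: frob_periodic_root rg; exact: monic_neq0.
exists ('X^(q ^ m) - 'X).
  rewrite monicE lead_coefDl ?lead_coefXn // size_polyXn size_polyN size_polyX ltnS.
  by apply: leq_trans card_gt1 _; rewrite -{1}(expn1 q) leq_exp2l ?card_gt1.
by rewrite rmorphB /= map_polyXn map_polyX rootE !hornerE hx subrr.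
Qed.

Lemma frob_periodic_subring : subring Fb.
Proof.
split=> [|x y|x y]; rewrite !frob_periodic_integral.
- exact: integral1.
- exact: integral_sub.
- exact: integral_mul.
Qed.

Lemma frob_periodicV x : Fb x -> Fb x^-1.
Proof. by case=> m m0 hx; exists m => //; rewrite exprVn hx. Qed.

Lemma frob_periodic_trans (f : {poly E}) x :
  f != 0 -> coefs_in Fb f -> root f x -> Fb x.
Proof.
move=> f0 fF rf; apply/frob_periodic_integral; apply: (integral_root f0 rf).
by apply/integral_poly => i; rewrite -frob_periodic_integral.
Qed.

Lemma frob_fixed_iota x : x ^+ q = x -> exists c, x = iota c.
Proof.
move=> hx; have : root (map_poly iota ('X^q - 'X)) x.
  by rewrite rmorphB /= map_polyXn map_polyX rootE !hornerE hx subrr.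
rewrite finField_genPoly rmorph_prod /= rootE horner_prod => /prodf_eq0[c _].
by rewrite rmorphB /= map_polyX map_polyC -rootE root_XsubC => /eqP; exists c.
Qed.

Lemma coef_frob (f : {poly E}) i : (map_poly (fun x => x ^+ q) f)`_i = f`_i ^+ q.
Proof.
by rewrite coef_map_id0 // expr0n -leqn0 leqNgt card_gt0.
Qed.

Local Notation tw := (map_poly (fun x : E => x ^+ q)).

Lemma frob_polyB (f g : {poly E}) : tw (f - g) = tw f - tw g.
Proof.
apply/polyP=> i; rewrite !(coefB, coef_frob).
by have := frobB iota 1 f`_i g`_i; rewrite expn1.
Qed.

Lemma frob_polyD (f g : {poly E}) : tw (f + g) = tw f + tw g.
Proof.
apply/polyP=> i; rewrite !(coefD, coef_frob).
by have := frobD iota 1 f`_i g`_i; rewrite expn1.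
Qed.

Lemma frob_polyM (f g : {poly E}) : tw (f * g) = tw f * tw g.
Proof.
apply/polyP=> i; rewrite coef_frob !coefM.
have := frob_sum iota 1 (index_enum 'I_i.+1) xpredT (fun j => f`_j * g`_(i - j)).
rewrite expn1 => ->; apply: eq_bigr => j _.
by rewrite !coef_frob exprMn.
Qed.

Lemma frob_poly_iota (c : {poly Fq}) : tw (map_poly iota c) = map_poly iota c.
Proof.
apply/polyP=> i; rewrite coef_frob coef_map.
by have := frob_iota iota 1 c`_i; rewrite expn1.
Qed.

Lemma horner_frob (f : {poly E}) x : (tw f).[x ^+ q] = f.[x] ^+ q.
Proof.
have st : (size (tw f) <= size f)%N by exact: size_poly.
rewrite (horner_coef_wide _ st) horner_coef.
have := frob_sum iota 1 (index_enum 'I_(size f)) xpredT (fun j => f`_j * x ^+ j).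
rewrite expn1 => ->; apply: eq_bigr => i _.
by rewrite coef_frob exprMn -!exprM mulnC.
Qed.

End Algebraic.

(** [d] is the least period of a root [z] under Frobenius. The product of ['X - z ^+ (q ^ s)] over
    one period is fixed by Frobenius, so it comes from [Fq]; it shares the root [z] with the
    irreducible [l], hence is a multiple of [l]. Vanishing at the [d] conjugates therefore forces
    divisibility by [l]. *)
Lemma irreducible_frob_roots (E : closedFieldType) (iota : {rmorphism Fq -> E})
    (l : {poly Fq}) : irreducible_poly l ->
  exists (z : E) (d : nat),
  [/\ (0 < d)%N, z ^+ (q ^ d) = z,
      forall s t, (s < d)%N -> (t < d)%N -> z ^+ (q ^ s) = z ^+ (q ^ t) -> s = t,
      forall s, root (map_poly iota l) (z ^+ (q ^ s)) &
      forall f : {poly E}, (forall s, (s < d)%N -> root f (z ^+ (q ^ s))) ->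
        map_poly iota l %| f].
Proof.
move=> [sl irr]; have l0 : l != 0 by rewrite -size_poly_gt0; apply: ltn_trans sl.
have [z rz] : exists z, root (map_poly iota l) z.
  by apply/closed_rootP; rewrite size_map_poly; move: sl; case: (size l) => [|[]].
have ex : exists m, (0 < m)%N && (z ^+ (q ^ m) == z).
  by have [m m0 /eqP h] := frob_periodic_root l0 rz; exists m; rewrite m0.
case: (ex_minnP ex) => d /andP[d0 /eqP hz] dmin.
have inj s t : (s < d)%N -> (t < d)%N -> z ^+ (q ^ s) = z ^+ (q ^ t) -> s = t.
  suff H a c : (a < c)%N -> (c < d)%N -> z ^+ (q ^ a) <> z ^+ (q ^ c).
    move=> hs ht hst; have [lt|lt|//] := ltngtP s t.
      by case: (H s t).
    by case: (H t s).
  move=> hst ht E0; have /dmin : (0 < d - c + a)%N && (z ^+ (q ^ (d - c + a)) == z).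
    rewrite addn_gt0 subn_gt0 ht /=.
    by rewrite addnC expnD exprM E0 -exprM -expnD subnKC ?(ltnW ht) // hz.
  lia.
exists z, d; split=> //.
- elim=> [|s IH]; first by rewrite expr1.
  rewrite expnSr exprM rootE -(frob_poly_iota iota) horner_frob // (rootP IH).
  by rewrite expr0n -leqn0 leqNgt card_gt0.
move=> f hf; pose rs := [seq z ^+ (q ^ s) | s <- seq.iota 0 d].
pose G k := \prod_(0 <= s < k) ('X - (z ^+ (q ^ s))%:P).
have urs : uniq rs.
  rewrite map_inj_in_uniq ?iota_uniq // => s t; rewrite !mem_iota !add0n => hs ht.
  exact: inj.
have dG : G d %| f.
  have := @uniq_roots_dvdp _ f rs; rewrite /rs big_map /G /index_iota subn0; apply.
    by apply/allP=> _ /mapP[s hs ->]; apply: hf; rewrite mem_iota add0n in hs.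
  by rewrite uniq_rootsE.
apply: dvdp_trans dG.
have twX a : map_poly (fun x => x ^+ q) ('X - a%:P) = 'X - (a ^+ q)%:P :> {poly E}.
  rewrite (frob_polyB iota); congr (_ - _); apply/polyP=> i; rewrite coef_frob //.
    by rewrite coefX; case: eqP => _; rewrite ?expr1n // expr0n -leqn0 leqNgt card_gt0.
  by rewrite !coefC; case: eqP => _ //; rewrite expr0n -leqn0 leqNgt card_gt0.
(* Twisting moves each factor of [G k] to the next conjugate. For [k = d] the two extra factors
   coincide, so [G d] is fixed. *)
have twG k : map_poly (fun x => x ^+ q) (G k) * ('X - z%:P)
    = G k * ('X - (z ^+ (q ^ k))%:P).
  elim: k => [|k IH].
    rewrite /G big_geq // expr1 mul1r; rewrite (_ : map_poly _ 1 = 1) ?mul1r //.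
    apply/polyP=> i; rewrite coef_frob // coef1.
    by case: eqP => _; rewrite ?expr1n // expr0n -leqn0 leqNgt card_gt0.
  rewrite /G big_nat_recr //= -/(G k) (frob_polyM iota) twX -exprM -expnSr.
  by rewrite mulrAC IH.
have twGd : map_poly (fun x => x ^+ q) (G d) = G d.
  have XC0 : 'X - z%:P != 0 by rewrite polyXsubC_eq0.
  by apply: (mulIf XC0); rewrite twG hz.
have exg i : exists c, (G d)`_i = iota c.
  by apply: frob_fixed_iota; rewrite -coef_frob // twGd.
have [g hg] := choice exg.
pose h := \poly_(i < size (G d)) g i.
have hE : map_poly iota h = G d.
  apply/polyP=> i; rewrite coef_map coef_poly; case: ltnP => hi; first by rewrite hg.
  by rewrite nth_default // raddf0.
rewrite -hE dvdp_map.
have rh : root (map_poly iota h) z.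
  by rewrite hE /G big_ltn // rootM expr1 root_XsubC eqxx.
have : gcdp l h %= l.
  apply: irr; last exact: dvdp_gcdl.
  apply/negP => /eqP sg.
  have : root (map_poly iota (gcdp l h)) z by rewrite gcdp_map root_gcd rz rh.
  have /size_poly1P[c c0 ->] : size (gcdp l h) == 1%N by rewrite sg.
  by rewrite map_polyC /= rootC fmorph_eq0 (negPf c0).
by move/eqp_dvdl <-; exact: dvdp_gcdr.
Qed.

End FiniteFieldPoly.

(** * Residues *)

Section Residues.
Variables (Fq : finFieldType).
Local Notation q := #|Fq|.
Variables (K : fieldType) (w : K -> int) (dv : discrete_valuation w).
Variables (u : K) (u0 : u != 0) (wu : w u = 1).
Variables (L : closedFieldType) (b : {rmorphism K -> L}).
Variable iotaK : {rmorphism Fq -> K}.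
(** The residue field is algebraic over [Fq], expressed without forming a quotient ring. *)
Hypothesis hres : forall a, val_ge w 0 a ->
  exists2 G : {poly Fq}, G \is monic & val_ge w 1 (map_poly iotaK G).[a].

Local Notation U := (b u).
Local Notation Ob := (integral_in (O_im w b)).
Let hOb : subring Ob := integral_in_subring (O_im_subring dv b).
Let iotaL : {rmorphism Fq -> L} := b \o iotaK.

Lemma val_ge_iota c : val_ge w 0 (iotaK c).
Proof.
have [->|c0] := eqVneq c 0; first by rewrite rmorph0 val_ge0.
have i0 : iotaK c != 0 by rewrite fmorph_eq0.
rewrite val_geE //.
(* From [c ^+ q = c] the valuation equals [q] times itself, so it is zero. *)
have := congr1 (fun x => w (iotaK x)) (expf_card c).
rewrite /= rmorphXn (valX dv) // -mulr_natr natz.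
by have := card_gt1 Fq; move: (w _) (q) => x n; nia.
Qed.

Lemma integral_iota c : Ob (iotaL c).
Proof. exact/(integral_O dv)/val_ge_iota. Qed.

Lemma integral_frob_periodic x : frob_periodic Fq x -> Ob x.
Proof.
case=> m m0 hx; apply/integral_over_OE; exists ('X^(q ^ m) - 'X).
  have hO := val_ge_subring dv; split; last first.
    by apply: (coefs_inB hO); [apply: (coefs_inX hO)|]; exact: (coefs_in_X hO).
  rewrite monicE lead_coefDl ?lead_coefXn // size_polyXn size_polyN size_polyX ltnS.
  by apply: leq_trans (card_gt1 Fq) _; rewrite -{1}(expn1 q) leq_exp2l ?card_gt1.
by rewrite rmorphB /= map_polyXn map_polyX rootE !hornerE hx subrr.
Qed.

(* Integral dependence over this ring means that the residue is algebraic over Fq. *)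
Definition const_mod (y : L) : Prop := exists c, exists2 z, Ob z & y = iotaL c + U * z.

Lemma const_mod_subring : subring const_mod.
Proof.
split=> [|x y [c [z hz ->]] [d [t ht ->]]|x y [c [z hz ->]] [d [t ht ->]]].
- by exists 1, 0; [exact: (subring0 hOb)|rewrite rmorph1 mulr0 addr0].
- exists (c - d), (z - t); first exact: (subringB hOb).
  by rewrite rmorphB mulrBr; ring.
- exists (c * d), (iotaL c * t + z * iotaL d + U * (z * t)).
    apply: (subringD hOb); [apply: (subringD hOb)|]; apply: (subringM hOb) => //;
      [exact: integral_iota|exact: integral_iota|exact: integral_U|exact: (subringM hOb)].
  by rewrite rmorphM /=; ring.
Qed.

Lemma const_mod_root a : val_ge w 0 a -> integral_in const_mod (b a).
Proof.
move=> ha; have [G mG hG] := hres ha.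
have sG : (0 < size G)%N by rewrite size_poly_gt0 monic_neq0.
(* The factor ['X] makes the degree positive, so that subtracting a constant keeps the polynomial
   monic; no separate case [G = 1] arises. *)
pose g := map_poly iotaL ('X * G) - (b (a * (map_poly iotaK G).[a]))%:P.
have sXG : size (map_poly iotaL ('X * G)) = (size G).+1.
  by rewrite size_map_poly mulrC size_mulX // monic_neq0.
exists g.
  split; first by rewrite monicE lead_coefDl ?lead_coef_map ?lead_coefM ?lead_coefX
    ?mul1r ?(monicP mG) ?rmorph1 // sXG size_polyN (leq_ltn_trans (size_polyC_leq1 _)).
  have hC := const_mod_subring; apply: (coefs_inB hC).
    move=> i; rewrite coef_map; exists ('X * G)`_i, 0; first exact: (subring0 hOb).
    by rewrite mulr0 addr0.
  apply: (coefs_inC hC); exists 0, (b (a * (map_poly iotaK G).[a] / u)).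
    apply: (integral_O dv); rewrite -mulrA; rewrite -[0]addr0; apply: (val_geM dv) => //.
    by rewrite -[u]expr1 -(val_ge_divX dv u0 wu).
  by rewrite rmorph0 add0r -rmorphM mulrCA divff // mulr1.
rewrite rootE hornerD hornerN hornerC (rmorphM (map_poly iotaL)) /= map_polyX hornerM hornerX rmorphM.
by rewrite /iotaL map_poly_comp horner_map subrr.
Qed.

(** An equation of [y] with coefficients in [const_mod] reduces modulo [U] to one over [Fq], to
    which [dvdp_frob_power] applies. The exponent [N] cannot be dropped: [Ob] modulo [U] has
    nilpotents, such as a square root of [U]. *)
Lemma integral_frob_mod y : Ob y -> exists m N, (0 < m)%N /\
  exists2 z, Ob z & (y ^+ (q ^ m) - y) ^+ N = U * z.
Proof.
move=> hy; have [g [mg gC] rg] : integral_in const_mod y.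
  have [g [mg gO] rg] := hy; apply: (integral_in_trans const_mod_subring mg _ rg).
  by move=> i; have [a ha ->] := gO i; exact: const_mod_root.
have ex i : exists p : Fq * L, Ob p.2 /\ g`_i = iotaL p.1 + U * p.2.
  by have [c [z hz E]] := gC i; exists (c, z).
have [cz hcz] := choice ex.
have sg : (0 < size g)%N by rewrite size_poly_gt0 monic_neq0.
pose d := (size g).-1; pose G : {poly Fq} := 'X^d + \poly_(i < d) (cz i).1.
have sP : (size (\poly_(i < d) (cz i).1) <= d)%N by exact: size_poly.
have G0 : G != 0.
  by rewrite -size_poly_gt0 size_polyDl size_polyXn.
have [m [N [m0 /dvdpP[H EH]]]] := dvdp_frob_power G0.
exists m, N; split=> //.
pose Z := \sum_(i < d) (cz i).2 * y ^+ i.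
have hZ : Ob Z.
  apply: (subring_sum hOb) => i _; apply: (subringM hOb); last exact: (subringX hOb).
  by have [] := hcz i.
have GE : (map_poly iotaL G).[y] = U * - Z.
  rewrite rmorphD /= map_polyXn hornerD hornerXn.
  have -> : (map_poly iotaL (\poly_(i < d) (cz i).1)).[y] = \sum_(i < d) iotaL (cz i).1 * y ^+ i.
    rewrite (horner_coef_wide _ (_ : _ <= d)%N); last by rewrite size_map_poly.
    by apply: eq_bigr => i _; rewrite coef_map coef_poly ltn_ord.
  move: (rootP rg); rewrite horner_coef -(prednK sg) big_ord_recr /= -/d.
  have -> : g`_d = 1 by move: mg; rewrite monicE lead_coefE => /eqP.
  rewrite mul1r => /eqP; rewrite addrC addr_eq0 => /eqP ->.
  rewrite mulrN mulr_sumr addrC -sumrB -sumrN; apply: eq_bigr => i _.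
  by have [_ ->] := hcz i; ring.
exists ((map_poly iotaL H).[y] * - Z).
  apply: (subringM hOb); last exact: (subringN hOb).
  by apply: (coefs_in_horner hOb) => // i; rewrite coef_map; exact: integral_iota.
have := congr1 (fun p => (map_poly iotaL p).[y]) EH.
by rewrite /= rmorphM rmorphXn rmorphB /= map_polyXn map_polyX horner_exp hornerD hornerN hornerXn hornerX hornerM GE => ->; rewrite mulrCA.
Qed.

(** Inside K the exponent disappears: an element of valuation 0 has no power divisible by [u]. *)
Lemma val_frob_mod a : val_ge w 0 a ->
  exists2 m, (0 < m)%N & val_ge w 1 (a ^+ (q ^ m) - a).
Proof.
move=> ha; have [m [N [m0 [z hz E]]]] := integral_frob_mod (integral_O dv b ha).
exists m => //; set t := a ^+ (q ^ m) - a.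
have ht : val_ge w 0 t.
  have hO := val_ge_subring dv; apply: (subringB hO) => //; exact: (subringX hO).
have [->|t0] := eqVneq t 0; first exact: val_ge0.
rewrite val_geE //; rewrite val_geE // in ht.
suff : w t != 0 by move: ht; lia.
apply/negP => /eqP wt.
have : val_ge w 0 (t ^+ N / u).
  apply: (integral_O_closed dv (b := b)); rewrite rmorphM fmorphV rmorphXn /t.
  by rewrite rmorphB rmorphXn E mulrAC divff ?fmorph_eq0 // mul1r.
rewrite val_geE ?mulf_neq0 ?invr_eq0 ?expf_neq0 //.
by rewrite (valM dv) ?invr_eq0 ?expf_neq0 // (valX dv) // (valV dv) // wt wu mul0rn.
Qed.

End Residues.

(** * Hensel's lemma *)

Section Hensel.
Variables (K : fieldType) (w : K -> int) (dv : discrete_valuation w).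
Variables (cw : val_complete w).
Variables (u : K) (u0 : u != 0) (wu : w u = 1).
Variables (L : closedFieldType) (b : {rmorphism K -> L}).
Hypothesis hb : algebraic_closure b.
Local Notation U := (b u).
Local Notation Ob := (integral_in (O_im w b)).
Let hOb : subring Ob := integral_in_subring (O_im_subring dv b).

Lemma val_ge_uX n : val_ge w n%:Z (u ^+ n).
Proof. by rewrite val_geE ?expf_neq0 // (valX dv) // wu natz. Qed.

Lemma power_series_cvg (c : nat -> K) : (forall i, val_ge w 0 (c i)) ->
  exists s, forall n : nat, val_ge w n%:Z (s - \sum_(0 <= i < n) u ^+ i * c i).
Proof.
move=> hc; pose S n := \sum_(0 <= i < n) u ^+ i * c i.
have tail (n m : nat) : (n <= m)%N -> val_ge w n%:Z (S m - S n).
  move=> nm; rewrite /S (big_cat_nat (leq0n n) nm) //= addrAC subrr add0r.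
  rewrite big_nat_cond; apply: (val_ge_sum dv) => i /andP[/andP[ni _] _].
  apply: (val_geMr dv) => //; apply: val_ge_le (val_ge_uX i); lia.
have [|s hs] := cw (u := S).
  move=> n; exists `|n|%N => i j hi hj.
  have [ij|/ltnW ji] := leqP j i.
    apply: val_ge_le (tail _ _ ij); lia.
  by rewrite -(val_geN dv) opprB; apply: val_ge_le (tail _ _ ji); lia.
exists s => n; have [N hN] := hs n%:Z.
have -> : s - S n = (S (maxn N n) - S n) - (S (maxn N n) - s) by ring.
by apply: (val_geB dv); [apply: tail; exact: leq_maxr|apply: hN; exact: leq_maxl].
Qed.

Definition spanned (B : L -> Prop) (s : seq L) : Prop := forall x, B x <->
  exists2 c : nat -> K, (forall i, val_ge w 0 (c i)) &
    x = \sum_(i < size s) b (c i) * s`_i.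

Section Algebra.
Variables (B : L -> Prop) (s : seq L).
Hypotheses (hB : subring B) (Bs : spanned B s) (BOb : forall x, B x -> Ob x).
Hypothesis BO : forall a, val_ge w 0 a -> B (b a).

Let BU n : B (U ^+ n).
Proof. by apply: (subringX hB); apply: BO; rewrite val_geE // wu. Qed.

(** The limit is taken on each coordinate with respect to the generators. These need not be
    independent, since any choice of coordinates with values in O gives convergent series. *)
Lemma spanned_series (z : nat -> L) : (forall i, B (z i)) ->
  exists2 t, B t & forall n : nat,
    exists2 r, B r & t - \sum_(0 <= i < n) U ^+ i * z i = U ^+ n * r.
Proof.
move=> hz; have ex n : exists c : nat -> K, (forall i, val_ge w 0 (c i)) /\
    z n = \sum_(i < size s) b (c i) * s`_i.
  by have [c hc E] := (Bs _).1 (hz n); exists c.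
have [c hc] := choice ex.
have ex2 k : exists t, forall n : nat,
    val_ge w n%:Z (t - \sum_(0 <= i < n) u ^+ i * c i k).
  by apply: power_series_cvg => i; have [] := hc i.
have [C hC] := choice ex2.
exists (\sum_(k < size s) b (C k) * s`_k).
  apply/Bs; exists C => // k; have := hC k 0%N; by rewrite big_geq // subr0.
move=> n; pose r k := (C k - \sum_(0 <= i < n) u ^+ i * c i k) / u ^+ n.
exists (\sum_(k < size s) b (r k) * s`_k).
  by apply/Bs; exists r => // k; rewrite /r -(val_ge_divX dv u0 wu).
have -> : \sum_(0 <= i < n) U ^+ i * z i =
    \sum_(k < size s) b (\sum_(0 <= i < n) u ^+ i * c i k) * s`_k.
  under eq_bigr do rewrite (hc _).2 mulr_sumr.
  rewrite exchange_big; apply: eq_bigr => k _.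
  rewrite rmorph_sum mulr_suml; apply: eq_bigr => i _.
  by rewrite rmorphM rmorphXn mulrA.
rewrite -sumrB mulr_sumr; apply: eq_bigr => k _.
rewrite -mulrBl -rmorphB mulrA; congr (_ * _).
rewrite -rmorphXn -rmorphM /r mulrCA divff ?mulr1 //.
by rewrite expf_neq0.
Qed.

Lemma taylor2 (f : {poly L}) x y : coefs_in B f -> B x -> B y ->
  exists2 r, B r & f.[x + y] = f.[x] + f^`().[x] * y + y ^+ 2 * r.
Proof.
move=> + hx hy; elim/poly_ind: f => [|p c IH] hf.
  by exists 0; [exact: (subring0 hB)|rewrite deriv0 !horner0; ring].
have hp : coefs_in B p.
  move=> i; have := hf i.+1; by rewrite coefD coefMX coefC /= addr0.
have [r hr E] := IH hp.
have hp' : B (p^`().[x]).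
  apply: (coefs_in_horner hB) => // i; rewrite coef_deriv -mulr_natl.
  apply: (subringM hB) => //; rewrite -(rmorph_nat b); apply: BO.
  by elim: (i.+1) => [|n IHn]; rewrite ?mulr0n ?val_ge0 // mulrS;
    apply: (val_geD dv) => //; exact: (val_ge1 dv).
exists (r * x + p^`().[x] + r * y).
  by apply: (subringD hB); [apply: (subringD hB)|]; rewrite //; exact: (subringM hB).
by rewrite derivD derivC derivM derivX !hornerE E; ring.
Qed.

Lemma divisible_all_eq0 y : (forall n, exists2 r, B r & y = U ^+ n * r) -> y = 0.
Proof.
move=> h; apply/eqP/negPn/negP => y0.
have [n hn] := integral_separated dv u0 wu hb y0; apply: hn.
have [r /BOb hr ->] := h n; rewrite mulrAC divff ?mul1r //.
by rewrite expf_neq0 // (U_neq0 b u0).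
Qed.

(** With derivative -1 the Newton step is [y + f(y)], and it needs no inverse. By Taylor, [f] at the
    new point is a multiple of the square of its old value; only the gain of one factor [U] is
    recorded, which is enough for the series of corrections to converge. *)
Lemma hensel (f : {poly L}) a t : coefs_in B f -> f^`() = - 1 ->
  B a -> B t -> f.[a] = U * t ->
  exists2 e, root f e & exists2 r, B r & e = a + U * r.
Proof.
move=> hf df ha ht fa.
pose x n := iter n (fun y => y + f.[y]) a.
have step n : B (x n) /\ exists2 r, B r & f.[x n] = U ^+ n.+1 * r.
  elim: n => [|n [hx [r hr Er]]]; first by split=> //; exists t.
  have hfx : B f.[x n] by exact: (coefs_in_horner hB).
  split; first exact: (subringD hB).
  have [r' hr' E'] := taylor2 hf hx hfx.
  exists (U ^+ n * (r ^+ 2 * r')).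
    by apply: (subringM hB) => //; apply: (subringM hB) => //; exact: (subringX hB).
  rewrite /= E' df hornerN hornerC Er !exprS; ring.
have ex n : exists r, B r /\ f.[x n] = U ^+ n.+1 * r.
  by have [_ [r]] := step n; exists r.
have [z hz] := choice ex.
have hUz i : B (U * z i) by apply: (subringM hB); [exact: (BU 1)|have [] := hz i].
have [v hv Ev] := spanned_series hUz.
have xE n : x n = a + \sum_(0 <= i < n) U ^+ i * (U * z i).
  elim: n => [|n IH]; first by rewrite big_geq // addr0.
  by rewrite big_nat_recr //= addrA -IH (hz n).2 exprSr; ring.
exists (a + v).
  apply/rootP; apply: divisible_all_eq0 => n.
  have [hx [r hr Er]] := step n; have [r' hr' Er'] := Ev n.
  have hUr : B (U ^+ n * r') by exact: (subringM hB).
  have [r2 hr2 E2] := taylor2 hf hx hUr.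
  have -> : a + v = x n + U ^+ n * r' by rewrite xE -Er'; ring.
  exists (U * r - r' + r' * (U ^+ n * r') * r2).
    apply: (subringD hB); last by do 2!apply: (subringM hB) => //.
    by apply: (subringB hB) => //; apply: (subringM hB) => //; exact: (BU 1).
  by rewrite E2 Er df hornerN hornerC exprSr; ring.
have [r hr Er] := Ev 1%N; exists (z 0%N + r).
  by apply: (subringD hB) => //; have [] := hz 0%N.
by move: Er; rewrite big_nat1 expr0 mul1r expr1 => /eqP; rewrite subr_eq => /eqP ->; ring.
Qed.

End Algebra.
End Hensel.

(** * Unramified elements *)

Section Span.
Variables (K : fieldType) (w : K -> int) (dv : discrete_valuation w).
Variables (L : closedFieldType) (b : {rmorphism K -> L}).
Local Notation Ob := (integral_in (O_im w b)).

Definition Ospan (s : seq L) (x : L) : Prop :=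
  exists2 c : nat -> K, (forall i, val_ge w 0 (c i)) &
    x = \sum_(i < size s) b (c i) * s`_i.

Lemma Ospan0 s : Ospan s 0.
Proof.
exists (fun=> 0) => [i|]; first exact: val_ge0.
by rewrite big1 // => i _; rewrite rmorph0 mul0r.
Qed.

Lemma OspanB s x y : Ospan s x -> Ospan s y -> Ospan s (x - y).
Proof.
move=> [c hc ->] [d hd ->]; exists (fun i => c i - d i).
  by move=> i; exact: (val_geB dv).
by rewrite -sumrB; apply: eq_bigr => i _; rewrite rmorphB mulrBl.
Qed.

Lemma OspanD s x y : Ospan s x -> Ospan s y -> Ospan s (x + y).
Proof.
by move=> hx hy; rewrite -[y]opprK -[- y]add0r; apply: OspanB => //; apply: OspanB => //;
  exact: Ospan0.
Qed.

Lemma OspanZ s a x : val_ge w 0 a -> Ospan s x -> Ospan s (b a * x).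
Proof.
move=> ha [c hc ->]; exists (fun i => a * c i).
  by move=> i; exact: (val_geMr dv).
by rewrite mulr_sumr; apply: eq_bigr => i _; rewrite rmorphM mulrA.
Qed.

Lemma Ospan_mem s x : x \in s -> Ospan s x.
Proof.
move=> xs; exists (fun i => (i == index x s)%:R).
  by move=> i; case: eqP => _; rewrite ?val_ge0 // (val_ge1 dv).
have hi : (index x s < size s)%N by rewrite index_mem.
rewrite (bigD1 (Ordinal hi)) //= eqxx rmorph1 mul1r nth_index //.
rewrite big1 ?addr0 // => i; rewrite -val_eqE /= => /negPf ->.
by rewrite rmorph0 mul0r.
Qed.

Lemma Ospan_sum s (I : Type) (r : seq I) (P : pred I) (F : I -> L) :
  (forall i, P i -> Ospan s (F i)) -> Ospan s (\sum_(i <- r | P i) F i).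
Proof.
move=> h; elim/big_rec: _ => [|i x Pi hx]; first exact: Ospan0.
by apply: OspanD => //; exact: h.
Qed.

Lemma Ospan_mulr s s' y x : (forall z, z \in s -> Ospan s' (z * y)) ->
  Ospan s x -> Ospan s' (x * y).
Proof.
move=> h [c hc ->]; rewrite mulr_suml; apply: Ospan_sum => i _.
by rewrite -mulrA; apply: OspanZ => //; apply: h; exact: mem_nth.
Qed.

Lemma Ospan_subring s : 1 \in s -> (forall x y, x \in s -> y \in s -> x * y \in s) ->
  subring (Ospan s).
Proof.
move=> s1 sM; split=> [|x y|x y hx hy]; [exact: Ospan_mem|exact: OspanB|].
apply: (Ospan_mulr _ hx) => z hz; rewrite mulrC; apply: (Ospan_mulr _ hy) => t ht.
by apply: Ospan_mem; exact: sM.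
Qed.

Lemma Ospan_sub s (T : L -> Prop) : subring T ->
  (forall a, val_ge w 0 a -> T (b a)) -> (forall z, z \in s -> T z) ->
  forall x, Ospan s x -> T x.
Proof.
move=> hT TO Ts x [c hc ->]; apply: (subring_sum hT) => i _.
by apply: (subringM hT); [exact: TO|apply: Ts; exact: mem_nth].
Qed.

(** [B'] is B[y]: division by a monic equation bounds the powers of [y] that are needed as
    generators. The last clause, minimality, is what later places the new algebra inside [Ob] and
    inside K[x]. *)
Lemma adjoin_integral (B : L -> Prop) (s : seq L) y :
  subring B -> (forall a, val_ge w 0 a -> B (b a)) ->
  (forall x, B x <-> Ospan s x) -> Ob y ->
  exists B' s', [/\ subring B', (forall x, B' x <-> Ospan s' x),
    forall x, B x -> B' x, B' y &
    forall T, subring T -> (forall x, B x -> T x) -> T y -> forall x, B' x -> T x].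
Proof.
move=> hB BO Bs [g [mg gO] rg].
pose B' x := exists2 p : {poly L}, coefs_in B p & x = p.[y].
have BB' x : B x -> B' x by move=> hx; exists x%:P; [exact: (coefs_inC hB)|rewrite hornerC].
have B'y : B' y by exists 'X; [exact: (coefs_in_X hB)|rewrite hornerX].
have hB' : subring B'.
  split=> [|_ _ [p hp ->] [r hr ->]|_ _ [p hp ->] [r hr ->]].
  - by apply: BB'; exact: (subring1 hB).
  - by exists (p - r); [exact: (coefs_inB hB)|rewrite !hornerE].
  - by exists (p * r); [exact: (coefs_inM hB)|rewrite !hornerE].
have subT T : subring T -> (forall x, B x -> T x) -> T y -> forall x, B' x -> T x.
  by move=> hT BT Ty _ [p hp ->]; apply: (coefs_in_horner hT) => // i; exact: BT.
pose s' := [seq z * y ^+ i | z <- s, i <- seq.iota 0 (size g)].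
exists B', s'; split=> // x; split=> [[p hp ->]|]; last first.
  apply: Ospan_sub => // [a ha|z /allpairsP[[z1 i] /= [hz _ ->]]].
    exact/BB'/BO.
  apply: (subringM hB'); last exact: (subringX hB').
  by apply/BB'/Bs; exact: Ospan_mem.
have gB : coefs_in B g by move=> i; have [a ha ->] := gO i; exact: BO.
have [k [r [-> _ rB sr]]] := monic_division (subring0 hB) (fun x y => subringD hB (x:=x) (y:=y))
  (subringB hB) (subringM hB) hp mg gB.
rewrite hornerD hornerM (rootP rg) mulr0 add0r.
rewrite (horner_coef_wide _ (ltnW sr)); apply: Ospan_sum => i _.
apply: (@Ospan_mulr s); last exact/Bs.
move=> z hz; apply: Ospan_mem; apply/allpairsP; exists (z, nat_of_ord i) => /=.
by rewrite hz mem_iota ltn_ord.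
Qed.

End Span.

Section Unramified.
Variables (Fq : finFieldType).
Local Notation q := #|Fq|.
Variables (K : fieldType) (w : K -> int) (dv : discrete_valuation w).
Variables (cw : val_complete w).
Variables (u : K) (u0 : u != 0) (wu : w u = 1).
Variables (L : closedFieldType) (b : {rmorphism K -> L}).
Hypothesis hb : algebraic_closure b.
Variable iotaK : {rmorphism Fq -> K}.
Hypothesis hres : forall a, val_ge w 0 a ->
  exists2 G : {poly Fq}, G \is monic & val_ge w 1 (map_poly iotaK G).[a].

Local Notation U := (b u).
Local Notation Ob := (integral_in (O_im w b)).
Let hOb : subring Ob := integral_in_subring (O_im_subring dv b).
Let iotaL : {rmorphism Fq -> L} := b \o iotaK.
Local Notation Fb := (@frob_periodic Fq L).
Let hFb : subring Fb := frob_periodic_subring iotaL.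
Let hO := val_ge_subring dv.
Let U0 : U != 0 := U_neq0 b u0.
Let Ou : val_ge w 0 u.
Proof. by rewrite val_geE // wu. Qed.

Let exFm m : {r : seq L | 'X^(q ^ m) - 'X = lead_coef ('X^(q ^ m) - 'X : {poly L}) *:
  \prod_(z <- r) ('X - z%:P)} := closed_field_poly_normal _.

(** The field with [q ^ m] elements in [L]. At [m = 0] the polynomial is zero and has no list of
    roots, hence the default. As [Fm m] is closed under products, its O-span [Wm] is a ring. *)
Definition Fm m : seq L := if m is 0 then [:: 1] else sval (exFm m).

Lemma mem_Fm m x : (0 < m)%N -> (x \in Fm m) = (x ^+ (q ^ m) == x).
Proof.
case: m => // m _; rewrite /Fm; case: (exFm m.+1) => r /= E.
have sz : (size (- 'X : {poly L}) < size ('X^(q ^ m.+1) : {poly L}))%N.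
  rewrite size_polyXn size_polyN size_polyX ltnS.
  by apply: leq_trans (card_gt1 Fq) _; rewrite -{1}(expn1 q) leq_exp2l ?card_gt1.
have l1 : lead_coef ('X^(q ^ m.+1) - 'X : {poly L}) = 1.
  by rewrite lead_coefDl // lead_coefXn.
have := congr1 (fun p => root p x) E; rewrite l1 scale1r root_prod_XsubC => <-.
by rewrite rootE !hornerE subr_eq0.
Qed.

Definition Wm m : L -> Prop := Ospan w b (Fm m).

Lemma Wm_subring m : (0 < m)%N -> subring (Wm m).
Proof.
move=> m0; apply: (Ospan_subring dv); first by rewrite mem_Fm // expr1n.
by move=> x y; rewrite !mem_Fm // => /eqP hx /eqP hy; rewrite exprMn hx hy.
Qed.

Lemma Wm_O m a : (0 < m)%N -> val_ge w 0 a -> Wm m (b a).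
Proof.
move=> m0 ha; rewrite -[b a]mulr1; apply: (OspanZ dv) => //.
exact: (subring1 (Wm_subring m0)).
Qed.

Lemma Wm_mono m k x : (0 < m)%N -> (0 < k)%N -> Wm m x -> Wm (m * k) x.
Proof.
move=> m0 k0; have mk : (0 < m * k)%N by rewrite muln_gt0 m0.
apply: (Ospan_sub (Wm_subring mk)) => [a|z]; first exact: Wm_O.
rewrite mem_Fm // => /eqP hz; apply: (Ospan_mem dv).
by rewrite mem_Fm // frob_mul.
Qed.

Lemma Wm_integral m x : (0 < m)%N -> Wm m x -> Ob x.
Proof.
move=> m0; apply: (Ospan_sub hOb) => [a|z]; first exact: (integral_O dv).
rewrite mem_Fm // => /eqP hz; apply: (integral_frob_periodic dv b (Fq := Fq)).
by exists m.
Qed.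

(* The valuation ring of the compositum of K with the algebraic closure of Fq *)
Definition Wur x : Prop := exists2 m, (0 < m)%N & Wm m x.

Lemma Wur_common (s : seq L) : (forall x, x \in s -> Wur x) ->
  exists2 m, (0 < m)%N & forall x, x \in s -> Wm m x.
Proof.
elim: s => [|x s IH] hs; first by exists 1%N.
have [|m m0 hm] := IH; first by move=> y ys; apply: hs; rewrite inE ys orbT.
have [k k0 hk] := hs x (mem_head _ _).
exists (m * k)%N; first by rewrite muln_gt0 m0.
move=> y; rewrite inE => /orP[/eqP ->|ys]; first by rewrite mulnC; exact: Wm_mono.
by apply: Wm_mono => //; exact: hm.
Qed.

Lemma Wur_subring : subring Wur.
Proof.
split=> [|x y hx hy|x y hx hy]; first by exists 1%N => //; exact: (subring1 (Wm_subring _)).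
  have [|m m0 hm] := @Wur_common [:: x; y].
    by move=> z; rewrite !inE => /orP[] /eqP ->.
  by exists m => //; apply: (subringB (Wm_subring m0)); apply: hm; rewrite !inE eqxx ?orbT.
have [|m m0 hm] := @Wur_common [:: x; y].
  by move=> z; rewrite !inE => /orP[] /eqP ->.
by exists m => //; apply: (subringM (Wm_subring m0)); apply: hm; rewrite !inE eqxx ?orbT.
Qed.
Let hW := Wur_subring.

Lemma Wur_O a : val_ge w 0 a -> Wur (b a).
Proof. by exists 1%N => //; exact: Wm_O. Qed.

Lemma Wur_U : Wur U. Proof. exact: Wur_O. Qed.

Lemma Wur_Fb z : Fb z -> Wur z.
Proof.
by case=> m m0 hz; exists m => //; apply: (Ospan_mem dv); rewrite mem_Fm // hz.
Qed.

Lemma Wur_integral x : Wur x -> Ob x.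
Proof. by case=> m m0; exact: Wm_integral. Qed.

Let frobpoly m : {poly L} := 'X^(q ^ m) - 'X.

Let coefs_frobpoly m (T : L -> Prop) : subring T -> coefs_in T (frobpoly m).
Proof.
by move=> hT; apply: (coefs_inB hT); [apply: (coefs_inX hT)|]; exact: (coefs_in_X hT).
Qed.

Let deriv_frobpoly m : (0 < m)%N -> (frobpoly m)^`() = -1.
Proof.
move=> m0; rewrite derivB derivXn derivX.
rewrite -scaler_nat natrX (natr_card iotaL) expr0n.
by rewrite (gtn_eqF m0) scale0r sub0r.
Qed.

(** The representative is the root of ['X^(q ^ m) - 'X] near [a]. Hensel's lemma runs inside [B], so
    the quotient [t] of the defect by [U] has to lie in [B] as well. *)
Lemma teichmuller (B : L -> Prop) (s : seq L) m a t :
  subring B -> spanned w b B s -> (forall x, B x -> Ob x) ->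
  (forall a, val_ge w 0 a -> B (b a)) -> (0 < m)%N ->
  B a -> B t -> a ^+ (q ^ m) - a = U * t ->
  exists2 e, Fb e & exists2 r, B r & a = e + U * r.
Proof.
move=> hB Bs BOb BO m0 Ba Bt E.
have Ef : (frobpoly m).[a] = U * t by rewrite !hornerE.
have [e re [r hr Er]] := hensel dv cw u0 wu hb hB Bs BOb BO (coefs_frobpoly m hB)
  (deriv_frobpoly m0) Ba Bt Ef.
exists e.
  by exists m => //; move: re; rewrite rootE !hornerE subr_eq0 => /eqP.
exists (- r); first exact: (subringN hB).
by rewrite Er; ring.
Qed.

Lemma O_im_spanned : spanned w b (O_im w b) [:: 1].
Proof.
move=> x; split=> [[a ha ->]|[c hc ->]].
  by exists (fun=> a) => //; rewrite big_ord1 /= mulr1.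
by exists (c 0%N) => //; rewrite big_ord1 /= mulr1.
Qed.

Lemma Wur_residue_O a : val_ge w 0 a -> exists2 e, Fb e & exists2 r, Wur r & b a = e + U * r.
Proof.
move=> ha; have [m m0 hm] := val_frob_mod dv u0 wu b hres ha.
have hOi := O_im_subring dv b.
have iO x : O_im w b x -> Ob x by move=> [c hc ->]; exact: (integral_O dv).
have OO c : val_ge w 0 c -> O_im w b (b c) by exists c.
have ht : val_ge w 0 ((a ^+ (q ^ m) - a) / u).
  by rewrite -[u]expr1 -(val_ge_divX dv u0 wu).
have [|e he [r [c hc ->] E]] := teichmuller hOi O_im_spanned iO OO m0 (OO _ ha) (OO _ ht).
  by rewrite -rmorphM mulrCA divff // mulr1 rmorphB rmorphXn.
by exists e => //; exists (b c) => //; exact: Wur_O.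
Qed.

Lemma Wur_residue x : Wur x -> exists2 e, Fb e & exists2 r, Wur r & x = e + U * r.
Proof.
case=> m m0 [c hc {x}->]; elim/big_rec: _ => [|i x _ [e he [r hr ->]]].
  exists 0; first exact: (subring0 hFb).
  by exists 0; [exact: (subring0 hW)|rewrite mulr0 addr0].
have [e' he' [r' hr' E]] := Wur_residue_O (hc i).
have hz : Fb (Fm m)`_i.
  by exists m => //; apply/eqP; rewrite -mem_Fm //; exact: mem_nth.
exists (e' * (Fm m)`_i + e); first by apply: (subringD hFb) => //; exact: (subringM hFb).
exists (r' * (Fm m)`_i + r); last by rewrite E; ring.
by apply: (subringD hW) => //; apply: (subringM hW) => //; exact: Wur_Fb.
Qed.

(** The condition that [max_unramified] puts on the nonzero elements of K[x]: the valuation is that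
    of an element of K. *)
Definition has_val (x : L) : Prop :=
  exists2 c : K, c != 0 & Ob (x / b c) /\ Ob (b c / x).

Lemma has_val_scale a x : a != 0 -> has_val x -> has_val (b a * x).
Proof.
move=> a0 [c c0 [h1 h2]]; exists (a * c); first exact: mulf_neq0.
have ba0 : b a != 0 by rewrite fmorph_eq0.
rewrite rmorphM -mulf_div divff // mul1r; split=> //.
by rewrite -mulf_div divff // mul1r.
Qed.

Lemma has_val_unscale a x : a != 0 -> has_val (b a * x) -> has_val x.
Proof.
move=> a0 /(has_val_scale (invr_neq0 a0)); rewrite mulrA -rmorphM mulVf //.
by rewrite rmorph1 mul1r.
Qed.

Lemma has_val_1DU x z : has_val x -> Ob z -> has_val (x * (1 + U * z)).
Proof.
move=> [c c0 [h1 h2]] hz; have [n0 hV] := integral_1DU dv u0 wu hz.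
exists c => //; split.
  rewrite mulrAC; apply: (subringM hOb) => //; apply: (subringD hOb).
    exact: (subring1 hOb).
  by apply: (subringM hOb) => //; apply: (integral_O dv).
by rewrite invfM mulrA; exact: (subringM hOb).
Qed.

Lemma has_val_Fb e : Fb e -> e != 0 -> has_val e.
Proof.
move=> he e0; exists 1; first exact: oner_neq0.
rewrite rmorph1 divr1 div1r; split; first exact: Wur_integral (Wur_Fb _).
exact/Wur_integral/Wur_Fb/frob_periodicV.
Qed.

(** Look at the first Teichmueller digit [e] of [x]. If it is zero, divide by [U], which can happen
    fewer than [N] times; otherwise [x = e (1 + U r / e)] is a unit. *)
Lemma has_val_Wur x : Wur x -> x != 0 -> has_val x.
Proof.
move=> + x0; have [N] := integral_separated dv u0 wu hb x0.
elim: N x x0 => [|N IH] x x0 hN hx.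
  by case: hN; rewrite expr0 divr1; exact: Wur_integral.
have [e he [r hr E]] := Wur_residue hx.
have [e0|e0] := eqVneq e 0.
  move: E; rewrite e0 add0r => E; have r0 : r != 0.
    by apply: contraNneq x0 => r0; rewrite E r0 mulr0.
  rewrite E; apply: has_val_scale => //; apply: IH => // hN'; apply: hN.
  rewrite E exprS; suff -> : U * r / (U * U ^+ N) = r / U ^+ N by [].
  by rewrite -mulf_div divff // mul1r.
have -> : x = e * (1 + U * (r / e)).
  by rewrite E; field.
apply: has_val_1DU; first exact: has_val_Fb.
by apply: (subringM hOb); [exact: Wur_integral|exact/Wur_integral/Wur_Fb/frob_periodicV].
Qed.

Lemma poly_scale (g : {poly K}) : exists M : nat, coefs_in (val_ge w 0) (u ^+ M *: g).
Proof.
have [M hM] := val_poly_bound w g; exists M => i.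
rewrite coefZ -(addrN M%:Z); apply: (val_geM dv); last exact: hM.
exact: (val_ge_uX dv u0 wu).
Qed.

Lemma Wur_unramified x : Wur x -> max_unramified w b x.
Proof.
move=> hx g /= gx0; have [M hM] := poly_scale g.
have uM0 : u ^+ M != 0 by rewrite expf_neq0.
have : has_val (b (u ^+ M) * (map_poly b g).[x]).
  apply: has_val_Wur; last by rewrite mulf_neq0 // fmorph_eq0.
  rewrite -hornerZ -linearZ /=; apply: (coefs_in_horner hW) => // i.
  by rewrite coef_map; apply: Wur_O; exact: hM.
move/(has_val_unscale uM0) => [c c0 [h1 h2]]; exists c => //.
by split; apply/integral_over_OE.
Qed.

(* By unramified_approx and has_val_approx, this is the maximal unramified
   extension; here it is visibly an additive group. *)
Definition approx x : Prop := exists M : nat, forall N : nat,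
  exists s t, [/\ Wur s, Ob t & U ^+ M * x = s + U ^+ N * t].

Lemma approx_raise x M k : (forall N : nat, exists s t,
     [/\ Wur s, Ob t & U ^+ M * x = s + U ^+ N * t]) ->
  forall N : nat, exists s t,
     [/\ Wur s, Ob t & U ^+ (M + k) * x = s + U ^+ N * t].
Proof.
move=> h N; have [s [t [hs ht E]]] := h N.
exists (U ^+ k * s), (U ^+ k * t); split.
- by apply: (subringM hW) => //; apply: (subringX hW); exact: Wur_U.
- by apply: (subringM hOb) => //; apply: (subringX hOb); exact: (integral_O dv).
- by rewrite exprD mulrAC E; ring.
Qed.

Lemma approxB x y : approx x -> approx y -> approx (x - y).
Proof.
move=> [M hM] [M' hM']; exists (M + M')%N => N.
have [s [t [hs ht E]]] := approx_raise M' hM N.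
have := approx_raise M hM' N; rewrite addnC => -[s' [t' [hs' ht' E']]].
exists (s - s'), (t - t'); split; [exact: (subringB hW)|exact: (subringB hOb)|].
by rewrite mulrBr E E'; ring.
Qed.

Lemma approx_K a : approx (b a).
Proof.
have [M hM] := poly_scale a%:P; exists M => N; exists (b (u ^+ M * a)), 0.
split; [|exact: (subring0 hOb)|by rewrite rmorphM rmorphXn mulr0 addr0].
by apply: Wur_O; have := hM 0%N; rewrite coefZ coefC.
Qed.

Lemma approx0 : approx 0. Proof. by rewrite -(rmorph0 b); exact: approx_K. Qed.

Lemma approxD x y : approx x -> approx y -> approx (x + y).
Proof.
move=> hx hy; rewrite -[y]opprK -[- y]add0r; apply: approxB => //; apply: approxB => //.
exact: approx0.
Qed.

Lemma approxM x a : approx x -> approx (x * b a).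
Proof.
move=> [M hM]; have [k hk] := poly_scale a%:P.
have {}hk : val_ge w 0 (u ^+ k * a) by have := hk 0%N; rewrite coefZ coefC.
exists (M + k)%N => N; have [s [t [hs ht E]]] := hM N.
exists (b (u ^+ k * a) * s), (b (u ^+ k * a) * t); split.
- by apply: (subringM hW) => //; exact: Wur_O.
- by apply: (subringM hOb) => //; exact: (integral_O dv).
rewrite rmorphM rmorphXn exprD.
have -> : U ^+ M * U ^+ k * (x * b a) = U ^+ k * b a * (U ^+ M * x) by ring.
by rewrite E /=; ring.
Qed.

(** With [y = U ^+ M * x] not divisible by [U ^+ N], approximate [y] modulo [U ^+ N.+1] by [s] in
    [Wur]. Then [s] has valuation at most [N], so [y] is [s] times some [1 + U z] with [z] integral,
    and both have the same valuation. *)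
Lemma has_val_approx x : approx x -> x != 0 -> has_val x.
Proof.
move=> [M hM] x0; have uM0 : u ^+ M != 0 by rewrite expf_neq0.
apply: (has_val_unscale uM0).
have y0 : b (u ^+ M) * x != 0 by rewrite mulf_neq0 // fmorph_eq0.
move: y0; rewrite rmorphXn; set y := _ * x => y0.
have [N hN] := integral_separated dv u0 wu hb y0.
have [s [t [hs ht E]]] := hM N.+1; rewrite -/y in E.
have UN0 : U ^+ N != 0 by rewrite expf_neq0.
have hU : Ob U by exact: (integral_O dv).
have yN v : y = U ^+ N * v -> ~ Ob v.
  by move=> Ev hv; apply: hN; rewrite Ev mulrAC divff // mul1r.
have s0 : s != 0.
  apply/negP => /eqP s0; apply: (yN (U * t)); last exact: (subringM hOb).
  by rewrite E s0 add0r exprSr mulrA.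
have [c c0 [h1 h2]] := has_val_Wur hs s0.
have bc0 : b c != 0 by rewrite fmorph_eq0.
have wc : w c <= N.
  rewrite leNgt; apply/negP => wc; apply: (yN (b (c / u ^+ N) * (s / b c) + U * t)).
    rewrite E rmorphM fmorphV rmorphXn mulrDr exprSr mulrA; congr (_ + _); last by ring.
    by field; rewrite ?UN0 ?bc0.
  apply: (subringD hOb); apply: (subringM hOb) => //; apply: (integral_O dv).
  by rewrite -(val_ge_divX dv u0 wu) val_geE // ltW.
have hk : Ob (U ^+ N / s).
  have -> : U ^+ N / s = b (u ^+ N / c) * (b c / s).
    by rewrite rmorphM fmorphV rmorphXn; field; rewrite ?s0 ?bc0.
  apply: (subringM hOb) => //; apply: (integral_O dv).
  rewrite val_geE ?mulf_neq0 ?invr_eq0 ?expf_neq0 //.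
  rewrite (valM dv) ?invr_eq0 ?expf_neq0 // (valX dv) // wu (valV dv) // natz.
  by move: wc; clear; lia.
have -> : y = s * (1 + U * (U ^+ N / s * t)).
  by rewrite E exprS; field.
apply: has_val_1DU; last exact: (subringM hOb).
by exists c.
Qed.

(** Some power of [t = y ^+ (q ^ m) - y] is divisible by [U], so [t] has positive valuation. Because
    [x] is unramified, that valuation is an integer, hence at least 1, and [t] itself is divisible
    by [U]. The remainder [z] stays in K[x], so the step can be repeated. *)
Lemma unramified_residue x y : max_unramified w b x ->
  (exists g, y = (map_poly b g).[x]) -> Ob y ->
  exists e z, [/\ Fb e, Ob z, exists g, z = (map_poly b g).[x] & y = e + U * z].
Proof.
move=> hx; pose V y := exists g, y = (map_poly b g).[x]; rewrite -/(V y) => Vy hy.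
have hV : subring V.
  split=> [|_ _ [g ->] [h ->]|_ _ [g ->] [h ->]].
  - by exists 1; rewrite rmorph1 hornerC.
  - by exists (g - h); rewrite rmorphB /= !hornerE.
  - by exists (g * h); rewrite rmorphM /= !hornerE.
have VK a : V (b a) by exists a%:P; rewrite map_polyC hornerC.
have [m [N [m0 [z0 hz0 E0]]]] := integral_frob_mod dv u0 wu hres hy.
have Vt : V (y ^+ (q ^ m) - y) by apply: (subringB hV) => //; exact: (subringX hV).
have Ot : Ob (y ^+ (q ^ m) - y) by apply: (subringB hOb) => //; exact: (subringX hOb).
set t := y ^+ (q ^ m) - y in E0 Vt Ot.
have [t0|t0] := eqVneq t 0.
  exists y, 0; split; [|exact: (subring0 hOb)| |by rewrite mulr0 addr0].
    by exists m => //; apply/eqP; rewrite -subr_eq0 -/t t0.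
  by exists 0; rewrite rmorph0 horner0.
have [c c0 [h1 h2]] : has_val t.
  have [g Eg] := Vt; have := hx g; rewrite /= -Eg => /(_ t0)[c c0 [h1 h2]].
  by exists c => //; split; apply/integral_over_OE.
have bc0 : b c != 0 by rewrite fmorph_eq0.
have wc0 : 0 <= w c.
  have : Ob (b c) by rewrite -[b c](mulfVK t0) mulrC; exact: (subringM hOb).
  by move/(integral_O_closed dv); rewrite val_geE.
have wc : 1 <= w c.
  suff : w c != 0 by move: wc0; clear; lia.
  apply/negP => /eqP wc.
  have : val_ge w 0 (c ^+ N / u).
    apply: (integral_O_closed dv (b := b)).
    have z00 : z0 != 0.
      by have := expf_neq0 N t0; rewrite E0 mulf_eq0 negb_or => /andP[].
    have -> : b (c ^+ N / u) = z0 * (b c / t) ^+ N.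
      rewrite rmorphM fmorphV rmorphXn exprMn exprVn E0; field.
      by rewrite ?z00 ?U0.
    by apply: (subringM hOb) => //; exact: (subringX hOb).
  rewrite val_geE ?mulf_neq0 ?invr_eq0 ?expf_neq0 //.
  by rewrite (valM dv) ?invr_eq0 ?expf_neq0 // (valX dv) // (valV dv) // wc wu mul0rn.
pose z1 := t / b c * b (c / u).
have hz1 : Ob z1.
  apply: (subringM hOb) => //; apply: (integral_O dv).
  by rewrite -[u]expr1 -(val_ge_divX dv u0 wu) val_geE.
have tE : t = U * z1 by rewrite /z1 rmorphM fmorphV; field; rewrite ?bc0 ?U0.
have Vz1 : V z1.
  rewrite /z1 -fmorphV; apply: (subringM hV) => //.
  by apply: (subringM hV).
have hOi := O_im_subring dv b.
(* Hensel's lemma is applied in O[y, z1]: [z1 = t / U] is adjoined too, since it need not lie in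
   O[y]. *)
have [B1 [s1 [hB1 Bs1 sub1 B1y min1]]] := @adjoin_integral _ _ dv _ b _ _ y hOi
  (fun a ha => ex_intro2 _ _ a ha erefl) O_im_spanned hy.
have B1O a : val_ge w 0 a -> B1 (b a) by move=> ha; apply: sub1; exists a.
have [B2 [s2 [hB2 Bs2 sub2 B2z min2]]] := adjoin_integral dv hB1 B1O Bs1 hz1.
have B2T T : subring T -> (forall a, val_ge w 0 a -> T (b a)) -> T y -> T z1 ->
    forall x, B2 x -> T x.
  move=> hT TO Ty Tz; apply: min2 => //; apply: min1 => //.
  by move=> _ [a ha ->]; exact: TO.
have B2O : forall x, B2 x -> Ob x by apply: B2T => // a; exact: (integral_O dv).
have [e he [r hr E]] := teichmuller hB2 Bs2 B2O (fun a ha => sub2 _ (B1O a ha)) m0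
  (sub2 _ B1y) B2z tE.
exists e, r; split=> //; first exact: B2O.
by apply: (B2T V) hr.
Qed.

(** Iterating [unramified_residue] gives [N] Teichmueller digits of an integral multiple of [x], for
    every [N]. *)
Lemma unramified_approx x : max_unramified w b x -> approx x.
Proof.
move=> hx; have [M hM] := integral_scale dv u0 wu hb x; exists M => N.
have : exists s t, [/\ Wur s, Ob t, exists g, t = (map_poly b g).[x] &
    U ^+ M * x = s + U ^+ N * t].
  elim: N => [|N [s [t [hs ht Vt E]]]].
    exists 0, (U ^+ M * x); split=> //; [exact: (subring0 hW)| |by rewrite expr0; ring].
    by exists (u ^+ M *: 'X); rewrite linearZ /= hornerZ map_polyX hornerX rmorphXn.
  have [e [z [he hz Vz Ez]]] := unramified_residue hx Vt ht.
  exists (s + U ^+ N * e), z; split=> //; last by rewrite E Ez exprSr; ring.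
  apply: (subringD hW) => //; apply: (subringM hW); last exact: Wur_Fb.
  by apply: (subringX hW); exact: Wur_U.
by move=> [s [t [hs ht _ E]]]; exists s, t.
Qed.

End Unramified.

(** * Solutions modulo powers of ell force integrality *)

Lemma size_monic_exp (R : idomainType) (p : {poly R}) k :
  p \is monic -> size (p ^+ k) = ((size p).-1 * k).+1.
Proof.
by move=> mp; rewrite -size_exp prednK // size_poly_gt0 monic_neq0 // monic_exp.
Qed.

Section Backward.
Variables (Fq : finFieldType).
Local Notation q := #|Fq|.
Variables (K : fieldType) (w : K -> int) (dv : discrete_valuation w).
Variables (cw : val_complete w).
Variables (u : K) (u0 : u != 0) (wu : w u = 1).
Variables (L : closedFieldType) (b : {rmorphism K -> L}).
Hypothesis hb : algebraic_closure b.
Variable iotaK : {rmorphism Fq -> K}.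
Hypothesis hres : forall a, val_ge w 0 a ->
  exists2 G : {poly Fq}, G \is monic & val_ge w 1 (map_poly iotaK G).[a].

Local Notation U := (b u).
Local Notation Ob := (integral_in (O_im w b)).
Let hOb : subring Ob := integral_in_subring (O_im_subring dv b).
Let iotaL : {rmorphism Fq -> L} := b \o iotaK.
Let hO := val_ge_subring dv.
Let U0 : U != 0 := U_neq0 b u0.
Local Notation approx := (approx Fq w u b).

(* If h is not integral then the leading term dominates in g(h). *)
Lemma val_monic_horner (g : {poly K}) Q h a :
  approx h -> g \is monic -> size g = Q.+1 -> coefs_in (val_ge w 0) g ->
  b a = (map_poly b g).[h] ->
  val_ge w 0 a \/ exists c, w a = Q%:Z * c.
Proof.
move=> hh mg sg gO E.
have gOb i : Ob (b g`_i) by apply: (integral_O dv); exact: gO.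
have int : Ob h -> val_ge w 0 a.
  move=> Oh; apply: (integral_O_closed dv (b := b)); rewrite E.
  by apply: (coefs_in_horner hOb) => // i; rewrite coef_map; exact: gOb.
have [h0|h0] := eqVneq h 0; first by left; apply: int; rewrite h0; exact: (subring0 hOb).
have [c c0 [h1 h2]] := has_val_approx dv cw u0 wu hb hres hh h0.
have bc0 : b c != 0 by rewrite fmorph_eq0.
have [wc|wc] := leP 0 (w c).
  left; apply: int; rewrite -[h](mulfVK bc0); apply: (subringM hOb) => //.
  by apply: (integral_O dv); rewrite val_geE.
right; exists (w c).
have hcu : Ob (b (c^-1 / u)).
  apply: (integral_O dv); rewrite -[u]expr1 -(val_ge_divX dv u0 wu).
  by rewrite val_geE ?invr_eq0 // (valV dv) //; lia.
have hU : Ob U by apply: (integral_O dv); rewrite val_geE // wu.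
have hc : Ob (b c^-1).
  by apply: (integral_O dv); rewrite val_geE ?invr_eq0 // (valV dv) //; lia.
set v := h / b c in h1.
(* The terms of degree [i < Q] contribute [g_i v^i c^-(Q - i)], a multiple of [U] because [c] has
   negative valuation. *)
have [z hz Ez] : exists2 z, Ob z & b (a / c ^+ Q) = v ^+ Q + U * z.
  exists (\sum_(i < Q) b g`_i * v ^+ i * ((b c^-1) ^+ (Q - i).-1 * b (c^-1 / u))).
    apply: (subring_sum hOb) => i _; apply: (subringM hOb).
      by apply: (subringM hOb) => //; exact: (subringX hOb).
    by apply: (subringM hOb) => //; exact: (subringX hOb).
  rewrite rmorphM E fmorphV rmorphXn horner_coef size_map_poly sg big_ord_recr /=.
  have -> : (map_poly b g)`_Q = 1.
    by move: mg; rewrite monicE lead_coefE sg coef_map => /eqP /= ->; rewrite rmorph1.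
  rewrite mul1r mulrDl addrC; congr (_ + _); first by rewrite /v expr_div_n.
  rewrite mulr_suml mulr_sumr; apply: eq_bigr => i _.
  rewrite coef_map /= rmorphM !fmorphV /v expr_div_n.
  have -> : b c ^+ Q = b c ^+ i * b c ^+ (Q - i).-1 * b c.
    by rewrite -exprD -exprSr; congr (_ ^+ _); have := ltn_ord i; lia.
  by rewrite exprVn; field; rewrite ?U0 ?bc0 ?expf_neq0.
have cQ0 : c ^+ Q != 0 by rewrite expf_neq0.
have t0 : val_ge w 0 (a / c ^+ Q).
  apply: (integral_O_closed dv (b := b)); rewrite Ez.
  by apply: (subringD hOb); [exact: (subringX hOb)|exact: (subringM hOb)].
(* Otherwise [v ^+ Q] would be divisible by [U]; as [1 / v] is integral, so would be [U^-1]. *)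
have t1 : ~~ val_ge w 1 (a / c ^+ Q).
  apply/negP; rewrite (_ : 1 = 1%N%:Z) // (val_ge_divX dv u0 wu) expr1 => /(integral_O dv b).
  rewrite rmorphM fmorphV Ez => hv; apply: (@not_integral_Uinv _ _ dv _ b _ u0 wu).
  have -> : U^-1 = ((v ^+ Q + U * z) / U - z) * (b c / h) ^+ Q.
    rewrite /v expr_div_n expr_div_n; field.
    by rewrite ?U0 ?bc0 ?h0 ?expf_neq0.
  by apply: (subringM hOb); [exact: (subringB hOb)|exact: (subringX hOb)].
have a0 : a != 0 by apply: contraNneq t1 => ->; rewrite mul0r val_ge0.
move: t0 t1; rewrite !val_geE ?mulf_neq0 ?invr_eq0 //.
rewrite (valM dv) ?invr_eq0 // (valV dv) // (valX dv) // -mulr_natl natz; lia.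
Qed.

Variables (theta : K) (n : nat) (n0 : (0 < n)%N).
Hypothesis Otheta : val_ge w 0 theta.
Hypothesis pn : [pchar Fq].-nat n.
Local Notation tw := (map_poly (fun x : L => x ^+ q)).

(** Modulo a polynomial in ['X^n], exponents in different residue classes mod [n] do not mix. *)
Lemma frobenius_comp (l : {poly Fq}) :
  l ^+ n = map_poly (fun c => c ^+ n) l \Po 'X^n.
Proof.
have z0 (R : nzRingType) : (0 : R) ^+ n = 0 by rewrite expr0n gtn_eqF.
have pnP : [pchar {poly Fq}].-nat n.
  by apply: sub_in_pnat pn => p _ hp; exact: (rmorph_pchar polyC).
have -> : l ^+ n = \sum_(i < size l) (l`_i *: 'X^i) ^+ n.
  rewrite -[in LHS](coefK l) poly_def.
  apply: (big_morph (fun x : {poly Fq} => x ^+ n) (id1 := 0)); last exact: z0.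
  by move=> x y; exact: exprDn_pchar.
have sz : size (map_poly (fun c => c ^+ n) l) = size l.
  have [->|l0] := eqVneq l 0; first by rewrite map_poly0.
  by rewrite size_map_poly_id0 // expf_neq0 // lead_coef_eq0.
rewrite comp_polyE sz; apply: eq_bigr => i _.
by rewrite exprZn -!exprM mulnC coef_map_id0 ?z0.
Qed.

(** As [h] has degree less than [n], its translates by multiples of [n] do not overlap. *)
Lemma coef_mul_compXn (h m : {poly L}) i j : (i < n)%N -> (size h <= n)%N ->
  (h * (m \Po 'X^n))`_(i + n * j) = h`_i * m`_j.
Proof.
move=> hi sh; rewrite comp_polyE mulr_sumr coef_sum.
have E (t : nat) : (h * (m`_t *: 'X^n ^+ t))`_(i + n * j) =
    if t == j then h`_i * m`_j else 0.
  rewrite -scalerAr coefZ -exprM coefMXn; case: eqP => [->|tj].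
    by rewrite ltnNge leq_addl /= addnK mulrC.
  case: ltnP => ht; first by rewrite mulr0.
  rewrite [h`_(_ - _)]nth_default ?mulr0 //; apply: (leq_trans sh).
  have lt : (t < j)%N by move: ht tj hi; clear; nia.
  by move: lt; clear -n0; nia.
under eq_bigr do rewrite E.
have [hj|hj] := ltnP j (size m); last first.
  rewrite [m`_j]nth_default // mulr0 big1 // => t _; by case: eqP.
by rewrite (bigD1 (Ordinal hj)) //= eqxx big1 ?addr0 // => t; rewrite -val_eqE => /negPf /= ->.
Qed.

Lemma backward_bound (y : {poly K}) (l : {poly Fq}) : (size y <= n)%N ->
  l \is monic -> (1 < size l)%N ->
  (forall i, exists2 xi : {poly L}, coefs_in approx xi &
    map_poly iotaL l ^+ i %| ('X - (b theta)%:P) ^+ n * xi - tw xi - map_poly b y) ->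
  coefs_in (val_ge w 0) y.
Proof.
move=> sy ml sl H i.
have [hin|hin] := ltnP i n; last by rewrite nth_default ?val_ge0 // (leq_trans sy).
apply/negPn/negP => hyi.
(* Take [r] to be the absolute value of [w y_i]: a nonzero multiple of [q ^ e] with [e >= r] exceeds
   [r], because [e < q ^ e]. *)
suff G r : exists2 e, (r <= e)%N & exists c, w y`_i = (q ^ e)%N%:Z * c.
  have [e he [c Ec]] := G `|w y`_i|%N.
  have wy : w y`_i < 0.
    by rewrite ltNge; apply: contraNN hyi; rewrite /val_ge => ->; rewrite orbT.
  have : (e < q ^ e)%N by apply: ltn_expl; exact: card_gt1.
  move: he wy; rewrite Ec abszM absz_nat; move: (q ^ e)%N => Q; clear => he wy lt.
  have c0 : (0 < `|c|)%N by rewrite absz_gt0; apply/negP => /eqP c0; move: wy; rewrite c0 mulr0.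
  by move: (`|c|)%N c0 he lt; clear => k; nia.
have [e [he e0 [mu [mmu smu Emu]]]] : exists e, [/\ (r <= e)%N, (0 < e)%N & exists mu : {poly Fq},
    [/\ mu \is monic, size mu = e.+1 & l ^+ (n * r.+1) = mu \Po 'X^n]].
  pose l' := map_poly (fun c : Fq => c ^+ n) l.
  have l'0 : lead_coef l ^+ n != 0 by rewrite (monicP ml) expr1n oner_neq0.
  have sl' : size l' = size l by rewrite size_map_poly_id0.
  have ml' : l' \is monic.
    by rewrite monicE lead_coef_map_id0 // ?(monicP ml) ?expr1n // expr0n gtn_eqF.
  (* Using [r.+1] instead of [r] ensures [0 < e], so that [c e.-1] below is the top coefficient. *)
  exists ((size l).-1 * r.+1)%N; split; [by move: sl; clear; nia|by move: sl; clear; nia|].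
  exists (l' ^+ r.+1); split; first exact: monic_exp.
    by rewrite size_monic_exp // sl'.
  by rewrite exprM frobenius_comp -/l' rmorphXn.
exists e => //.
have q0L : 0 ^+ q = 0 :> L by have := frob0 Fq L 1; rewrite expn1.
have [xi hxi dxi] := H (n * r.+1)%N.
pose muL := map_poly iotaL mu.
have mmuL : muL \is monic by rewrite monic_map.
have smuL : size muL = e.+1 by rewrite size_map_poly.
pose La := muL \Po 'X^n.
have LaE : map_poly iotaL l ^+ (n * r.+1) = La.
  by rewrite -rmorphXn /= Emu map_comp_poly map_polyXn.
have mLa : La \is monic.
  rewrite -LaE; apply: monic_exp; by rewrite monic_map.
have sLa : size La = (n * e).+1.
  have := size_comp_poly muL 'X^n; rewrite smuL size_polyXn /= mulnC => E.
  by rewrite -E prednK // size_poly_gt0 monic_neq0.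
have a0 : approx 0 by exact: (approx0 Fq dv u0 wu b).
have aD x y' : approx x -> approx y' -> approx (x + y').
  exact: (approxD dv u0 wu).
have aB x y' : approx x -> approx y' -> approx (x - y').
  exact: (approxB dv u0 wu).
have aM x c : approx x -> (exists a, c = b a) -> approx (x * c).
  by move=> hx [a ->]; exact: (approxM dv u0 wu a hx).
have cLa j : exists a, La`_j = b a.
  by rewrite -LaE -rmorphXn coef_map; eexists.
have [Q [R [EQ QV RV sR]]] := monic_division a0 aD aB aM hxi mLa cLa.
have twLa : tw La = La by rewrite -LaE -rmorphXn (frob_poly_iota iotaL).
have XE : ('X - (b theta)%:P) ^+ n = 'X^n - (b theta ^+ n)%:P :> {poly L}.
  have pnP : [pchar {poly L}].-nat n.
    by apply: sub_in_pnat pn => p _ hp; exact: (rmorph_pchar (polyC \o iotaL)).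
  rewrite exprDn_pchar // polyC_exp; congr (_ + _).
  by apply/eqP; rewrite -addr_eq0 -exprDn_pchar // addNr expr0n gtn_eqF.
(* The defect of the remainder [R]. Twisting fixes [La], so the congruence survives the passage from
   [xi] to [R]; twisting changes coefficients only, so [T] has degree less than [n + n e] and its
   quotient [h] by [La] has degree less than [n]. *)
pose T := 'X^n * R - (b theta ^+ n)%:P * R - tw R - map_poly b y.
have dT : La %| T.
  have -> : T = ('X - (b theta)%:P) ^+ n * xi - tw xi - map_poly b y
      - (('X^n - (b theta ^+ n)%:P) * Q - tw Q) * La.
    by rewrite XE EQ (frob_polyD iotaL) (frob_polyM iotaL) twLa /T; ring.
  by rewrite dvdp_subr ?dvdp_mulIr // -LaE.
have /dvdpP[h Eh] := dT.
have sT : (size T <= n + n * e)%N.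
  apply/leq_sizeP => j hj; rewrite !coefB coefXnM coefCM coef_frob coef_map.
  rewrite sLa ltnS in sR.
  have Rj k : (n * e <= k)%N -> R`_k = 0.
    by move=> hk; rewrite nth_default // (leq_trans sR).
  rewrite [y`_j]nth_default; last by apply: (leq_trans sy); move: hj; clear; lia.
  rewrite ltnNge (leq_trans (leq_addr _ _) hj) /= Rj; last by move: hj; clear; lia.
  rewrite Rj; last by move: hj; clear; lia.
  by rewrite mulr0 q0L rmorph0 !subr0.
have sh : (size h <= n)%N.
  have [->|h0] := eqVneq h 0; first by rewrite size_poly0.
  have : (size h + n * e <= n + n * e)%N.
    move: sT; rewrite Eh size_Mmonic // sLa addnS /=; exact.
  by rewrite leq_add2r.
pose c j := R`_(i + n * j).
have Rhi j : (e <= j)%N -> c j = 0.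
  move=> hj; rewrite /c nth_default //; rewrite sLa ltnS in sR.
  by apply: (leq_trans sR); move: hj; clear; nia.
have yhi j : (0 < j)%N -> y`_(i + n * j) = 0.
  by move=> hj; rewrite nth_default // (leq_trans sy) //; move: hj; clear; nia.
(* Compare coefficients of degree [i + n j]: both [(t - theta)^n] and [La] are polynomials in
   ['X^n], so only this residue class occurs. *)
have rel j : (if j is j'.+1 then c j' else 0) - b theta ^+ n * c j - c j ^+ q
    - b y`_(i + n * j) = h`_i * muL`_j.
  rewrite -(coef_mul_compXn muL j hin sh) -/La -Eh !coefB coefXnM coefCM coef_frob coef_map -/(c j).
  case: j => [|j]; first by rewrite muln0 addn0 hin.
  by rewrite mulnS addnCA ltnNge leq_addr /= addKn.
(* The relation for [j = e]: [c e] vanishes and [mu] is monic. *)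
have relE : c e.-1 = h`_i.
  have := rel e; case: (e) e0 smuL Rhi => // e' _ smu' Rhi'.
  rewrite (Rhi' _ (leqnn _)) (yhi e'.+1) // rmorph0 mulr0 q0L !subr0 => ->.
  by move: mmuL; rewrite monicE lead_coefE smu' => /eqP ->; rewrite mulr1.
have ha : approx h`_i by rewrite -relE; exact: RV.
(* Read downwards from [j = e - 1], the relations give each [c (j - 1)] from [c j] and [h_i]. Thus
   [a s], the coefficient reached after [s] steps, is the value of [g s] at [h_i]; the q-th power
   dominates, so [g s] is monic of degree [q ^ s]. The relation for [j = 0] ends the chain with
   [- y_i]. *)
pose g := fix g s : {poly K} := if s is s'.+1 then
   (theta ^+ n)%:P * g s' + g s' ^+ q + (iotaK mu`_(e - s))%:P * 'X else 'X.
pose a s := if (s < e)%N then c (e - s.+1)%N else - b y`_i.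
have gO s : coefs_in (val_ge w 0) (g s).
  elim: s => [|s IH]; first exact: (coefs_in_X hO).
  apply: (coefs_inD hO); [apply: (coefs_inD hO)|].
  - by apply: (coefs_inM hO) => //; apply: (coefs_inC hO); exact: (subringX hO).
  - exact: (coefs_inX hO).
  - apply: (coefs_inM hO); last exact: (coefs_in_X hO).
    by apply: (coefs_inC hO); exact: (val_ge_iota dv u0 wu).
have gm s : g s \is monic /\ size (g s) = (q ^ s).+1.
  elim: s => [|s [m1 s1]]; first by rewrite monicX size_polyX.
  have sq : size (g s ^+ q) = (q ^ s.+1).+1.
    by rewrite size_monic_exp // s1 expnSr.
  pose lo := (theta ^+ n)%:P * g s + (iotaK mu`_(e - s.+1))%:P * 'X.
  have slo : (size lo <= (q ^ s).+1)%N.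
    apply: (leq_trans (size_polyD _ _)); rewrite geq_max !mul_polyC.
    rewrite (leq_trans (size_scale_leq _ _)) ?s1 //=.
    rewrite (leq_trans (size_scale_leq _ _)) // size_polyX ltnS.
    by rewrite expn_gt0 card_gt0.
  have lt : (size lo < size (g s ^+ q))%N.
    rewrite sq; apply: (leq_ltn_trans slo); rewrite ltnS ltn_exp2l //; exact: card_gt1.
  have E : g s.+1 = g s ^+ q + lo by rewrite /= /lo; ring.
  rewrite E; split; last by rewrite size_polyDl.
  by rewrite monicE lead_coefDl // -monicE monic_exp.
have gE s : (map_poly b (g s.+1)).[h`_i] = b theta ^+ n * (map_poly b (g s)).[h`_i] +
    (map_poly b (g s)).[h`_i] ^+ q + b (iotaK mu`_(e - s.+1)) * h`_i.
  rewrite /= !(rmorphD (map_poly b)) !(rmorphM (map_poly b)) (rmorphXn (map_poly b)) /=.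
  by rewrite !map_polyC map_polyX /= !hornerD !hornerM !hornerC hornerX horner_exp rmorphXn.
have aE s : (s <= e)%N -> a s = (map_poly b (g s)).[h`_i].
  elim: s => [|s IH] hs.
    by rewrite /= map_polyX hornerX /a e0 subn1.
  rewrite gE -IH ?(ltnW hs) // /a hs.
  have := rel (e - s.+1)%N; rewrite coef_map /= => E.
  have -> : b (iotaK mu`_(e - s.+1)) * h`_i = h`_i * b (iotaK mu`_(e - s.+1)).
    by rewrite mulrC.
  rewrite -E.
  case: ltnP => hs'.
    have -> : (e - s.+1 = (e - s.+2).+1)%N by move: hs'; clear; lia.
    by rewrite yhi // rmorph0 subr0; ring.
  have -> : (e - s.+1 = 0)%N by apply/eqP; rewrite subn_eq0.
  by rewrite muln0 addn0; ring.
have := aE e (leqnn _); rewrite /a ltnn -rmorphN => E.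
have [mg sg] := gm e.
case: (val_monic_horner ha mg sg (gO e) E) => [|[c' Ec']].
  by rewrite (val_geN dv) (negPf hyi).
by exists c'; rewrite -(valN dv).
Qed.
End Backward.

(** * Solutions modulo powers of ell from integrality *)

Section Forward.
Variables (Fq : finFieldType).
Local Notation q := #|Fq|.
Variables (K : fieldType) (w : K -> int) (dv : discrete_valuation w).
Variables (cw : val_complete w).
Variables (u : K) (u0 : u != 0) (wu : w u = 1).
Variables (L : closedFieldType) (b : {rmorphism K -> L}).
Hypothesis hb : algebraic_closure b.
Variable iotaK : {rmorphism Fq -> K}.
Hypothesis hres : forall a, val_ge w 0 a ->
  exists2 G : {poly Fq}, G \is monic & val_ge w 1 (map_poly iotaK G).[a].

Local Notation U := (b u).
Local Notation Ob := (integral_in (O_im w b)).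
Let iotaL : {rmorphism Fq -> L} := b \o iotaK.
Local Notation W := (Wur Fq w b).
Local Notation Fb := (@frob_periodic Fq L).
Let hW : subring W := Wur_subring Fq dv b.
Let hFb : subring Fb := frob_periodic_subring iotaL.
Let hOb : subring Ob := integral_in_subring (O_im_subring dv b).
Local Notation tw := (map_poly (fun x : L => x ^+ q)).

(* A polynomial over W with derivative -1 has a root in W: a root of a lift of its
   reduction lies in the algebraic closure of Fq, and Hensel's lemma applies. *)
Lemma Wur_root (f : {poly L}) : coefs_in W f -> f^`() = -1 ->
  exists2 e, W e & root f e.
Proof.
move=> hf df.
have ex i : exists p : L * L, [/\ Fb p.1, W p.2 & f`_i = p.1 + U * p.2].
  have [e he [r hr E]] := Wur_residue dv cw u0 wu hb hres (hf i).
  by exists (e, r).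
have [er her] := choice ex.
pose f0 := \poly_(i < size f) (er i).1.
have f1 : f`_1 = -1.
  have := congr1 (fun p : {poly L} => p`_0) df.
  by rewrite coef_deriv mulr1n => ->; rewrite coefN coef1.
have sf : (1 < size f)%N.
  rewrite ltnNge; apply/negP => sf; move/eqP: f1; rewrite nth_default // eq_sym.
  by rewrite oppr_eq0 oner_eq0.
(* The lift of -1 has the form [-(1 + U z)], which is nonzero; hence [f0] is not constant and has a
   root. *)
have c1 : f0`_1 != 0.
  rewrite coef_poly sf; have [_ h1 E1] := her 1%N.
  have -> : (er 1%N).1 = - (1 + U * (er 1%N).2) by rewrite f1 in E1; rewrite opprD E1; ring.
  by rewrite oppr_eq0; case: (integral_1DU dv u0 wu (Wur_integral dv h1)).
have sf0 : (1 < size f0)%N by rewrite ltnNge; apply: contraNN c1 => h; rewrite nth_default.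
have [e0 re0] : exists x, root f0 x.
  by apply/closed_rootP; rewrite gtn_eqF.
have he0 : Fb e0.
  apply: (frob_periodic_trans iotaL _ _ re0); first by rewrite -size_poly_gt0 ltnW.
  move=> i; rewrite coef_poly; case: ifP => _; last exact: (subring0 hFb).
  by have [] := her i.
pose t := \sum_(i < size f) (er i).2 * e0 ^+ i.
have ht : W t.
  apply: (subring_sum hW) => i _; apply: (subringM hW); first by have [] := her i.
  by apply: (subringX hW); exact: (Wur_Fb dv b).
have fe : f.[e0] = U * t.
  move/rootP: re0; rewrite (horner_coef_wide _ (size_poly _ _)) => E0.
  rewrite horner_coef /t mulr_sumr -[RHS]add0r -[X in X + _]E0 -big_split /=.
  apply: eq_bigr => i _; rewrite coef_poly ltn_ord; have [_ _ ->] := her i; ring.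
have [|m m0 hm] := @Wur_common Fq K w dv L b (e0 :: t :: f).
  move=> x; rewrite !inE => /or3P[/eqP ->|/eqP -> //|/(nthP 0)[i _ <-] //].
  exact: (Wur_Fb dv b).
have hWm := Wm_subring Fq dv b m0.
have fm : coefs_in (Wm Fq w b m) f.
  move=> i; have [hi|hi] := ltnP i (size f); last by rewrite nth_default //; exact: (subring0 hWm).
  by apply: hm; rewrite !inE mem_nth ?orbT.
have [||e re [r hr Er]] := hensel dv cw u0 wu hb hWm (s := Fm Fq L m)
  (fun x => conj id id) (fun x => Wm_integral dv m0 (x := x)) (fun a => Wm_O Fq dv b m0 (a := a))
  fm df _ _ fe.
- by apply: hm; rewrite inE eqxx.
- by apply: hm; rewrite !inE eqxx orbT.
exists e => //; exists m => //; rewrite Er; apply: (subringD hWm).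
  by apply: hm; rewrite inE eqxx.
by apply: (subringM hWm) => //; apply: Wm_O => //; rewrite val_geE // wu.
Qed.

Variables (theta : K) (n : nat) (l : {poly Fq}).
Hypothesis Otheta : val_ge w 0 theta.
Hypothesis irl : irreducible_poly l.
Hypothesis ml : l \is monic.
Hypothesis l0 : (map_poly iotaK l).[theta] != 0.
Hypothesis wl : w (map_poly iotaK l).[theta] = 0.
Local Notation La := (map_poly iotaL l).
Local Notation TL := (b theta).

Let WLa : coefs_in W La.
Proof. by move=> i; rewrite coef_map; apply: (Wur_O Fq dv b); exact: (val_ge_iota dv u0 wu). Qed.

Let mLa : La \is monic. Proof. by rewrite monic_map. Qed.

(** [z - theta] divides the difference of the values of [l] at [z] and [theta]. The first value is 0
    and the second a unit. *)
Lemma root_sub_unit z : Fb z -> root La z -> z - TL != 0 /\ W (z - TL)^-1.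
Proof.
move=> hz rz.
have WT : W TL by exact: (Wur_O Fq dv b).
have cX : coefs_in W ('X - TL%:P).
  by apply: (coefs_inB hW); [exact: (coefs_in_X hW)|exact: (coefs_inC hW)].
have [Q [R [E QW _ sR]]] := monic_division (subring0 hW)
  (fun x y => subringD hW (x:=x) (y:=y)) (subringB hW) (subringM hW) WLa (monicXsubC TL) cX.
move: sR; rewrite size_XsubC ltnS => /size1_polyC ER.
have R0 : R`_0 = b (map_poly iotaK l).[theta].
  have := congr1 (fun p => p.[TL]) E; rewrite /= ER !hornerE subrr mulr0 add0r => <-.
  by rewrite coefC eqxx map_poly_comp horner_map.
have E1 : (z - TL) * - (Q.[z] * b (map_poly iotaK l).[theta]^-1) = 1.
  have := congr1 (fun p => p.[z]) E; rewrite /= (rootP rz) ER R0 !hornerE => /eqP.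
  rewrite eq_sym addr_eq0 => /eqP E2.
  rewrite mulrN mulrA [(z - _) * _]mulrC E2 mulNr opprK fmorphV divff //.
  by rewrite fmorph_eq0.
have nz : z - TL != 0.
  by apply: contraTneq isT => z0; move/eqP: E1; rewrite z0 mul0r eq_sym oner_eq0.
split=> //; have -> : (z - TL)^-1 = - (Q.[z] * b (map_poly iotaK l).[theta]^-1).
  by apply: (mulfI nz); rewrite E1 mulfV.
apply: (subringN hW); apply: (subringM hW).
  by apply: (coefs_in_horner hW) => //; exact: (Wur_Fb dv b).
apply: (Wur_O Fq dv b); by rewrite val_geE ?invr_eq0 // (valV dv) // wl.
Qed.

Lemma solve_mod (c : {poly L}) : coefs_in W c -> exists2 eta : {poly L},
  coefs_in W eta & La %| ('X - TL%:P) ^+ n * eta - tw eta - c.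
Proof.
move=> hc; have [z [d [d0 hzd inj rz dvd]]] := irreducible_frob_roots iotaL irl.
pose Z s := z ^+ (q ^ s).
have ZS s : Z s.+1 = Z s ^+ q by rewrite /Z expnSr exprM.
have Zd : Z d = Z 0%N by rewrite /Z hzd expr1.
have FZ s : Fb (Z s).
  by apply: (subringX hFb); exists d.
have WZ s : W (Z s) by exact: (Wur_Fb dv b).
have nz s : Z s - TL != 0 by case: (root_sub_unit (FZ s) (rz s)).
pose si s := (Z s - TL)^-1 ^+ n.
have Wsi s : W (si s).
  by apply: (subringX hW); case: (root_sub_unit (FZ s) (rz s)).
have Wcs s : W c.[Z s] by exact: (coefs_in_horner hW).
(* [E s] is the value required at [Z s], as a polynomial in the unknown value at [Z 0]. The cycle
   closes at a root of [E d - 'X], whose derivative is -1 because the unknown enters [E d] through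
   q-th powers only. *)
pose E := fix E s : {poly L} :=
  if s is s'.+1 then (si s)%:P * (E s' ^+ q + c.[Z s]%:P) else 'X.
have WE s : coefs_in W (E s).
  elim: s => [|s IH]; first exact: (coefs_in_X hW).
  apply: (coefs_inM hW); first exact: (coefs_inC hW).
  by apply: (coefs_inD hW); [exact: (coefs_inX hW)|exact: (coefs_inC hW)].
have dE s : (0 < s)%N -> (E s)^`() = 0.
  case: s => // s _; rewrite /= derivM derivC mul0r add0r derivD derivC addr0.
  by rewrite deriv_exp -mulr_natr (_ : q%:R = 0) ?mulr0 // -polyC_natr (natr_card iotaL).
have [e We re] : exists2 e, W e & root (E d - 'X) e.
  apply: Wur_root; first by apply: (coefs_inB hW) => //; exact: (coefs_in_X hW).
  by rewrite derivB dE // derivX sub0r.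
pose es s := (E s).[e].
have esS s : es s.+1 = si s.+1 * (es s ^+ q + c.[Z s.+1]).
  by rewrite /es /= hornerM hornerC hornerD horner_exp hornerC.
have esd : es d = es 0%N.
  by rewrite /es [E 0%N]/= hornerX; apply/eqP; move: re; rewrite rootE hornerD hornerN hornerX subr_eq0.
have Wes s : W (es s) by exact: (coefs_in_horner hW).
(* Lagrange interpolation stays over [W]: the differences of the nodes are nonzero and algebraic
   over [Fq], so their inverses are in [W]. *)
pose lag (s : 'I_d) := \prod_(t < d | t != s) (((Z s - Z t)^-1)%:P * ('X - (Z t)%:P)).
pose eta := \sum_(s < d) (es s)%:P * lag s.
have Weta : coefs_in W eta.
  apply/(coefs_inP hW); apply: rpred_sum => s _; apply/(coefs_inP hW).
  apply: (coefs_inM hW); first exact: (coefs_inC hW).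
  apply/(coefs_inP hW); apply: rpred_prod => t _; apply/(coefs_inP hW).
  apply: (coefs_inM hW).
    apply: (coefs_inC hW); apply: (Wur_Fb dv b); apply: frob_periodicV.
    exact: (subringB hFb).
  by apply: (coefs_inB hW); [exact: (coefs_in_X hW)|exact: (coefs_inC hW)].
have etaZ (s : nat) : (s < d)%N -> eta.[Z s] = es s.
  move=> hs; rewrite horner_sum (bigD1 (Ordinal hs)) //= big1 ?addr0.
    rewrite hornerM hornerC horner_prod big1 ?mulr1 // => t ts.
    rewrite !hornerE mulVf // subr_eq0; apply: contraNN ts => /eqP h.
    by apply/eqP/val_inj; exact: (inj _ _ (ltn_ord t) hs (esym h)).
  move=> t ts; rewrite hornerM horner_prod (bigD1 (Ordinal hs)) 1?eq_sym //=.
  by rewrite hornerM hornerXsubC subrr mulr0 mul0r mulr0.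
have etaZS (s : nat) : (s < d)%N -> eta.[Z s.+1] = es s.+1.
  move=> hs; have [lt|ge] := ltnP s.+1 d; first exact: etaZ.
  have -> : s.+1 = d by apply/eqP; rewrite eqn_leq hs ge.
  by rewrite Zd esd; exact: etaZ.
exists eta => //; apply: dvd => s hs.
(* The twist at [Z s'.+1] is the q-th power of the value at [Z s'], so the nodes are indexed one
   step ahead around the cycle. *)
have [s' hs' ->] : exists2 s', (s' < d)%N & z ^+ (q ^ s) = Z s'.+1.
  case: s hs => [|s] hs; last by exists s => //; exact: ltnW.
  by exists d.-1; rewrite prednK // Zd.
have twE : (tw eta).[Z s'.+1] = es s' ^+ q by rewrite ZS (horner_frob iotaL) etaZ.
apply/rootP; rewrite !hornerD !hornerN hornerM horner_exp twE hornerXsubC etaZS // esS.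
have nzn : (Z s'.+1 - TL) ^+ n != 0 by rewrite expf_neq0.
by rewrite /si exprVn mulrA divff // mul1r; ring.
Qed.

Lemma forward_solution (y : {poly K}) : coefs_in (val_ge w 0) y ->
  exists xi : nat -> {poly L}, forall i, [/\ coefs_in W (xi i),
    La ^+ i %| xi i.+1 - xi i &
    La ^+ i %| ('X - TL%:P) ^+ n * xi i - tw (xi i) - map_poly b y].
Proof.
move=> yO; pose T (f : {poly L}) := ('X - TL%:P) ^+ n * f - tw f - map_poly b y.
have WT : W TL by exact: (Wur_O Fq dv b).
have TW f : coefs_in W f -> coefs_in W (T f).
  move=> hf; apply: (coefs_inB hW); last by move=> i; rewrite coef_map; apply: (Wur_O Fq dv b).
  apply: (coefs_inB hW); last by move=> i; rewrite (coef_frob Fq); exact: (subringX hW).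
  apply: (coefs_inM hW) => //; apply: (coefs_inX hW).
  by apply: (coefs_inB hW); [exact: (coefs_in_X hW)|exact: (coefs_inC hW)].
pose P i f := coefs_in W f /\ La ^+ i %| T f.
have step (p : nat * {poly L}) : exists f', P p.1 p.2 -> P p.1.+1 f' /\ La ^+ p.1 %| f' - p.2.
  case: p => i f /=; have [[hf dT]|nP] := pselect (P i f); last by exists 0.
  have mLi : La ^+ i \is monic by exact: monic_exp.
  have [Q [R [E QW _ sR]]] := monic_division (subring0 hW)
    (fun x y => subringD hW (x:=x) (y:=y)) (subringB hW) (subringM hW) (TW _ hf) mLi
    (coefs_inX hW i WLa).
  have R0 : R = 0.
    have : La ^+ i %| R by move: dT; rewrite E dvdp_addr // dvdp_mulIr.
    by apply: contraTeq => R0; apply/negP => /(dvdp_leq R0); rewrite leqNgt sR.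
  have [|eta hE dE] := @solve_mod (- Q).
    by move=> j; rewrite coefN; exact: (subringN hW).
  exists (f + La ^+ i * eta) => _; split; last by rewrite addrAC subrr add0r dvdp_mulIl.
  split; first by apply: (coefs_inD hW) => //; apply: (coefs_inM hW) => //; exact: (coefs_inX hW).
  (* [La ^+ i] is fixed by the twist and factors out of the correction; the error
     [T f = La ^+ i * Q] is thus cancelled modulo [La ^+ i.+1] by solving modulo [La] with
     right-hand side [- Q]. *)
  have -> : T (f + La ^+ i * eta) = La ^+ i * (('X - TL%:P) ^+ n * eta - tw eta - - Q).
    have twL : tw (La ^+ i) = La ^+ i by rewrite -rmorphXn (frob_poly_iota iotaL).
    rewrite /T (frob_polyD iotaL) (frob_polyM iotaL) twL.
    have -> : ('X - TL%:P) ^+ n * (f + La ^+ i * eta) - (tw f + La ^+ i * tw eta) - map_poly b y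
       = T f + La ^+ i * (('X - TL%:P) ^+ n * eta - tw eta) by rewrite /T; ring.
    by rewrite E R0; ring.
  by rewrite exprSr dvdp_mul2l // monic_neq0.
have [nx hnx] := choice step.
pose xi := fix xi i : {poly L} := if i is i'.+1 then nx (i', xi i') else 0.
have Pxi i : P i (xi i).
  elim: i => [|i IH]; last by have [] := hnx (i, xi i) IH.
  split; last by rewrite expr0 dvd1p.
  by move=> j; rewrite coef0; exact: (subring0 hW).
exists xi => i; have [h1 h2] := Pxi i; split=> //.
by have [] := hnx (i, xi i) (Pxi i).
Qed.

End Forward.

(** * The residue field of a finite place *)

Lemma fraction_rep (R : idomainType) (x : {fraction R}) :
  exists a c, c != 0 /\ x = tofrac a / tofrac c.
Proof.
elim/quotW: x => r; exists (\n_r), (\d_r); split; first exact: denom_ratioP.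
have d0 : tofrac (\d_r) != 0 by rewrite tofrac_eq0 denom_ratioP.
apply: (mulIf d0); rewrite divfK //.
change (FracField.mul (\pi_(FracField.type R)%qT r) (tofrac (\d_r)) = tofrac (\n_r)).
apply/eqP; rewrite !piE FracField.equivfE /FracField.mulf !numden_Ratio ?mulf_neq0 ?oner_eq0 ?denom_ratioP //.
by rewrite !mulr1 mulrC.
Qed.

Section ConstMod.
Variables (Fq : finFieldType) (F : fieldType) (v : F -> int).
Hypothesis dv : discrete_valuation v.
Variable iota : {rmorphism Fq -> F}.
Hypothesis iotaO : forall c, val_ge v 0 (iota c).

(** The elements whose residue lies in [Fq]. It contains the whole maximal ideal, which is what
    allows terms of positive valuation to be hidden in constant coefficients below. *)
Definition val_const (y : F) : Prop := exists c, exists2 z, val_ge v 1 z & y = iota c + z.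

Lemma val_const_subring : subring val_const.
Proof.
split=> [|x y [c [z hz ->]] [d [t ht ->]]|x y [c [z hz ->]] [d [t ht ->]]].
- by exists 1, 0; [exact: val_ge0|rewrite rmorph1 addr0].
- exists (c - d), (z - t); first exact: (val_geB dv).
  by rewrite rmorphB; ring.
- exists (c * d), (iota c * t + z * iota d + z * t); last by rewrite rmorphM; ring.
  apply: (val_geD dv); [apply: (val_geD dv)|].
  + by rewrite mulrC; exact: (val_geMr dv).
  + exact: (val_geMr dv).
  + by apply: (val_geMr dv) => //; apply: val_ge_le ht.
Qed.

Lemma val_const_id z : val_ge v 1 z -> val_const z.
Proof. by move=> hz; exists 0, z => //; rewrite rmorph0 add0r. Qed.

Lemma val_const_iota c : val_const (iota c).
Proof. by exists c, 0; [exact: val_ge0|rewrite addr0]. Qed.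

Lemma integral_val_const x : val_ge v 0 x -> integral_in val_const x ->
  exists2 G : {poly Fq}, G \is monic & val_ge v 1 (map_poly iota G).[x].
Proof.
move=> hx [g [mg gC] rg].
have ex i : exists p : Fq * F, val_ge v 1 p.2 /\ g`_i = iota p.1 + p.2.
  by have [c [z hz E]] := gC i; exists (c, z).
have [cz hcz] := choice ex.
have sg : (0 < size g)%N by rewrite size_poly_gt0 monic_neq0.
pose d := (size g).-1; pose G : {poly Fq} := 'X^d + \poly_(i < d) (cz i).1.
have sP : (size (\poly_(i < d) (cz i).1) <= d)%N by exact: size_poly.
exists G.
  by rewrite monicE lead_coefDl ?lead_coefXn // size_polyXn.
have -> : (map_poly iota G).[x] = - \sum_(i < d) (cz i).2 * x ^+ i.
  rewrite rmorphD /= map_polyXn hornerD hornerXn.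
  have -> : (map_poly iota (\poly_(i < d) (cz i).1)).[x] = \sum_(i < d) iota (cz i).1 * x ^+ i.
    rewrite (horner_coef_wide _ (_ : _ <= d)%N); last by rewrite size_map_poly.
    by apply: eq_bigr => i _; rewrite coef_map coef_poly ltn_ord.
  move: (rootP rg); rewrite horner_coef -(prednK sg) big_ord_recr /= -/d.
  have -> : g`_d = 1 by move: mg; rewrite monicE lead_coefE => /eqP.
  rewrite mul1r => /eqP; rewrite addrC addr_eq0 => /eqP ->.
  rewrite addrC -sumrB -sumrN; apply: eq_bigr => i _.
  by have [_ ->] := hcz i; ring.
rewrite (val_geN dv); apply: (val_ge_sum dv) => i _.
apply: (val_geMr dv); first by have [] := hcz i.
exact: (subringX (val_ge_subring dv)).
Qed.

End ConstMod.

Section FinitePlace.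
Variables (Fq : finFieldType) (F : fieldExtType {fraction {poly Fq}}).
Variables (v : F -> int) (hv : finite_place v).
Let dv : discrete_valuation v := hv.1.
Local Notation kap := (kappaF F).
Let iota : {rmorphism Fq -> F} := kap \o polyC.
Let iotaO c : val_ge v 0 (iota c). Proof. exact: hv.2. Qed.
Local Notation C := (val_const v iota).
Let hC : subring C := val_const_subring dv iotaO.
Local Notation I := (integral_in C).
Let hI : subring I := integral_in_subring hC.

Lemma kappaF_eq0 a : (kap a == 0) = (a == 0).
Proof. by rewrite -[kap a]/(in_alg F (tofrac a)) fmorph_eq0 tofrac_eq0. Qed.

Lemma in_alg_rep (r : F) : (exists k, r = k%:A) ->
  exists a c, [/\ c != 0, coprimep a c & r = kap a / kap c].
Proof.
case=> k ->; have [a [c [c0 ->]]] := fraction_rep k.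
have g0 : gcdp a c != 0 by rewrite gcdp_eq0 negb_and c0 orbT.
exists (a %/ gcdp a c), (c %/ gcdp a c); split.
- by rewrite dvdp_div_eq0 ?dvdp_gcdr.
- by rewrite coprimep_div_gcd // c0 orbT.
have Ea : kap a = kap (a %/ gcdp a c) * kap (gcdp a c) by rewrite -rmorphM divpK ?dvdp_gcdl.
have Ec : kap c = kap (c %/ gcdp a c) * kap (gcdp a c) by rewrite -rmorphM divpK ?dvdp_gcdr.
have -> : (tofrac a / tofrac c)%:A = kap a / kap c :> F.
  by rewrite -in_algE rmorphM fmorphV.
by rewrite Ea Ec -mulf_div divff ?mulr1 // kappaF_eq0.
Qed.

Let coprime_one (a c : {poly Fq}) : coprimep a c -> exists s t, s * a + t * c = 1.
Proof. by move/Bezout_eq1_coprimepP => [[s t] /= E]; exists s, t. Qed.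

Let minp (x : F) i : exists k, (minPoly 1%AS x)`_i = k%:A.
Proof. by have /polyOverP/(_ i)/vlineP[k] := minPolyOver 1%AS x; exists k. Qed.

Let val_ge_kap a : val_ge v 0 (kap a). Proof. exact: hv.2. Qed.

(** Otherwise [v] is trivial on Fq(t). The nonzero terms of the minimal polynomial over Fq(t),
    evaluated at a uniformizer, would then have distinct valuations, namely their degrees, and could
    not cancel. *)
Lemma place_ideal_neq0 : exists2 m, m != 0 & val_ge v 1 (kap m).
Proof.
apply: contrapT => H.
have w0 a : a != 0 -> v (kap a) = 0.
  move=> a0; have ka0 : kap a != 0 by rewrite kappaF_eq0.
  have h0 := val_ge_kap a; rewrite val_geE // in h0.
  apply/eqP; rewrite eq_le h0 andbT -ltzD1 add0r ltNge; apply/negP => h1.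
  by apply: H; exists a => //; rewrite val_geE.
have wr r : (exists k, r = k%:A) -> r != 0 -> v r = 0.
  move=> /in_alg_rep[a [c [c0 _ ->]]]; rewrite mulf_eq0 invr_eq0 !kappaF_eq0 negb_or.
  move=> /andP[a0 _]; rewrite (valM dv) ?invr_eq0 ?kappaF_eq0 // (valV dv) ?kappaF_eq0 //.
  by rewrite !w0.
have [x x0 vx] := dv_norm dv.
pose P := minPoly 1%AS x; have mP : P \is monic := monic_minPoly _ _.
have exi : exists i, P`_i != 0.
  by exists (size P).-1; rewrite -lead_coefE lead_coef_eq0 monic_neq0.
case: (ex_minnP exi) => i Pi imin.
have : P.[x] = 0 by apply/rootP; exact: root_minPoly.
have si : (i < size P)%N by rewrite ltnNge; apply: contraNN Pi => h; rewrite nth_default.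
rewrite horner_coef (bigD1 (Ordinal si)) //= => /eqP; rewrite addr_eq0 => /eqP E.
have Pix : P`_i * x ^+ i != 0 by rewrite mulf_neq0 // expf_neq0.
have : val_ge v (i.+1%:Z) (P`_i * x ^+ i).
  rewrite E (val_geN dv); apply: (val_ge_sum dv) => j ji.
  have [->|Pj] := eqVneq P`_j 0; first by rewrite mul0r val_ge0.
  rewrite val_geE ?mulf_neq0 ?expf_neq0 // (valM dv) ?expf_neq0 // (valX dv) // vx natz.
  rewrite (wr _ (minp x j) Pj) add0r lez_nat ltn_neqAle imin // andbT eq_sym.
  by move: ji; rewrite -val_eqE.
rewrite val_geE // (valM dv) ?expf_neq0 // (valX dv) // vx natz (wr _ (minp x i) Pi) add0r.
by rewrite lez_nat ltnn.
Qed.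

Lemma integral_kappa a : I (kap a).
Proof.
have IX : I (kap 'X).
  have [m m0 hm] := place_ideal_neq0.
  pose m1 := (lead_coef m)^-1 *: m.
  have l0 : lead_coef m != 0 by rewrite lead_coef_eq0.
  have mm : m1 \is monic by rewrite monicE lead_coefZ mulVf.
  have hm1 : val_ge v 1 (kap m1).
    by rewrite /m1 -mul_polyC rmorphM mulrC; exact: (val_geMr dv).
  have hXm : val_ge v 1 (kap ('X * m1)).
    by rewrite mulrC rmorphM; exact: (val_geMr dv).
  have ev f : (map_poly iota f).[kap 'X] = kap f.
    rewrite /iota map_poly_comp horner_map /=; congr (kap _).
    by rewrite -[RHS]comp_polyXr.
  have sXm : size (map_poly iota ('X * m1)) = (size m1).+1.
    by rewrite size_map_poly mulrC size_mulX // monic_neq0.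
  have sm : (0 < size m1)%N by rewrite size_poly_gt0 monic_neq0.
  (* [kap 'X] satisfies the equation that sets ['X * m1] equal to its value there, a constant in the
     maximal ideal. *)
  exists (map_poly iota ('X * m1) - (kap ('X * m1))%:P).
    split; first by rewrite monicE lead_coefDl ?lead_coef_map ?lead_coefM ?lead_coefX
      ?mul1r ?(monicP mm) ?rmorph1 // sXm size_polyN (leq_ltn_trans (size_polyC_leq1 _)).
    apply: (coefs_inB hC); first by move=> i; rewrite coef_map; exact: val_const_iota.
    by apply: (coefs_inC hC); exact: val_const_id.
  by rewrite rootE hornerD hornerN hornerC ev subrr.
have -> : kap a = (map_poly iota a).[kap 'X].
  rewrite /iota map_poly_comp horner_map /=; congr (kap _).
  by rewrite -[LHS]comp_polyXr.
apply: (coefs_in_horner hI) => // i; rewrite coef_map.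
by apply: (integral_in_id hC); exact: val_const_iota.
Qed.

(** A polynomial [m] of least degree in the place ideal is coprime to [c]: a common factor divides
    [c], hence has valuation 0 and could be removed from [m]. From [s m + t c = 1], the inverse of
    [c] is [t] plus an element of the maximal ideal. *)
Lemma integral_kappaV (c : {poly Fq}) : c != 0 -> ~~ val_ge v 1 (kap c) -> I (kap c)^-1.
Proof.
move=> c0 hc; have kc0 : kap c != 0 by rewrite kappaF_eq0.
have vk (a : {poly Fq}) : a != 0 -> 0 <= v (kap a).
  by move=> a0; have := val_ge_kap a; rewrite val_geE // kappaF_eq0.
have vc : v (kap c) = 0.
  by move: hc (vk _ c0); rewrite val_geE //; move: (v _); clear; lia.
have exm : exists k, `[< exists m : {poly Fq}, [/\ m != 0, val_ge v 1 (kap m) & size m = k] >].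
  have [m m0 hm] := place_ideal_neq0; exists (size m); apply/asboolP; by exists m.
case: (ex_minnP exm) => k /asboolP[m [m0 hm Ek]] kmin.
have cop : coprimep m c.
  rewrite /coprimep; set g := gcdp m c.
  have g0 : g != 0 by rewrite gcdp_eq0 negb_and m0.
  have Em : m = m %/ g * g by rewrite divpK ?dvdp_gcdl.
  have Ec : c = c %/ g * g by rewrite divpK ?dvdp_gcdr.
  have mg0 : m %/ g != 0 by apply: contraNneq m0 => h; rewrite Em h mul0r.
  have cg0 : c %/ g != 0 by apply: contraNneq c0 => h; rewrite Ec h mul0r.
  have vg : v (kap g) = 0.
    have Ekc : kap c = kap (c %/ g) * kap g by rewrite -rmorphM -Ec.
    move: vc; rewrite Ekc (valM dv) ?kappaF_eq0 //.
    by move: (vk _ g0) (vk _ cg0); move: (v _) (v _); clear; lia.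
  have hmg : val_ge v 1 (kap (m %/ g)).
    have Ekm : kap m = kap (m %/ g) * kap g by rewrite -rmorphM -Em.
    move: hm; rewrite Ekm !val_geE ?mulf_neq0 ?kappaF_eq0 //.
    by rewrite (valM dv) ?kappaF_eq0 // vg addr0.
  have : (k <= size (m %/ g)%R)%N by apply: kmin; apply/asboolP; exists (m %/ g).
  have sg : (0 < size g)%N by rewrite size_poly_gt0.
  have sm : (0 < size m)%N by rewrite size_poly_gt0.
  rewrite size_divp // -Ek; move: sg sm; move: (size m) (size g) => x y; clear; lia.
have [s [t E]] := coprime_one cop.
have -> : (kap c)^-1 = kap (s * m) / kap c + kap t.
  by apply: (mulIf kc0); rewrite mulVf // mulrDl divfK // -rmorphM -rmorphD E rmorph1.
apply: (subringD hI); last exact: integral_kappa.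
apply: (integral_in_id hC); apply: val_const_id.
rewrite rmorphM [kap s * _]mulrC; apply: (val_geMr dv); last first.
  by rewrite val_geE ?invr_eq0 // (valV dv) // vc.
exact: (val_geMr dv).
Qed.

Lemma integral_in_alg r : (exists k, r = k%:A) -> val_ge v 0 r -> I r.
Proof.
move=> /in_alg_rep[a [c [c0 cop ->]]] hr.
have kc0 : kap c != 0 by rewrite kappaF_eq0.
apply: (subringM hI); first exact: integral_kappa.
apply: integral_kappaV => //; apply/negP => hc.
have ha : val_ge v 1 (kap a) by rewrite -(divfK kc0 (kap a)) mulrC; exact: (val_geMr dv).
have [s [t E]] := coprime_one cop.
have : val_ge v 1 (kap 1).
  rewrite -E rmorphD !rmorphM.
  by apply: (val_geD dv); rewrite mulrC; exact: (val_geMr dv).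
by rewrite rmorph1 val_geE ?oner_eq0 // (val1 dv).
Qed.

(** [d] is the largest index at which the minimal valuation of the coefficients is attained. *)
Lemma dominant_index (P : {poly F}) : P != 0 -> exists d, [/\ P`_d != 0,
  forall i, val_ge v (v P`_d) P`_i & forall i, (d < i)%N -> val_ge v (v P`_d + 1) P`_i].
Proof.
elim/poly_ind: P => [|P c IH]; first by rewrite eqxx.
have cS i : (P * 'X + c%:P)`_i.+1 = P`_i by rewrite coefD coefMX coefC /= addr0.
have c0 : (P * 'X + c%:P)`_0 = c by rewrite coefD coefMX coefC /= add0r.
have [-> h|P0 _] := eqVneq P 0.
  have cn0 : c != 0 by move: h; rewrite mul0r add0r polyC_eq0.
  exists 0%N; rewrite mul0r add0r coefC /=; split=> // i.
    by rewrite coefC; case: eqP => _; rewrite ?val_ge0 // val_geE.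
  by case: i => // i _; rewrite coefC /= val_ge0.
have [d [Pd h1 h2]] := IH P0.
have [hc|hc] := boolP (val_ge v (v P`_d) c).
  exists d.+1; rewrite cS; split=> // -[|i] //; rewrite ?c0 ?cS // => hi; exact: h2.
have cn0 : c != 0 by apply: contraNneq hc => ->; exact: val_ge0.
rewrite val_geE // -ltNge in hc.
exists 0%N; rewrite c0; split=> // [[|i]|[|i] // _]; rewrite ?c0 ?cS.
- by rewrite val_geE.
- by apply: val_ge_le (h1 i); exact: ltW.
- by apply: val_ge_le (h1 i); rewrite lezD1.
Qed.

(** The minimal polynomial over Fq(t) may have coefficients with poles at [v], so it is divided by
    its dominant coefficient. The terms above degree [d] then have positive valuation at [x]; their
    sum [z] is moved into the constant term, leaving a monic equation of degree [d]. *)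
Lemma finite_place_integral x : val_ge v 0 x -> I x.
Proof.
move=> hx; have [P [mP rP Pk]] : exists P : {poly F}, [/\ P \is monic, root P x &
    forall i, exists k, P`_i = k%:A].
  exists (minPoly 1%AS x); split; [exact: monic_minPoly|exact: root_minPoly|exact: minp].
have [d [Pd h1 h2]] := dominant_index (monic_neq0 mP).
have hxn i : val_ge v 0 (x ^+ i) by exact: (subringX (val_ge_subring dv)).
have vdiv n y : val_ge v (v P`_d + n) y -> val_ge v n (y / P`_d).
  have [->|y0] := eqVneq y 0; first by rewrite mul0r !val_ge0.
  rewrite !val_geE ?mulf_neq0 ?invr_eq0 // (valM dv) ?invr_eq0 // (valV dv) //.
  by rewrite lerBrDl.
have sd : (d < size P)%N by rewrite ltnNge; apply: contraNN Pd => h; rewrite nth_default.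
pose z := \sum_(d.+1 <= i < size P) P`_i / P`_d * x ^+ i.
have hz : val_ge v 1 z.
  rewrite /z big_nat_cond; apply: (val_ge_sum dv) => i /andP[/andP[di _] _].
  by apply: (val_geMr dv) => //; apply: vdiv; exact: h2.
pose lo := \poly_(i < d) (P`_i / P`_d) + z%:P.
have E : ('X^d + lo).[x] = 0.
  rewrite hornerD hornerXn /lo hornerD hornerC horner_poly.
  have : P.[x] / P`_d = 0 by rewrite (rootP rP) mul0r.
  rewrite horner_coef -(big_mkord xpredT (fun i => P`_i * x ^+ i)).
  rewrite (big_cat_nat (leq0n d) (ltnW sd)) /= (big_ltn sd) big_mkord.
  rewrite !mulrDl !mulr_suml (mulrAC P`_d) divff // mul1r => h; rewrite -[RHS]h.
  rewrite addrCA; congr (_ + (_ + _)); last by rewrite /z; apply: eq_bigr => i _; rewrite mulrAC.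
  by apply: eq_bigr => i _; rewrite mulrAC.
(* For [d = 0] the equation would read [1 + z = 0] with [z] of positive valuation. *)
case: (posnP d) => [d0|d_gt0].
  move: E; rewrite /lo d0 poly_def big_ord0 add0r hornerD hornerXn hornerC expr0 => /eqP.
  rewrite addr_eq0 => /eqP E; move: hz; rewrite -(opprK z) -E (val_geN dv).
  by rewrite val_geE ?oner_eq0 // (val1 dv).
have slo : (size lo < size ('X^d : {poly F}))%N.
  rewrite size_polyXn ltnS (leq_trans (size_polyD _ _)) // geq_max size_poly.
  by rewrite (leq_trans (size_polyC_leq1 _)).
apply: (integral_in_trans hC (g := 'X^d + lo)).
- by rewrite monicE lead_coefDl // lead_coefXn.
- move=> i; rewrite !coefD coefXn coef_poly coefC.
  apply: (subringD hI); first by case: eqP => _; [exact: (subring1 hI)|exact: (subring0 hI)].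
  apply: (subringD hI); last first.
    case: eqP => _; last exact: (subring0 hI).
    by apply: (integral_in_id hC); exact: val_const_id.
  case: ifP => _; last exact: (subring0 hI).
  have h0 : val_ge v 0 (P`_i / P`_d) by apply: vdiv; rewrite addr0.
  apply: integral_in_alg h0; have [k ->] := Pk i; have [k' ->] := Pk d; exists (k / k').
  by rewrite -!in_algE rmorphM fmorphV.
- exact/rootP.
Qed.

Lemma finite_place_residue x : val_ge v 0 x ->
  exists2 G : {poly Fq}, G \is monic & val_ge v 1 (map_poly iota G).[x].
Proof.
move=> hx; apply: (integral_val_const dv) => //; exact: finite_place_integral.
Qed.

(** By density [a] is congruent to some [j x], and the difference of the values of [G] at [a] and
    [j x] is a multiple of [a - j x]. *)
Lemma completion_residue (Fp : fieldType) (j : {rmorphism F -> Fp}) (w : Fp -> int)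
    (iotaK : {rmorphism Fq -> Fp}) : iotaK =1 j \o iota ->
  is_completion v j w -> forall a, val_ge w 0 a ->
  exists2 G : {poly Fq}, G \is monic & val_ge w 1 (map_poly iotaK G).[a].
Proof.
move=> iE hw a ha; have dw := compl_dv hw.
have wj n x : val_ge w n (j x) = val_ge v n x.
  have [->|x0] := eqVneq x 0; first by rewrite rmorph0 !val_ge0.
  by rewrite !val_geE ?fmorph_eq0 // (compl_ext hw).
have [x hx] := compl_dense hw 1 a.
have hx0 : val_ge v 0 x.
  rewrite -wj -[j x](subKr a); apply: (val_geB dw) => //.
  by apply: val_ge_le hx.
have [G mG hG] := finite_place_residue hx0; exists G => //.
have hO := val_ge_subring dw.
have hOj : val_ge w 0 (j x) by rewrite wj.
have GO : coefs_in (val_ge w 0) (map_poly iotaK G).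
  by move=> i; rewrite coef_map /= iE /= wj; exact: iotaO.
have cX : coefs_in (val_ge w 0) ('X - (j x)%:P).
  by apply: (coefs_inB hO); [exact: (coefs_in_X hO)|exact: (coefs_inC hO)].
have [Q [R [E QO _ sR]]] := monic_division (subring0 hO)
  (fun x y => subringD hO (x:=x) (y:=y)) (subringB hO) (subringM hO) GO (monicXsubC (j x)) cX.
move: sR; rewrite size_XsubC ltnS => /size1_polyC ER.
have R0 : R`_0 = j (map_poly iota G).[x].
  have := congr1 (fun p => p.[j x]) E; rewrite /= ER hornerD hornerM hornerXsubC subrr mulr0.
  rewrite add0r hornerC coefC /= => <-.
  rewrite -horner_map -map_poly_comp; congr (_.[_]); exact: eq_map_poly.
rewrite E ER R0 hornerD hornerM hornerXsubC hornerC; apply: (val_geD dw); last by rewrite wj.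
rewrite mulrC; apply: (val_geMr dw) => //; exact: (coefs_in_horner hO).
Qed.

End FinitePlace.

(** * Extension classes *)

Section Equivalence.
Variables (Fq : finFieldType) (K : fieldType) (kappa : {rmorphism {poly Fq} -> K}).
Local Notation q := #|Fq|.
Let ik : {rmorphism Fq -> K} := kappa \o polyC.

Lemma to_fracM m n p (A : 'M[{poly K}]_(m, n)) (B : 'M_(n, p)) :
  to_frac (A *m B) = to_frac A *m to_frac B.
Proof. exact: map_mxM. Qed.

Lemma twistM m n p (A : 'M[{poly K}]_(m, n)) (B : 'M_(n, p)) :
  twist q (A *m B) = twist q A *m twist q B.
Proof.
apply/matrixP=> i j; rewrite !mxE.
rewrite (big_morph (map_poly (fun x : K => x ^+ q)) (frob_polyD ik) (map_poly0 _)).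
by apply: eq_bigr => k _; rewrite (frob_polyM ik) !mxE.
Qed.

Section Fixed.
Variables (r : nat) (M : motive kappa r).
Implicit Types E : extension M.

Lemma ext_equiv_refl E : ext_equiv E E.
Proof.
exists 1%:M; split; rewrite ?unitmx1 ?mul1mx ?mulmx1 //.
by rewrite /morphism /tauM twist1 /to_frac map_mx1 mul1mx mulmx1.
Qed.

Lemma ext_equiv_trans E1 E2 E3 : ext_equiv E1 E2 -> ext_equiv E2 E3 -> ext_equiv E1 E3.
Proof.
move=> [g [ug mg ig pg]] [h [uh mh ih ph]]; exists (h *m g); split.
- by rewrite unitmx_mul uh.
- by rewrite /morphism /tauM to_fracM -mulmxA mg /tauM mulmxA mh /tauM twistM to_fracM mulmxA.
- by rewrite -mulmxA ig.
- by rewrite mulmxA ph.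
Qed.

Lemma ext_equiv_sym E1 E2 : ext_equiv E1 E2 -> ext_equiv E2 E1.
Proof.
move=> [g [ug mg ig pg]]; exists (invmx g); split.
- by rewrite unitmx_inv.
- rewrite /morphism /tauM.
  have Eg : to_frac (invmx g) *m to_frac g = 1%:M.
    by rewrite -to_fracM mulVmx // /to_frac map_mx1.
  have Et : to_frac (twist q g) *m to_frac (twist q (invmx g)) = 1%:M.
    by rewrite -to_fracM -twistM mulmxV // twist1 /to_frac map_mx1.
  by rewrite -[LHS]mulmx1 -Et mulmxA -[to_frac (invmx g) *m _ *m _]mulmxA
    -[X in _ *m X *m _]mg mulmxA Eg mul1mx.
- by rewrite -ig mulKmx.
- by rewrite -pg mulmxK.
Qed.

Lemma ext_classP E1 E2 : ext_class E1 = ext_class E2 <-> ext_equiv E1 E2.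
Proof.
split=> [h|h].
  have : ext_class E2 E2 by exact: ext_equiv_refl.
  by rewrite -h.
apply/seteqP; split=> E /= hE; last exact: ext_equiv_trans hE.
exact: ext_equiv_trans (ext_equiv_sym h) hE.
Qed.

(** The unipotent matrix with upper right entry [f] is the isomorphism. *)
Lemma iota_equiv (m m' : 'M[{fraction {poly K}}]_(r, 1)) (hm : localize kappa setT m)
    (hm' : localize kappa setT m') (f : 'M[{poly K}]_(r, 1)) :
  m + to_frac f = m' + tauM M f -> ext_equiv (Defs.iota M hm) (Defs.iota M hm').
Proof.
move=> E; exists (block_mx 1%:M f 0 1%:M); split.
- by rewrite unitmxE det_ublock !det1 mulr1 unitr1.
- rewrite /morphism /tauM /= /twist !map_block_mx -!/(twist q _) !twist1 twist0.
  rewrite /to_frac !map_block_mx !map_mx1 !map_mx0 !mulmx_block.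
  rewrite !(mul1mx, mulmx1, mul0mx, mulmx0, addr0, add0r).
  by congr block_mx; move: E; rewrite /tauM /to_frac => ->; rewrite addrC.
- by rewrite mul_block_col !(mul1mx, mulmx1, mul0mx, mulmx0, addr0, add0r).
- by rewrite mul_row_block !(mul1mx, mulmx1, mul0mx, mulmx0, addr0, add0r).
Qed.

End Fixed.

Definition is_poly_mx m n (A : 'M[{fraction {poly K}}]_(m, n)) := exists y, A = to_frac y.

Lemma is_poly_mxM m n p (A : 'M_(m, n)) (B : 'M_(n, p)) :
  is_poly_mx A -> is_poly_mx B -> is_poly_mx (A *m B).
Proof. by move=> [x ->] [y ->]; exists (x *m y); rewrite to_fracM. Qed.

Lemma to_frac_inv n (A : 'M[{poly K}]_n) : A \in unitmx ->
  to_frac A *m to_frac (invmx A) = 1%:M /\ to_frac (invmx A) *m to_frac A = 1%:M.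
Proof. by move=> uA; rewrite -!to_fracM mulmxV // mulVmx // /to_frac map_mx1. Qed.

(** How regulatedness enters the proof: equal slopes give equal diagonal parts up to factors
    invertible over K[t], hence the same bound on denominators. *)
Lemma hodge_is_poly r (N N' : motive kappa r) c :
  same_hodge_polygon N N' -> is_poly_mx (c *: Phi N') -> is_poly_mx (c *: Phi N).
Proof.
move=> [w [[_ [P [Q [uP uQ EN]]]] [_ [P' [Q' [uP' uQ' EN']]]]]] h.
have ED : diag_mx (\row_i jgen kappa ^ tnth w i) =
    to_frac (invmx P') *m Phi N' *m to_frac (invmx Q').
  rewrite EN' !mulmxA (to_frac_inv uP').2 mul1mx -mulmxA (to_frac_inv uQ').1.
  by rewrite mulmx1.
rewrite EN ED -!mulmxA scalemxAr scalemxAr scalemxAl.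
apply: is_poly_mxM; first by exists P.
apply: is_poly_mxM; first by exists (invmx P').
by apply: is_poly_mxM => //; apply: is_poly_mxM; [exists (invmx Q')|exists Q].
Qed.

Lemma equiv_is_poly r (M : motive kappa r) (E E' : extension M) c :
  ext_equiv E E' -> is_poly_mx (c *: Phi E) -> is_poly_mx (c *: Phi E').
Proof.
move=> [g [ug mg _ _]] h.
have Et : to_frac (twist q g) *m to_frac (twist q (invmx g)) = 1%:M.
  by rewrite -to_fracM -twistM mulmxV // twist1 /to_frac map_mx1.
have -> : Phi E' = to_frac g *m Phi E *m to_frac (twist q (invmx g)).
  by rewrite mg /tauM -mulmxA Et mulmx1.
rewrite scalemxAl scalemxAr; apply: is_poly_mxM; last by exists (twist q (invmx g)).
by apply: is_poly_mxM => //; exists g.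
Qed.

Lemma regulated_is_poly n (m : 'M[{fraction {poly K}}]_(1, 1)) (hm : localize kappa setT m) :
  Ext1reg (carlitz_dual kappa n) (ext_class (Defs.iota (carlitz_dual kappa n) hm)) ->
  exists y, jgen kappa ^+ n *: m = to_frac y.
Proof.
move=> [E /ext_classP EE hod].
have h : is_poly_mx (jgen kappa ^+ n *: Phi (direct_sum (carlitz_dual kappa n) (unit_motive kappa))).
  exists (block_mx 1%:M 0 0 (('X - (kappa 'X)%:P) ^+ n)%:M).
  rewrite /= scale_block_mx !scaler0 !scale_scalar_mx mulr1 divff; last first.
    by rewrite expf_neq0 // jgen_neq0.
  rewrite /to_frac map_block_mx !map_mx0 map_mx1 map_scalar_mx /=.
  by congr (block_mx _ _ _ _%:M); rewrite [RHS]rmorphXn.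
have [y Ey] := equiv_is_poly (ext_equiv_sym EE) (hodge_is_poly hod h).
exists (ursubmx y); move: Ey; rewrite /= scale_block_mx => Ey.
have := congr1 ursubmx Ey; rewrite block_mxKur => ->.
by rewrite /to_frac map_ursubmx.
Qed.

End Equivalence.

(** * Integral models and the comparison *)

Section GaussNorm.
Variables (K : fieldType) (w : K -> int) (dv : discrete_valuation w).
Variables (theta : K) (Otheta : val_ge w 0 theta).
Local Notation lin := ('X - theta%:P).

Lemma gauss_mul s (p : {poly K}) n :
  coefs_in (val_ge w s) p -> coefs_in (val_ge w s) (lin ^+ n * p).
Proof.
move=> hp; elim: n => [|n IH]; first by rewrite mul1r.
rewrite exprS -mulrA mulrBl => i; rewrite coefB coefXM coefCM; apply: (val_geB dv).
  by case: eqP => _; [exact: val_ge0|exact: IH].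
by rewrite mulrC; exact: (val_geMr dv).
Qed.

(** Descending induction: the coefficient of degree [i] of [f] is that of degree [i.+1] in the
    product plus [theta] times the next coefficient of [f]. *)
Lemma gauss_div s (p : {poly K}) n :
  coefs_in (val_ge w s) (lin ^+ n * p) -> coefs_in (val_ge w s) p.
Proof.
elim: n => [|n IH]; first by rewrite mul1r.
rewrite exprS -mulrA => h; apply: IH; move: h; set f := _ ^+ n * p => h.
suff H k i : (size f <= i + k)%N -> val_ge w s f`_i by move=> i; apply: (H (size f)); exact: leq_addl.
elim: k i => [|k IH] i hi; first by rewrite nth_default ?val_ge0 // -(addn0 i).
have := h i.+1; rewrite mulrBl coefB coefXM coefCM /= => hf.
rewrite -(subrK (theta * f`_i.+1) f`_i); apply: (val_geD dv) => //.
by rewrite mulrC; apply: (val_geMr dv) => //; apply: IH; rewrite addSnnS.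
Qed.

End GaussNorm.

Section IntegralModel.
Variables (Fq : finFieldType) (K : fieldType) (kappa : {rmorphism {poly Fq} -> K}).
Variables (w : K -> int) (dv : discrete_valuation w).
Hypothesis Okappa : forall a, val_ge w 0 (kappa a).
Variable n : nat.
Local Notation q := #|Fq|.
Local Notation M := (carlitz_dual kappa n).
Local Notation theta := (kappa 'X).
Local Notation jg := (jgen kappa).
Let ik : {rmorphism Fq -> K} := kappa \o polyC.

Lemma jgen_pow N : jg ^+ N = tofrac (('X - theta%:P) ^+ N).
Proof. by rewrite rmorphXn. Qed.

Lemma poly_eq_of_frac (m : 'M[{fraction {poly K}}]_(1, 1)) N N' (y z : 'M[{poly K}]_(1, 1)) :
  jg ^+ N *: m = to_frac y -> jg ^+ N' *: m = to_frac z ->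
  ('X - theta%:P) ^+ N * z 0 0 = ('X - theta%:P) ^+ N' * y 0 0.
Proof.
move=> Ey Ez; apply/eqP; rewrite -tofrac_eq !rmorphM /= -!jgen_pow.
have := congr1 (fun A : 'M_1 => A 0 0) Ey; have := congr1 (fun A : 'M_1 => A 0 0) Ez.
by rewrite !mxE => <- <-; rewrite mulrCA.
Qed.

Lemma frac_eq_of_poly (m : 'M[{fraction {poly K}}]_(1, 1)) N (y : {poly K}) :
  jg ^+ N * m 0 0 = tofrac y -> jg ^+ N *: m = to_frac (y%:M : 'M_1).
Proof. by move=> E; apply/matrixP=> i j; rewrite !ord1 !mxE E mulr1n. Qed.

Lemma integral_model_sub L : integral_model w M L ->
  forall f, L f -> polyO w f.
Proof.
move=> [[d [G [-> _]]] stab].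
set L' := [set _ | _ in _] in stab *.
have hO := val_ge_subring dv.
have [e he] : exists e : nat, forall f, L' f -> coefs_in (val_ge w (- e%:Z)) (f 0 0).
  have ex (k : 'I_d) : exists e : nat, forall i, val_ge w (- e%:Z) (G 0 k)`_i.
    exact: val_poly_bound.
  have [B hB] := choice ex.
  exists (\max_k B k)%N => f [c hc <-] i; rewrite mxE coef_sum.
  apply: (val_ge_sum dv) => k _; rewrite coefM; apply: (val_ge_sum dv) => s _.
  apply: (val_geMr dv); last exact: hc.
  by apply: val_ge_le (hB k s); rewrite lerN2 lez_nat leq_bigmax.
(* A pole of order [s.+1] in [f] would give one of order [q * s.+1] in its twist. By stability the
   twist agrees with an element of [L'] up to powers of [t - theta], which do not change the order
   of poles; so the order is at most [s.+1], a contradiction. *)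
have step (s : nat) : (forall f, L' f -> coefs_in (val_ge w (- s.+1%:Z)) (f 0 0)) ->
    forall f, L' f -> coefs_in (val_ge w (- s%:Z)) (f 0 0).
  move=> hs f Lf; have [N [y Ly Ey]] := stab _ Lf.
  have E : ('X - theta%:P) ^+ N * map_poly (fun x => x ^+ q) (f 0 0) =
      ('X - theta%:P) ^+ n * y 0 0.
    have E1 : jg ^+ n *: tauM M f = to_frac (twist q f).
      rewrite /tauM /= mul_scalar_mx scalerA divff ?scale1r //.
      by rewrite expf_neq0 // jgen_neq0.
    have := poly_eq_of_frac Ey E1; by rewrite mxE.
  have := gauss_mul dv (Okappa 'X) n (hs _ Ly); rewrite -E.
  move/(gauss_div dv (Okappa 'X)) => h i; have := h i; rewrite (coef_frob Fq).
  have [->|f0] := eqVneq (f 0 0)`_i 0; first by rewrite val_ge0.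
  rewrite !val_geE ?expf_neq0 // (valX dv) // -mulr_natl natz.
  have := card_gt1 Fq; move: (w _) (q) => x Q; clear => hQ h1.
  rewrite lerNl leNgt; apply/negP => h2.
  have : s.+1%:Z <= - x by lia.
  by move: h1 h2 hQ; nia.
have all0 s : (forall f, L' f -> coefs_in (val_ge w (- s%:Z)) (f 0 0)) ->
    forall f, L' f -> coefs_in (val_ge w 0) (f 0 0).
  by elim: s => [|s IH] // hs; apply: IH; exact: step.
move=> f Lf i j k; rewrite !ord1; exact: (all0 e he f Lf).
Qed.

Lemma max_integral_model_O : max_integral_model w M [set f | polyO w f].
Proof.
split; last by move=> L' /integral_model_sub h f /h.
split; last first.
  move=> x hx; exists n, (twist q x) => /=.
    move=> i j k; rewrite mxE (coef_frob Fq).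
    exact: (subringX (val_ge_subring dv)).
  rewrite /tauM /= mul_scalar_mx scalerA divff ?scale1r //.
  by rewrite expf_neq0 // jgen_neq0.
exists 1%N, 1%:M; split; last by move=> x; exists x; rewrite mul1mx.
apply/seteqP; split=> f /=; first by move=> hf; exists f => //; rewrite mul1mx.
by move=> [c hc <-]; rewrite mul1mx.
Qed.

(** If [y = Q g + R] with [g = (t - theta)^n], choosing [f = - Q] replaces [y] by [R] plus the twist
    of [Q]. Twisting does not raise the degree, and that of [Q] has dropped by [n > 0]. *)
Lemma reduce_degree (y : {poly K}) : (0 < n)%N -> exists f : {poly K},
  (size (y + ('X - theta%:P) ^+ n * f - map_poly (fun x => x ^+ q) f)%R <= n)%N.
Proof.
move=> n0; have [s] := ubnP (size y); elim: s y => // s IH y /ltnSE sy.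
have [le|lt] := leqP (size y) n.
  by exists 0; rewrite mulr0 addr0 map_poly0 subr0.
pose g : {poly K} := ('X - theta%:P) ^+ n.
have sg : size g = n.+1 by rewrite size_exp_XsubC.
have g0 : g != 0 by rewrite -size_poly_gt0 sg.
pose Q := y %/ g; pose R := y %% g.
have E : y = Q * g + R by exact: divp_eq.
have sR : (size R <= n)%N by rewrite -ltnS -sg ltn_modp.
have sQ : (size Q <= size y - n)%N by rewrite size_divp // sg.
pose tw := map_poly (fun x : K => x ^+ q).
have stQ : (size (tw Q) <= size Q)%N by exact: size_poly.
have [|f hf] := IH (R + tw Q).
  apply: (leq_ltn_trans (size_polyD _ _)); rewrite gtn_max.
  rewrite (leq_trans (leq_ltn_trans sR lt) sy) (leq_ltn_trans (leq_trans stQ sQ)) //.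
  by move: lt n0 sy; move: (size y) => x; clear; lia.
exists (f - Q); move: hf; congr (_ <= _)%N; congr (size (polyseq _)).
by rewrite (frob_polyB ik) E /tw /g; ring.
Qed.

End IntegralModel.

(** The ideal of [l] is maximal and the place ideal is proper, so containing [l] would make them
    equal. *)
Lemma place_ideal_not_dvd (Fq : finFieldType) (F : fieldExtType {fraction {poly Fq}})
    (v : F -> int) (l : {poly Fq}) : finite_place v -> irreducible_poly l ->
  [set a : {poly Fq} | l %| a] <> place_ideal v -> ~~ val_ge v 1 (kappaF F l).
Proof.
move=> [dv hv] [sl irl] hl; apply/negP => vl; apply: hl.
apply/seteqP; split=> a /= ha.
  move/dvdpP: ha => [c ->]; rewrite /place_ideal mulrC.
  change (val_ge v 1 (kappaF F (l * c))); rewrite rmorphM.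
  by apply: (val_geMr dv) => //; exact: hv.
apply/negPn/negP => nla.
have cop : coprimep l a.
  apply/negPn/negP => ncop; move/negP: nla; apply.
  have : gcdp l a %= l by apply: irl => //; exact: dvdp_gcdl.
  by move/eqp_dvdl <-; exact: dvdp_gcdr.
have [[s t] /= E] := Bezout_eq1_coprimepP _ _ cop.
have : val_ge v 1 (kappaF F (s * l + t * a)).
  by rewrite rmorphD !rmorphM; apply: (val_geD dv); rewrite mulrC; apply: (val_geMr dv) => //; exact: hv.
by rewrite E rmorph1 val_geE ?oner_eq0 // (val1 dv).
Qed.

Section Comparison.
Variables (Fq : finFieldType) (K : fieldType) (kappa : {rmorphism {poly Fq} -> K}).
Variables (w : K -> int) (dv : discrete_valuation w) (cw : val_complete w).
Variables (L : closedFieldType) (b : {rmorphism K -> L}) (hb : algebraic_closure b).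
Hypothesis Okappa : forall a, val_ge w 0 (kappa a).
Let ik : {rmorphism Fq -> K} := kappa \o polyC.
Hypothesis hres : forall a, val_ge w 0 a ->
  exists2 G : {poly Fq}, G \is monic & val_ge w 1 (map_poly ik G).[a].
Variables (l : {poly Fq}) (irl : irreducible_poly l).
Hypotheses (kl0 : kappa l != 0) (wkl : w (kappa l) = 0).
Variables (n : nat) (n0 : (0 < n)%N) (pn : [pchar Fq].-nat n).
Local Notation q := #|Fq|.
Local Notation M := (carlitz_dual kappa n).
Local Notation theta := (kappa 'X).
Local Notation jg := (jgen kappa).
Let iL : {rmorphism Fq -> L} := b \o ik.
(** [l] is only assumed irreducible; the divisions above need a monic modulus. *)
Let ln := (lead_coef l)^-1 *: l.

Let l0 : l != 0.
Proof. by rewrite -size_poly_gt0; have [h _] := irl; exact: ltnW. Qed.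

Let lc0 : lead_coef l != 0. Proof. by rewrite lead_coef_eq0. Qed.

Let lnE : ln %= l.
Proof. by apply: eqp_scale; rewrite invr_eq0. Qed.

Let monic_ln : ln \is monic.
Proof. by rewrite monicE lead_coefZ mulVf. Qed.

Let irr_ln : irreducible_poly ln.
Proof.
have [h1 h2] := irl; split; first by rewrite (eqp_size lnE).
move=> g sg dg; rewrite (eqp_trans (h2 g sg _)) 1?eqp_sym //.
by rewrite -(eqp_dvdr _ lnE).
Qed.

Let kappa_eval (a : {poly Fq}) : (map_poly ik a).[theta] = kappa a.
Proof.
rewrite /ik map_poly_comp horner_map /=; congr (kappa _).
by rewrite -[RHS]comp_polyXr.
Qed.

Let ln_eval : (map_poly ik ln).[theta] != 0 /\ w (map_poly ik ln).[theta] = 0.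
Proof.
have c0 : kappa (lead_coef l)^-1%:P != 0.
  by rewrite (fmorph_eq0 ik) invr_eq0.
have wc : w (kappa (lead_coef l)^-1%:P) = 0.
  have := Okappa (lead_coef l)^-1%:P; rewrite val_geE // => h1.
  have := Okappa (lead_coef l)%:P; rewrite val_geE; last by rewrite (fmorph_eq0 ik).
  have : kappa (lead_coef l)^-1%:P * kappa (lead_coef l)%:P = 1.
    by rewrite -rmorphM -polyCM mulVf // rmorph1.
  move/(congr1 w); rewrite (valM dv) // ?(fmorph_eq0 ik) // (val1 dv) => E h2.
  by move: h1 h2 E; lia.
rewrite kappa_eval /ln -mul_polyC rmorphM; split; first exact: mulf_neq0.
by rewrite (valM dv) // wc wkl.
Qed.

Let ellE (i : nat) (f : {poly L}) : (ellL kappa b l ^+ i %| f) = (map_poly iL ln ^+ i %| f).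
Proof.
apply: eqp_dvdl; apply: eqp_exp.
have -> : ellL kappa b l = map_poly iL l by [].
by rewrite eqp_map eqp_sym.
Qed.

Lemma good_of_integral (m : 'M[{fraction {poly K}}]_(1, 1)) (hm : localize kappa setT m) y :
  jg ^+ n *: m = to_frac y -> coefs_in (val_ge w 0) (y 0 0) ->
  Ext1good w b l M (ext_class (Defs.iota M hm)).
Proof.
move=> Ey hy; have [u u0 wu] := dv_norm dv.
have [ln0 wln] := ln_eval.
have [xi hxi] := forward_solution dv cw u0 wu hb hres n (Okappa 'X) irr_ln monic_ln ln0 wln hy.
exists m, hm; split=> //; exists (fun i => (xi i)%:M).
  split=> [i a c k|i a c]; rewrite !ord1 !mxE !mulr1n.
    by have [h _ _] := hxi i; exact: (Wur_unramified dv cw u0 wu hb hres (h k)).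
  by rewrite ellE; have [_ h _] := hxi i.
exists n, 1%:M, y; split=> //.
  rewrite /= scale_scalar_mx divff ?expf_neq0 ?jgen_neq0 //.
  by rewrite /to_frac map_mx1.
move=> i a c; rewrite !ord1 map_mx1 mul1mx !mxE !mulr1n ellE.
by have [_ _ h] := hxi i.
Qed.

Lemma integral_of_good (m : 'M[{fraction {poly K}}]_(1, 1)) (hm : localize kappa setT m) y xi :
  jg ^+ n *: m = to_frac y -> in_completion kappa w b l xi -> solves b l M xi m ->
  exists m' (hm' : localize kappa setT m'), localize kappa [set f | polyO w f] m' /\
    ext_class (Defs.iota M hm) = ext_class (Defs.iota M hm').
Proof.
move=> Ey [ur _] [N [P [y' [EP Ey' sol]]]]; have [u u0 wu] := dv_norm dv.
have [ln0 wln] := ln_eval.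
pose tw (E : fieldType) := map_poly (fun x : E => x ^+ q).
pose J : {poly L} := 'X - (b theta)%:P.
have sol1 i : map_poly iL ln ^+ i %| J ^+ n * xi i 0 0 - tw L (xi i 0 0) - map_poly b (y 0 0).
  have := sol i 0 0; rewrite ellE !mxE big_ord1 !mxE => h.
  have EPn : ('X - theta%:P) ^+ n * P 0 0 = ('X - theta%:P) ^+ N.
    have E1 : jg ^+ n *: Phi M = to_frac (1%:M : 'M_1).
      rewrite /= scale_scalar_mx divff ?expf_neq0 ?jgen_neq0 //.
      by rewrite /to_frac map_mx1.
    by rewrite (poly_eq_of_frac E1 EP) mxE mulr1n mulr1.
  have Eyn : ('X - theta%:P) ^+ n * y' 0 0 = ('X - theta%:P) ^+ N * y 0 0.
    exact: poly_eq_of_frac Ey Ey'.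
  have JE k : J ^+ k = map_poly b (('X - theta%:P) ^+ k).
    by rewrite rmorphXn rmorphB /= map_polyX map_polyC.
  (* [ln] does not vanish at [theta], so [t - theta] is invertible modulo its powers. This allows
     the exponent [N] provided by [solves] to be exchanged for [n]. *)
  have cop : coprimep (map_poly iL ln ^+ i) (J ^+ N).
    rewrite coprimep_expl // coprimep_expr // coprimep_XsubC rootE.
    by rewrite /iL map_poly_comp horner_map fmorph_eq0.
  rewrite -(Gauss_dvdpr _ cop).
  have -> : J ^+ N * (J ^+ n * xi i 0 0 - tw L (xi i 0 0) - map_poly b (y 0 0)) =
     J ^+ n * (J ^+ N * xi i 0 0 - map_poly b (P 0 0) * tw L (xi i 0 0) - map_poly b (y' 0 0)).
    rewrite !mulrBr [J ^+ n * (map_poly b (P 0 0) * _)]mulrA !(JE n) (JE N) -!rmorphM /= EPn Eyn.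
    by rewrite !rmorphM /=; ring.
  by apply: dvdp_mull.
have [f sf] := reduce_degree kappa (y 0 0) n0.
set y0 := _ - _ in sf.
have Oy0 : coefs_in (val_ge w 0) y0.
  have [sl _] := irr_ln.
  apply: (backward_bound dv cw u0 wu hb hres n0 (Okappa 'X) pn sf monic_ln sl) => i.
  (* Replacing [y] by [y0] changes the solution by [f], whose coefficients lie in K. *)
  exists (xi i 0 0 + map_poly b f).
    move=> k; rewrite coefD coef_map; apply: (approxD dv u0 wu).
      exact: (unramified_approx dv cw u0 wu hb hres (ur i 0 0 k)).
    exact: (approx_K Fq dv u0 wu b).
  have := sol1 i; congr (is_true (_ %| _)).
  have twb : map_poly b (tw K f) = tw L (map_poly b f).
    by apply/polyP=> k; rewrite /tw coef_map !(coef_frob Fq) coef_map /= rmorphXn.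
  rewrite /y0 !rmorphD rmorphN rmorphM rmorphXn rmorphB /= map_polyX map_polyC /=.
  rewrite -/(tw K f) twb /tw (frob_polyD iL) /J; ring.
pose m' : 'M[{fraction {poly K}}]_1 := (jg ^- n * tofrac y0)%:M.
have Em' : jg ^+ n *: m' = to_frac (y0%:M : 'M_1).
  apply: frac_eq_of_poly; rewrite mxE mulr1n mulrA divff ?mul1r //.
  by rewrite expf_neq0 // jgen_neq0.
have hm' : localize kappa setT m' by exists n, y0%:M.
exists m', hm'; split.
  by exists n, y0%:M => // a c k; rewrite !ord1 mxE mulr1n.
apply/ext_classP; apply: (@iota_equiv _ _ _ _ _ _ _ _ _ (f%:M : 'M_1)).
have jn0 : jg ^+ n != 0 by rewrite expf_neq0 // jgen_neq0.
apply: (scalerI jn0); rewrite !scalerDr Ey Em'.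
rewrite /tauM /= mul_scalar_mx scalerA (divff jn0) scale1r.
apply/matrixP=> a c; rewrite !ord1 !mxE !mulr1n jgen_pow -rmorphM -!rmorphD; congr tofrac.
by rewrite /y0; ring.
Qed.

Lemma comparison : Ext1O w M `&` Ext1reg M = Ext1good w b l M `&` Ext1reg M.
Proof.
apply/seteqP; split=> C [hC reg]; split=> //.
  have [MO [[imMO _] [m [hm [lm EC]]]]] := hC; rewrite EC in reg *.
  have [y Ey] := regulated_is_poly reg.
  apply: (good_of_integral hm Ey).
  have [N [z Lz Ez]] := lm.
  have Oz := integral_model_sub dv Okappa imMO Lz.
  (* Both [y] and the integral [z] represent [m] up to powers of [t - theta], which preserve the
     Gauss norm; hence [y] is integral. *)
  apply: (gauss_div dv (Okappa 'X) (n := N)).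
  rewrite -(poly_eq_of_frac Ey Ez); apply: (gauss_mul dv (Okappa 'X)).
  exact: Oz.
have [m [hm [[xi cxi sxi] EC]]] := hC; rewrite EC in reg *.
have [y Ey] := regulated_is_poly reg.
have [m' [hm' [lm' EC']]] := integral_of_good hm Ey cxi sxi.
exists [set f | polyO w f]; split; first exact: max_integral_model_O.
by exists m', hm'.
Qed.

End Comparison.

Theorem theorem5p18
  (Fq : finFieldType) (F : fieldExtType {fraction {poly Fq}})
  (v : F -> int) (hv : finite_place v)
  (Fp : fieldType) (j : {rmorphism F -> Fp}) (w : Fp -> int)
  (hw : is_completion v j w)
  (L : closedFieldType) (b : {rmorphism Fp -> L}) (hb : algebraic_closure b)
  (l : {poly Fq}) (hl : irreducible_poly l)
  (hlm : [set a : {poly Fq} | l %| a] <> place_ideal v)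
  (p k : nat) (hp : p \in [pchar Fq]) :
  let M := carlitz_dual (kappa_completion j) (p ^ k) in
  Ext1O w M `&` Ext1reg M = Ext1good w b l M `&` Ext1reg M.

Proof.
have dw := compl_dv hw.
have vl := place_ideal_not_dvd hv hl hlm.
have kE a : kappa_completion j a = j (kappaF F a) by [].
have wk a : val_ge w 0 (kappa_completion j a).
  have [->|a0] := eqVneq a 0; first by rewrite rmorph0 val_ge0.
  have k0 : kappaF F a != 0 by rewrite kappaF_eq0.
  have jk0 : j (kappaF F a) != 0 by rewrite (fmorph_eq0 j).
  rewrite kE (val_geE _ _ jk0) (compl_ext hw k0) -(val_geE _ _ k0).
  exact: hv.2.
have l0 : kappaF F l != 0 by apply: contraNneq vl => ->; exact: val_ge0.
have wl : w (kappa_completion j l) = 0.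
  rewrite kE (compl_ext hw l0); move: vl (hv.2 l); rewrite !val_geE //.
  by move: (v _) => x; lia.
have n0 : (0 < p ^ k)%N by rewrite expn_gt0 prime_gt0 // (pcharf_prime hp).
have pn : [pchar Fq].-nat (p ^ k)%N.
  by rewrite pnatX; apply/orP; left; rewrite pnatE // (pcharf_prime hp).
apply: (comparison dw (compl_complete hw) hb wk _ hl _ wl n0 pn).
  by apply: (completion_residue hv _ hw) => c.
by rewrite kE (fmorph_eq0 j).
Qed.
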